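(* Let $\mathcal C$ be a strict BTC over $\mathbb F$ that is modular and let $\mathcal S\subset\mathcal C$ be a full tensor subcategory which is a finite admissible STC, $\mathcal S\simeq\mathrm{Rep}\,G$. Then $\mathcal C\rtimes\mathcal S$ has full $G$-spectrum (for every $g\in G$ there is a nonzero object of grade $g$), and $(\mathcal C\rtimes\mathcal S)_e$ is modular.
   Context: **Categories.** $\mathbb F$ is an algebraically closed field of characteristic zero. A BTC is a semisimple $\mathbb F$-linear rigid braided ribbon category with finite dimensional $\mathrm{Hom}$-spaces and $\mathrm{End}\,\mathbf 1=\mathbb F\,\mathrm{id}_{\mathbf 1}$; it carries a canonical spherical structure with dimension function $d$. It is modular if it has finitely many isomorphism classes of simple objects and its $S$-matrix is invertible; equivalently it is finite and $Z_2(\mathcal C)$ (the full subcategory of those $X$ with $c_{X,Y}\circ c_{Y,X}=\mathrm{id}$ for all $Y\in\mathcal C$) consists only of multiples of $\mathbf 1$. For each object $X$ with dual $\overline X$ let $\varepsilon_X:\mathbf 1\to X\otimes\overline X$ and $\overline\varepsilon_X:X\otimes\overline X\to\mathbf 1$ be the duality morphisms of the spherical structure, so that $\overline\varepsilon_X\circ(s\otimes\mathrm{id}_{\overline X})\circ\varepsilon_X=\mathrm{Tr}_X(s)$ and $\overline\varepsilon_X\circ\varepsilon_X=d(X)$. An STC is a symmetric BTC; it is finite if it has finitely many isomorphism classes of simple objects. An STC is admissible if either (i) $\mathbb F=\mathbb C$, the category is a $*$-category (it has a positive involutive antilinear contravariant monoidal endofunctor $*$ acting trivially on objects) and all objects have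 trivial twist, or (ii) $d(X)\in\mathbb Z_+$ for all $X$, the dimension being that of the symmetric category for which the twist is trivial; in both cases twists are trivial and dimensions are positive integers for nonzero objects. **The Frobenius algebra.** $\mathcal C$ is a strict BTC with braiding $c$; $\mathcal S\subset\mathcal C$ is a full tensor subcategory (closed under duals, finite direct sums and subobjects) which is a finite admissible STC. By Doplicher–Roberts and Deligne there is a finite group $G$, unique up to isomorphism, with $\mathcal S\simeq\mathrm{Rep}_{\mathbb F}G$ as symmetric tensor categories. Let $(\Gamma,m,\eta,\Delta,\varepsilon)$ be the Frobenius algebra in $\mathcal S$ corresponding to the left regular representation on functions $G\to\mathbb F$, with pointwise multiplication $m$, unit $\eta$ the constant function $1$, $\Delta(\delta_g)=|G|\,\delta_g\otimes\delta_g$, $\varepsilon(\delta_g)=|G|^{-1}$. The group $G$ is identified with $\mathrm{Aut}(\Gamma,m,\eta)=\{g\in\mathrm{End}\,\Gamma\mid g\circ m=m\circ(g\otimes g),\ g\circ\eta=\eta\}$ under composition. **The Galois extension.** $\mathcal C\rtimes_0\mathcal S$ is the strict tensor category with the same objects, and the same tensor product of objects, as $\mathcal C$; $\mathrm{Hom}_{\mathcal C\rtimes_0\mathcal S}(X,Y)=\mathrm{Hom}_{\mathcal C}(\Gamma\otimes X,Y)$; composition $t\,\hat\circ\, s=t\circ(\mathrm{id}_\Gamma\otimes s)\circ(\Delta\otimes\mathrm{id}_X)$ for $s\in\mathrm{Hom}_{\mathcal C}(\Gamma\otimes X,Y)$, $t\in\mathrm{Hom}_{\mathcal C}(\Gamma\otimes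 Y,Z)$; and $s\,\hat\otimes\, t=(s\otimes t)\circ(\mathrm{id}_\Gamma\otimes c_{\Gamma,X}\otimes\mathrm{id}_Z)\circ(\Delta\otimes\mathrm{id}_X\otimes\mathrm{id}_Z)$ for $s\in\mathrm{Hom}_{\mathcal C}(\Gamma\otimes X,Y)$, $t\in\mathrm{Hom}_{\mathcal C}(\Gamma\otimes Z,T)$. The identity of $X$ is $\varepsilon\otimes\mathrm{id}_X$. $\mathcal C\rtimes\mathcal S$ is its idempotent completion: objects are pairs $(X,p)$ with $p=p\,\hat\circ\,p\in\mathrm{End}_{\mathcal C\rtimes_0\mathcal S}(X)$, and $(X,p)\otimes(Y,q)=(X\otimes Y,p\,\hat\otimes\,q)$. It is a semisimple strict spherical tensor category. **Grading, spectrum, braiding in degree $e$.** For a simple object $X_1=(X,p)$ of $\mathcal C\rtimes\mathcal S$ put $d(X_1)=\overline\varepsilon_X\circ(p\otimes\mathrm{id}_{\overline X})\circ(\eta\otimes\varepsilon_X)$ and $$\partial X_1=d(X_1)^{-1}\,(\mathrm{id}_\Gamma\otimes\overline\varepsilon_X)\circ\big((c_{\Gamma,X}^{-1}\circ c_{X,\Gamma}^{-1})\otimes\mathrm{id}_{\overline X}\big)\circ(\mathrm{id}_\Gamma\otimes p\otimes\mathrm{id}_{\overline X})\circ(\Delta\otimes\varepsilon_X)\in\mathrm{End}_{\mathcal C}(\Gamma).$$ This is an element of $G$ depending only on the isomorphism class of $X_1$. A nonzero object is homogeneous of grade $g\in G$ if it is isomorphic to a finite direct sum of simple objects all of grade $g$;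 $(\mathcal C\rtimes\mathcal S)_g$ is the full subcategory of these (together with the zero object, when regarded as an additive category). The $G$-spectrum is $\{g\in G\mid\text{there is a nonzero homogeneous object of grade }g\}$, and it is full if it equals $G$. The tensor category $(\mathcal C\rtimes\mathcal S)_e$ is braided by $c_{(X,p),(Y,q)}=(\varepsilon\otimes c_{X,Y})\,\hat\circ\,(p\,\hat\otimes\,q)$. *)

(* Defs.v *)
From HB Require Import structures.
From mathcomp Require Import all_boot all_order all_algebra all_fingroup.
From mathcomp Require Import complex.
From mathcomp Require Import classical_sets reals.

Set Implicit Arguments.
Unset Strict Implicit.
Unset Printing Implicit Defensive.

Import GRing.Theory.
Local Open Scope classical_set_scope.
Local Open Scope ring_scope.

(* The operations of an F-linear ribbon category, without their axioms.  The
   axioms are stated below for the full subcategory on a set D of objects, so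
   that a full subcategory needs no new carrier; [set: C] gives C itself.
   Hom-spaces are finite dimensional because they are vectTypes. *)
Record ribbonData (F : closedFieldType) := RibbonData {
  obj :> Type;
  hom : obj -> obj -> vectType F;
  cid : forall X, hom X X;
  comp : forall X Y Z, hom Y Z -> hom X Y -> hom X Z;
  tunit : obj;
  tens : obj -> obj -> obj;
  tensm : forall X Y Z T, hom X Y -> hom Z T -> hom (tens X Z) (tens Y T);
  assoc : forall X Y Z, hom (tens (tens X Y) Z) (tens X (tens Y Z));
  assocV : forall X Y Z, hom (tens X (tens Y Z)) (tens (tens X Y) Z);
  lunit : forall X, hom (tens tunit X) X;
  lunitV : forall X, hom X (tens tunit X);
  runit : forall X, hom (tens X tunit) X;
  runitV : forall X, hom X (tens X tunit);
  braid : forall X Y, hom (tens X Y) (tens Y X);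
  braidV : forall X Y, hom (tens Y X) (tens X Y);
  dual : obj -> obj;
  coev : forall X, hom tunit (tens X (dual X));
  ev : forall X, hom (tens (dual X) X) tunit;
  twist : forall X, hom X X
}.

Arguments cid {F r} X.
Arguments assoc {F r} X Y Z.
Arguments assocV {F r} X Y Z.
Arguments lunit {F r} X.
Arguments lunitV {F r} X.
Arguments runit {F r} X.
Arguments runitV {F r} X.
Arguments braid {F r} X Y.
Arguments braidV {F r} X Y.
Arguments coev {F r} X.
Arguments ev {F r} X.
Arguments twist {F r} X.
Arguments tunit {F} r.

Declare Scope cat_scope.
Delimit Scope cat_scope with cat.
Open Scope cat_scope.

Notation "g \oc f" := (comp g f)
  (at level 45, left associativity, format "g  \oc  f") : cat_scope.
Notation "X \ox Y" := (tens X Y)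
  (at level 40, left associativity, format "X  \ox  Y") : cat_scope.
Notation "f \om g" := (tensm f g)
  (at level 40, left associativity, format "f  \om  g") : cat_scope.

Section Categories.
Variables (F : closedFieldType) (C : ribbonData F).
Implicit Types (X Y Z T W : C) (D : set C).

Definition transpose X Y (f : hom X Y) : hom (dual Y) (dual X) :=
  lunit (dual X)
    \oc (ev Y \om cid (dual X))
    \oc assocV (dual Y) Y (dual X)
    \oc (cid (dual Y) \om (f \om cid (dual X)))
    \oc (cid (dual Y) \om coev X)
    \oc runitV (dual Y).

(* The second half of the canonical spherical structure, written \bar\epsilon_X
   on paper; \epsilon_X is coev X. *)
Definition epsbar X : hom (X \ox dual X) (tunit C) :=
  ev X \oc braid X (dual X) \oc (twist X \om cid (dual X)).

(* The scalar a such that f = a *: cid (tunit C), when there is one. *)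
Definition scal (f : hom (tunit C) (tunit C)) : F :=
  coord [tuple cid (tunit C)] ord0 f.

Definition trace X (s : hom X X) : F :=
  scal (epsbar X \oc (s \om cid (dual X)) \oc coev X).

Definition dim X : F := trace (cid X).

Definition zero_obj X := cid X = 0.

Definition simple X :=
  (forall f : hom X X, exists a : F, f = a *: cid X) /\ cid X <> 0.

Definition iso X Y :=
  exists (f : hom X Y) (g : hom Y X), g \oc f = cid X /\ f \oc g = cid Y.

Definition is_iso X Y (f : hom X Y) :=
  exists g : hom Y X, g \oc f = cid X /\ f \oc g = cid Y.

(* For n = 0 this says that Z is a zero object. *)
Definition direct_sum Z n (Y : 'I_n -> C) :=
  exists (i : forall k, hom (Y k) Z) (p : forall k, hom Z (Y k)),
    [/\ forall k, p k \oc i k = cid (Y k),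
        forall k l, k != l -> p k \oc i l = 0 &
        \sum_k (i k \oc p k) = cid Z].

Definition retract Y X :=
  exists (i : hom Y X) (r : hom X Y), r \oc i = cid Y.

Record linear_category D : Prop := LinearCategory {
  comp_idl : forall X Y (f : hom X Y), D X -> D Y -> cid Y \oc f = f;
  comp_idr : forall X Y (f : hom X Y), D X -> D Y -> f \oc cid X = f;
  compA : forall X Y Z T (f : hom X Y) (g : hom Y Z) (h : hom Z T),
    D X -> D Y -> D Z -> D T -> h \oc (g \oc f) = h \oc g \oc f;
  comp_linl : forall X Y Z (a : F) (g h : hom Y Z) (f : hom X Y),
    D X -> D Y -> D Z -> (a *: g + h) \oc f = a *: (g \oc f) + h \oc f;
  comp_linr : forall X Y Z (a : F) (g : hom Y Z) (f h : hom X Y),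
    D X -> D Y -> D Z -> g \oc (a *: f + h) = a *: (g \oc f) + g \oc h
}.

Record monoidal_category D : Prop := MonoidalCategory {
  tunit_in : D (tunit C);
  tens_in : forall X Y, D X -> D Y -> D (X \ox Y);
  tens_linl : forall X Y Z T (a : F) (f g : hom X Y) (h : hom Z T),
    D X -> D Y -> D Z -> D T ->
    (a *: f + g) \om h = a *: (f \om h) + g \om h;
  tens_linr : forall X Y Z T (a : F) (f : hom X Y) (g h : hom Z T),
    D X -> D Y -> D Z -> D T ->
    f \om (a *: g + h) = a *: (f \om g) + f \om h;
  tens_id : forall X Y, D X -> D Y -> cid X \om cid Y = cid (X \ox Y);
  tens_comp : forall X Y Z X' Y' Z' (f : hom X Y) (g : hom Y Z)
      (f' : hom X' Y') (g' : hom Y' Z'),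
    D X -> D Y -> D Z -> D X' -> D Y' -> D Z' ->
    (g \oc f) \om (g' \oc f') = (g \om g') \oc (f \om f');
  assocK : forall X Y Z, D X -> D Y -> D Z ->
    assocV X Y Z \oc assoc X Y Z = cid (X \ox Y \ox Z);
  assocVK : forall X Y Z, D X -> D Y -> D Z ->
    assoc X Y Z \oc assocV X Y Z = cid (X \ox (Y \ox Z));
  lunitK : forall X, D X -> lunitV X \oc lunit X = cid (tunit C \ox X);
  lunitVK : forall X, D X -> lunit X \oc lunitV X = cid X;
  runitK : forall X, D X -> runitV X \oc runit X = cid (X \ox tunit C);
  runitVK : forall X, D X -> runit X \oc runitV X = cid X;
  assoc_nat : forall X Y Z X' Y' Z' (f : hom X X') (g : hom Y Y')
      (h : hom Z Z'),
    D X -> D Y -> D Z -> D X' -> D Y' -> D Z' ->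
    assoc X' Y' Z' \oc (f \om g \om h) = (f \om (g \om h)) \oc assoc X Y Z;
  lunit_nat : forall X Y (f : hom X Y), D X -> D Y ->
    lunit Y \oc (cid (tunit C) \om f) = f \oc lunit X;
  runit_nat : forall X Y (f : hom X Y), D X -> D Y ->
    runit Y \oc (f \om cid (tunit C)) = f \oc runit X;
  pentagon : forall W X Y Z, D W -> D X -> D Y -> D Z ->
    assoc W X (Y \ox Z) \oc assoc (W \ox X) Y Z =
    (cid W \om assoc X Y Z) \oc assoc W (X \ox Y) Z \oc
      (assoc W X Y \om cid Z);
  triangle : forall X Y, D X -> D Y ->
    (cid X \om lunit Y) \oc assoc X (tunit C) Y = runit X \om cid Y
}.

Record braided_category D : Prop := BraidedCategory {
  braidK : forall X Y, D X -> D Y ->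
    braidV X Y \oc braid X Y = cid (X \ox Y);
  braidVK : forall X Y, D X -> D Y ->
    braid X Y \oc braidV X Y = cid (Y \ox X);
  braid_nat : forall X Y X' Y' (f : hom X X') (g : hom Y Y'),
    D X -> D Y -> D X' -> D Y' ->
    braid X' Y' \oc (f \om g) = (g \om f) \oc braid X Y;
  hexagon : forall X Y Z, D X -> D Y -> D Z ->
    assoc Y Z X \oc braid X (Y \ox Z) \oc assoc X Y Z =
    (cid Y \om braid X Z) \oc assoc Y X Z \oc (braid X Y \om cid Z);
  hexagonV : forall X Y Z, D X -> D Y -> D Z ->
    assocV Z X Y \oc braid (X \ox Y) Z \oc assocV X Y Z =
    (braid X Z \om cid Y) \oc assocV X Z Y \oc (cid X \om braid Y Z)
}.

Record rigid_ribbon_category D : Prop := RigidRibbonCategory {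
  dual_in : forall X, D X -> D (dual X);
  zigzag : forall X, D X ->
    runit X \oc (cid X \om ev X) \oc assoc X (dual X) X \oc
      (coev X \om cid X) \oc lunitV X = cid X;
  zigzag_dual : forall X, D X ->
    lunit (dual X) \oc (ev X \om cid (dual X)) \oc
      assocV (dual X) X (dual X) \oc (cid (dual X) \om coev X) \oc
      runitV (dual X) = cid (dual X);
  twist_iso : forall X, D X -> is_iso (twist X);
  twist_nat : forall X Y (f : hom X Y), D X -> D Y ->
    twist Y \oc f = f \oc twist X;
  twist_tens : forall X Y, D X -> D Y ->
    twist (X \ox Y) = braid Y X \oc braid X Y \oc (twist X \om twist Y);
  twist_dual : forall X, D X -> twist (dual X) = transpose (twist X)
}.

Record semisimple_category D : Prop := SemisimpleCategory {
  has_direct_sums : forall n (Y : 'I_n -> C), (forall k, D (Y k)) ->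
    exists Z, D Z /\ direct_sum Z Y;
  idempotents_split : forall X (p : hom X X), D X -> p \oc p = p ->
    exists Y, D Y /\
      exists (i : hom Y X) (r : hom X Y), r \oc i = cid Y /\ i \oc r = p;
  simple_decomposition : forall X, D X ->
    exists n (Y : 'I_n -> C),
      (forall k, D (Y k) /\ simple (Y k)) /\ direct_sum X Y;
  schur : forall X Y (f : hom X Y), D X -> D Y ->
    simple X -> simple Y -> ~ iso X Y -> f = 0
}.

Record BTC D : Prop := IsBTC {
  btc_linear : linear_category D;
  btc_monoidal : monoidal_category D;
  btc_braided : braided_category D;
  btc_ribbon : rigid_ribbon_category D;
  btc_semisimple : semisimple_category D;
  btc_unit : simple (tunit C)
}.

Definition cast_id X Y (e : X = Y) : hom X Y :=
  match e in _ = Y' return hom X Y' with erefl => cid X end.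

Definition strict :=
  [/\ forall X Y Z, exists e : X \ox Y \ox Z = X \ox (Y \ox Z),
        assoc X Y Z = cast_id e,
      forall X, exists e : tunit C \ox X = X, lunit X = cast_id e &
      forall X, exists e : X \ox tunit C = X, runit X = cast_id e].

Definition simple_classes D n (X : 'I_n -> C) :=
  [/\ forall k, D (X k) /\ simple (X k),
      forall k l, iso (X k) (X l) -> k = l &
      forall Y, D Y -> simple Y -> exists k, iso Y (X k)].

Definition finite_simples D :=
  exists n (X : 'I_n -> C), simple_classes D X.

Definition Smatrix n (X : 'I_n -> C) : 'M[F]_n :=
  \matrix_(k, l) trace (braid (X l) (X k) \oc braid (X k) (X l)).

Definition modular D :=
  BTC D /\
  exists n (X : 'I_n -> C), simple_classes D X /\ Smatrix X \in unitmx.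

Definition full_tensor_subcategory D :=
  [/\ D (tunit C), forall X Y, D X -> D Y -> D (X \ox Y),
      forall X, D X -> D (dual X),
      forall n (Y : 'I_n -> C) Z,
        (forall k, D (Y k)) -> direct_sum Z Y -> D Z &
      forall X Y, D X -> retract Y X -> D Y].

Definition STC D :=
  BTC D /\
  forall X Y, D X -> D Y -> braid Y X \oc braid X Y = cid (X \ox Y).

Definition trivial_twist D := forall X, D X -> twist X = cid X.

(* The field F is identified with the complex numbers through phi. *)
Definition positive_star D (R : realType) (phi : {rmorphism F -> R[i]}) :=
  exists star : forall X Y, hom X Y -> hom Y X,
    [/\ forall X Y (f : hom X Y), D X -> D Y -> star _ _ (star _ _ f) = f,
        forall X Y (a b : F) (f g : hom X Y), D X -> D Y ->
          phi b = conjc (phi a) ->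
          star _ _ (a *: f + g) = b *: star _ _ f + star _ _ g,
        forall X Y Z (f : hom X Y) (g : hom Y Z), D X -> D Y -> D Z ->
          star _ _ (g \oc f) = star _ _ f \oc star _ _ g,
        forall X Y Z T (f : hom X Y) (g : hom Z T),
          D X -> D Y -> D Z -> D T ->
          star _ _ (f \om g) = star _ _ f \om star _ _ g &
        forall X Y (f : hom X Y), D X -> D Y ->
          star _ _ f \oc f = 0 -> f = 0].

Definition admissible D :=
  ((exists (R : realType) (phi : {rmorphism F -> R[i]}),
      bijective phi /\ positive_star D phi) /\ trivial_twist D) \/
  (trivial_twist D /\
   forall X, D X -> ~ zero_obj X -> exists n : nat, dim X = n.+1%:R).

End Categories.

(* Idempotent completion.  Objects are all pairs (X, p); those with p
   idempotent are selected by is_idem.  A morphism (X, p) -> (Y, q) is an s with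
   q s p = s.  kmor coerces s to such a morphism: it does nothing when s already
   satisfies this equation (and p, q are idempotent), and otherwise returns a
   projection of s. *)
Section Karoubi.
Variables (F : closedFieldType) (C : ribbonData F).

Definition kobj := {X : C & hom X X}.

Definition is_idem : set kobj :=
  [set P | tagged P \oc tagged P = tagged P].

Definition khom_space (P Q : kobj) : {vspace hom (tag P) (tag Q)} :=
  fixedSpace (linfun (fun s => tagged Q \oc s \oc tagged P)).

Definition khom (P Q : kobj) : vectType F := subvs_of (khom_space P Q).

Definition kmor (P Q : kobj) (s : hom (tag P) (tag Q)) : khom P Q :=
  vsproj (khom_space P Q) s.

Definition ktens (P Q : kobj) : kobj :=
  Tagged (fun X => hom X X) (tagged P \om tagged Q).

Definition kunit : kobj := Tagged (fun X => hom X X) (cid (tunit C)).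

Definition kdual (P : kobj) : kobj :=
  Tagged (fun X => hom X X) (transpose (tagged P)).

Definition karoubi : ribbonData F :=
  @RibbonData F kobj khom
    (fun P => kmor (P := P) (Q := P) (tagged P))
    (fun P Q R t s => kmor (P := P) (Q := R) (vsval t \oc vsval s))
    kunit ktens
    (fun P Q R S s t =>
       kmor (P := ktens P R) (Q := ktens Q S) (vsval s \om vsval t))
    (fun P Q R => kmor (P := ktens (ktens P Q) R) (Q := ktens P (ktens Q R))
       (assoc (tag P) (tag Q) (tag R) \oc
          (tagged P \om tagged Q \om tagged R)))
    (fun P Q R => kmor (P := ktens P (ktens Q R)) (Q := ktens (ktens P Q) R)
       (assocV (tag P) (tag Q) (tag R) \oc
          (tagged P \om (tagged Q \om tagged R))))
    (fun P => kmor (P := ktens kunit P) (Q := P) (tagged P \oc lunit (tag P)))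
    (fun P => kmor (P := P) (Q := ktens kunit P) (lunitV (tag P) \oc tagged P))
    (fun P => kmor (P := ktens P kunit) (Q := P) (tagged P \oc runit (tag P)))
    (fun P => kmor (P := P) (Q := ktens P kunit) (runitV (tag P) \oc tagged P))
    (fun P Q => kmor (P := ktens P Q) (Q := ktens Q P)
       (braid (tag P) (tag Q) \oc (tagged P \om tagged Q)))
    (fun P Q => kmor (P := ktens Q P) (Q := ktens P Q)
       (braidV (tag P) (tag Q) \oc (tagged Q \om tagged P)))
    kdual
    (fun P => kmor (P := kunit) (Q := ktens P (kdual P))
       ((tagged P \om transpose (tagged P)) \oc coev (tag P)))
    (fun P => kmor (P := ktens (kdual P) P) (Q := kunit)
       (ev (tag P) \oc (transpose (tagged P) \om tagged P)))
    (fun P => kmor (P := P) (Q := P) (twist (tag P) \oc tagged P)).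

End Karoubi.

Record frobenius (F : closedFieldType) (C : ribbonData F) := Frobenius {
  frob :> C;
  fmul : hom (frob \ox frob) frob;
  funit : hom (tunit C) frob;
  fcomul : hom frob (frob \ox frob);
  fcounit : hom frob (tunit C)
}.

Arguments fmul {F C} f.
Arguments funit {F C} f.
Arguments fcomul {F C} f.
Arguments fcounit {F C} f.

Section GaloisExtension.
Variables (F : closedFieldType) (C : ribbonData F) (A : frobenius C).

Definition hat_comp (X Y Z : C) (t : hom (A \ox Y) Z) (s : hom (A \ox X) Y) :
    hom (A \ox X) Z :=
  t \oc (cid (A : C) \om s) \oc assoc (A : C) A X \oc (fcomul A \om cid X).

Definition hat_tens (X Y Z T : C) (s : hom (A \ox X) Y) (t : hom (A \ox Z) T) :
    hom (A \ox (X \ox Z)) (Y \ox T) :=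
  (s \om t)
    \oc assocV (A : C) X (A \ox Z)
    \oc (cid (A : C) \om (assoc X A Z \oc (braid (A : C) X \om cid Z)
                            \oc assocV (A : C) X Z))
    \oc assoc (A : C) A (X \ox Z)
    \oc (fcomul A \om cid (X \ox Z)).

(* The functor C -> C \rtimes_0 S, f |-> \epsilon \otimes f. *)
Definition hat (X Y : C) (f : hom X Y) : hom (A \ox X) Y :=
  lunit Y \oc (fcounit A \om f).

(* The braiding and the twist are images of those of C; they are natural only
   on the grade e part of the idempotent completion. *)
Definition rtimes0 : ribbonData F :=
  @RibbonData F C (fun X Y => hom (A \ox X) Y)
    (fun X => hat (cid X)) hat_comp
    (tunit C) (@tens F C) hat_tens
    (fun X Y Z => hat (assoc X Y Z)) (fun X Y Z => hat (assocV X Y Z))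
    (fun X => hat (lunit X)) (fun X => hat (lunitV X))
    (fun X => hat (runit X)) (fun X => hat (runitV X))
    (fun X Y => hat (braid X Y)) (fun X Y => hat (braidV X Y))
    (@dual F C)
    (fun X => hat (coev X)) (fun X => hat (ev X))
    (fun X => hat (twist X)).

Definition rtimes : ribbonData F := karoubi rtimes0.

Definition rtimes_obj : set rtimes := @is_idem F rtimes0.

Definition AutA : set (hom (A : C) A) :=
  [set g | g \oc fmul A = fmul A \oc (g \om g) /\ g \oc funit A = funit A].

Definition rdim (P : rtimes) : F :=
  let X : C := tag P in let p : hom (A \ox X) X := tagged P in
  scal (epsbar X \oc (p \om cid (dual X)) \oc assocV (A : C) X (dual X)
          \oc (funit A \om coev X) \oc lunitV (tunit C)).

Definition grade (P : rtimes) : hom (A : C) A :=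
  let X : C := tag P in let p : hom (A \ox X) X := tagged P in
  (rdim P)^-1 *:
    (runit (A : C)
       \oc (cid (A : C) \om epsbar X)
       \oc assoc (A : C) X (dual X)
       \oc ((braidV (A : C) X \oc braidV X A) \om cid (dual X))
       \oc assocV (A : C) X (dual X)
       \oc (cid (A : C) \om ((p \om cid (dual X)) \oc assocV (A : C) X (dual X)))
       \oc assoc (A : C) A (X \ox dual X)
       \oc (fcomul A \om coev X)
       \oc runitV (A : C)).

Definition homogeneous (g : hom (A : C) A) (P : rtimes) :=
  [/\ rtimes_obj P, ~ zero_obj P &
      exists n (Q : 'I_n -> rtimes),
        (forall k, [/\ rtimes_obj (Q k), simple (Q k) & grade (Q k) = g]) /\
        direct_sum P Q].

Definition rtimes_grade (g : hom (A : C) A) : set rtimes :=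
  [set P | homogeneous g P \/ (rtimes_obj P /\ zero_obj P)].

Definition Gspectrum : set (hom (A : C) A) :=
  [set g | AutA g /\ exists P, homogeneous g P].

Definition full_Gspectrum := Gspectrum = AutA.

End GaloisExtension.

Section RepEquivalence.
Variables (F : closedFieldType) (gT : finGroupType).

Definition is_rep (V : vectType F) (rho : gT -> 'End(V)) :=
  rho 1%g = \1%VF /\ forall g h, rho (g * h)%g = (rho g \o rho h)%VF.

Definition equivariant (V W : vectType F) (rV : gT -> 'End(V))
    (rW : gT -> 'End(W)) (f : 'Hom(V, W)) :=
  forall g v, f (rV g v) = rW g (f v).

(* mu : V x W -> U exhibits U as the tensor product of V and W. *)
Definition is_tensor_product (V W U : vectType F) (mu : V -> W -> U) :=
  [/\ forall a v v' w, mu (a *: v + v') w = a *: mu v w + mu v' w,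
      forall a v w w', mu v (a *: w + w') = a *: mu v w + mu v w' &
      basis_of fullv
        [seq mu v w | v <- vbasis (fullv : {vspace V}),
                      w <- vbasis (fullv : {vspace W})]].

Variable C : ribbonData F.

(* The tensor structure E(X) (x) E(Y) ~ E(X (x) Y) is given by the bilinear map
   emul, and F ~ E(1) by the vector eone.  Values outside S are irrelevant. *)
Record rep_functor := RepFunctor {
  eobj :> C -> vectType F;
  eact : forall X, gT -> 'End(eobj X);
  ehom : forall X Y, hom X Y -> 'Hom(eobj X, eobj Y);
  emul : forall X Y, eobj X -> eobj Y -> eobj (X \ox Y);
  eone : eobj (tunit C)
}.

Arguments eact r X g : rename.
Arguments ehom r {X Y}.
Arguments emul r {X Y}.

Record sym_tensor_equivalence (S : set C) (E : rep_functor) : Prop :=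
    SymTensorEquivalence {
  eact_rep : forall X, S X -> is_rep (eact E X);
  ehom_equivariant : forall X Y (f : hom X Y), S X -> S Y ->
    equivariant (eact E X) (eact E Y) (ehom E f);
  ehom_id : forall X, S X -> ehom E (cid X) = \1%VF;
  ehom_comp : forall X Y Z (f : hom X Y) (g : hom Y Z),
    S X -> S Y -> S Z -> ehom E (g \oc f) = (ehom E g \o ehom E f)%VF;
  ehom_linear : forall X Y (a : F) (f g : hom X Y), S X -> S Y ->
    ehom E (a *: f + g) = a *: ehom E f + ehom E g;
  ehom_faithful : forall X Y (f g : hom X Y), S X -> S Y ->
    ehom E f = ehom E g -> f = g;
  ehom_full : forall X Y (u : 'Hom(E X, E Y)), S X -> S Y ->
    equivariant (eact E X) (eact E Y) u -> exists f, u = ehom E f;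
  ess_surjective : forall (V : vectType F) (rho : gT -> 'End(V)),
    is_rep rho -> exists X (u : 'Hom(E X, V)),
      [/\ S X, bijective u & equivariant (eact E X) rho u];
  emul_tensor : forall X Y, S X -> S Y -> is_tensor_product (emul E (X := X) (Y := Y));
  emul_equivariant : forall X Y g x y, S X -> S Y ->
    eact E (X \ox Y) g (emul E x y) =
    emul E (eact E X g x) (eact E Y g y);
  emul_nat : forall X Y X' Y' (f : hom X X') (h : hom Y Y') x y,
    S X -> S Y -> S X' -> S Y' ->
    ehom E (f \om h) (emul E x y) = emul E (ehom E f x) (ehom E h y);
  emul_assoc : forall X Y Z x y z, S X -> S Y -> S Z ->
    ehom E (assoc X Y Z) (emul E (emul E x y) z) = emul E x (emul E y z);
  eone_basis : basis_of fullv [:: eone E];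
  eone_equivariant : forall g, eact E (tunit C) g (eone E) = eone E;
  eone_lunit : forall X x, S X -> ehom E (lunit X) (emul E (eone E) x) = x;
  eone_runit : forall X x, S X -> ehom E (runit X) (emul E x (eone E)) = x;
  emul_sym : forall X Y x y, S X -> S Y ->
    ehom E (braid X Y) (emul E x y) = emul E y x
}.

Definition delta (g : gT) : {ffun gT -> F^o} := [ffun h => (h == g)%:R].

(* Under E, A corresponds to the functions gT -> F with the left regular
   action and the stated Frobenius structure. *)
Definition regular_frobenius (E : rep_functor) (A : frobenius C) :=
  exists phi : 'Hom({ffun gT -> F^o}, E A),
    bijective phi /\
    [/\ forall g f, eact E (A : C) g (phi f) = phi [ffun h => f (g^-1 * h)%g],
        forall f h, ehom E (fmul A) (emul E (phi f) (phi h)) =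
                    phi [ffun x => (f x : F) * h x],
        ehom E (funit A) (eone E) = phi [ffun => 1],
        forall g, ehom E (fcomul A) (phi (delta g)) =
                  #|gT|%:R *: emul E (phi (delta g)) (phi (delta g)) &
        forall g, ehom E (fcounit A) (phi (delta g)) =
                  (#|gT|%:R)^-1 *: eone E].

End RepEquivalence.

(* Main.v *)
(* Write [A] for the function algebra, [rho g] for its automorphisms, and [B_X] for the
   double braiding of [A] and [X].  Averaging [B_X] over [A] yields central idempotents
   [pi_g] of [X] in the extension, summing to the identity, with [B_X] acting as
   [rho g^-1] on the image of [pi_g]; hence a simple object has grade [rho g] exactly
   when [pi_g] is nonzero on it, and the part of grade e consists of the idempotents [p]
   with [B_X (1 (x) p) = 1 (x) p], on which braiding and twist are natural.

   Put [omega = sum_i d_i ring_i] over the simple objects of C, where [ring_i] encircles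
   by the i-th simple object.  Modularity says that [omega] projects onto the multiples
   of the unit, up to the nonzero scalar [dim C].  On [A] this gives
   [omega_A = dim C . eta eps], a nonzero multiple of [sum_g rho g], while computing
   [omega_A] by [B_X = sum_g rho g^-1 pi_g] shows, as the [rho g] are linearly
   independent, that every [pi_g] is nonzero on some simple object: the spectrum is full.
   For a transparent simple object [(X, p)] of grade e, only the simple objects with
   trivial [B] contribute to the trace of [omega] on [A (x) X] composed with [1 (x) p],
   which is therefore [dim C . d(X, p)] and nonzero; so there is a nonzero morphism from
   the unit to [(X, p)].  A ribbon fusion category without nontrivial transparent simple
   objects has an invertible S-matrix, by the usual argument with [sum_i d_i S_ij]. *)
Require Import Defs.
From HB Require Import structures.
From mathcomp Require Import all_boot all_order all_algebra all_fingroup.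
From mathcomp Require Import classical_sets.
From mathcomp Require boolp.
Import VectorInternalTheory.
Import Defs.

Set Implicit Arguments.
Unset Strict Implicit.
Unset Printing Implicit Defensive.
Import GRing.Theory.
Local Open Scope ring_scope.

(** Three obstacles shape the proof. The extension lives on all idempotents, but its braiding and
    twist are natural on only some of them. So each structure is treated on a type of objects
    satisfying just the axioms at hand ([monoidal], [rigid], [braided], [ribbon]), and the part of
    grade e becomes such a type through [full_sub]. Semisimplicity of the extension has to be
    proved. It comes from von Neumann regularity: in a semisimple category every [f] has a [g] with
    [f \oc g \oc f = f]. Averaging over [A] carries [g] to the extension, where regularity, split
    idempotents and finite dimensional morphism spaces give back Schur's lemma and decompositions
    into simple objects. Dimensions lie in a field without order, so that they do not vanish needs a
    reason each time: invertibility of the S-matrix for the simple objects of C, nondegeneracy of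
    the trace for those of the extension, and positive definiteness of an integer matrix for the sum
    of squares [gdim]. The group and the fibre functor enter only through the identities collected
    in [galois_algebra]. *)

(** * Coherence in monoidal categories *)

Class monoidal (F : closedFieldType) (K : ribbonData F) : Prop := Monoidal {
  monoidal_linear : linear_category [set: K]%classic;
  monoidal_monoidal : monoidal_category [set: K]%classic
}.

Class braided (F : closedFieldType) (K : ribbonData F) : Prop := Braided {
  braided_is_monoidal :: monoidal K;
  braided_braided : braided_category [set: K]%classic
}.

Section Coherence.
Variables (F : closedFieldType) (K : ribbonData F).
Context {mK : monoidal K}.
Implicit Types (X Y Z W R : K).

Let lK := @monoidal_linear F K mK.
Let mmK := @monoidal_monoidal F K mK.

Lemma cidl X Y (f : hom X Y) : cid Y \oc f = f. Proof. exact: (comp_idl lK). Qed.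
Lemma cidr X Y (f : hom X Y) : f \oc cid X = f. Proof. exact: (comp_idr lK). Qed.
Lemma ocA X Y Z W (f : hom X Y) (g : hom Y Z) (h : hom Z W) :
  h \oc (g \oc f) = h \oc g \oc f.
Proof. exact: (compA lK). Qed.
Lemma omC X Y Z X' Y' Z' (f : hom X Y) (g : hom Y Z)
    (f' : hom X' Y') (g' : hom Y' Z') :
  (g \oc f) \om (g' \oc f') = (g \om g') \oc (f \om f').
Proof. exact: (tens_comp mmK). Qed.
Lemma om1 X Y : cid X \om cid Y = cid (X \ox Y).
Proof. exact: (tens_id mmK). Qed.
Lemma om_idl W X Y Z (f : hom X Y) (g : hom Y Z) :
  cid W \om (g \oc f) = (cid W \om g) \oc (cid W \om f).
Proof. by rewrite -omC cidl. Qed.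
Lemma om_idr W X Y Z (f : hom X Y) (g : hom Y Z) :
  (g \oc f) \om cid W = (g \om cid W) \oc (f \om cid W).
Proof. by rewrite -omC cidl. Qed.

Lemma ocDl X Y Z (g h : hom Y Z) (f : hom X Y) : (g + h) \oc f = g \oc f + h \oc f.
Proof. by have := comp_linl lK 1 g h f I I I; rewrite !scale1r. Qed.
Lemma ocDr X Y Z (g : hom Y Z) (f h : hom X Y) : g \oc (f + h) = g \oc f + g \oc h.
Proof. by have := comp_linr lK 1 g f h I I I; rewrite !scale1r. Qed.
Lemma oc0l X Y Z (f : hom X Y) : (0 : hom Y Z) \oc f = 0.
Proof. by apply: (addrI (0 \oc f)); rewrite -ocDl !addr0. Qed.
Lemma oc0r X Y Z (g : hom Y Z) : g \oc (0 : hom X Y) = 0.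
Proof. by apply: (addrI (g \oc 0)); rewrite -ocDr !addr0. Qed.
Lemma ocZl X Y Z a (g : hom Y Z) (f : hom X Y) : (a *: g) \oc f = a *: (g \oc f).
Proof. by have := comp_linl lK a g 0 f I I I; rewrite addr0 oc0l addr0. Qed.
Lemma ocZr X Y Z a (g : hom Y Z) (f : hom X Y) : g \oc (a *: f) = a *: (g \oc f).
Proof. by have := comp_linr lK a g f 0 I I I; rewrite addr0 oc0r addr0. Qed.
Lemma ocBl X Y Z (g h : hom Y Z) (f : hom X Y) : (g - h) \oc f = g \oc f - h \oc f.
Proof. by rewrite ocDl -scaleN1r ocZl scaleN1r. Qed.
Lemma ocBr X Y Z (g : hom Y Z) (f h : hom X Y) : g \oc (f - h) = g \oc f - g \oc h.
Proof. by rewrite ocDr -scaleN1r ocZr scaleN1r. Qed.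
Lemma oc_suml X Y Z (I : Type) (r : seq I) (P : pred I) (g : I -> hom Y Z) (f : hom X Y) :
  (\sum_(i <- r | P i) g i) \oc f = \sum_(i <- r | P i) (g i \oc f).
Proof.
by apply: (big_morph (fun g => g \oc f)) => [g1 g2|]; rewrite ?ocDl ?oc0l.
Qed.
Lemma oc_sumr X Y Z (I : Type) (r : seq I) (P : pred I) (g : hom Y Z) (f : I -> hom X Y) :
  g \oc (\sum_(i <- r | P i) f i) = \sum_(i <- r | P i) (g \oc f i).
Proof.
by apply: (big_morph (fun f => g \oc f)) => [f1 f2|]; rewrite ?ocDr ?oc0r.
Qed.

Lemma omDl X Y Z W (f g : hom X Y) (h : hom Z W) : (f + g) \om h = f \om h + g \om h.
Proof. by have := tens_linl mmK 1 f g h I I I I; rewrite !scale1r. Qed.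
Lemma omDr X Y Z W (f : hom X Y) (g h : hom Z W) : f \om (g + h) = f \om g + f \om h.
Proof. by have := tens_linr mmK 1 f g h I I I I; rewrite !scale1r. Qed.
Lemma om0l X Y Z W (h : hom Z W) : (0 : hom X Y) \om h = 0.
Proof. by apply: (addrI (0 \om h)); rewrite -omDl !addr0. Qed.
Lemma om0r X Y Z W (h : hom Z W) : h \om (0 : hom X Y) = 0.
Proof. by apply: (addrI (h \om 0)); rewrite -omDr !addr0. Qed.
Lemma omZl X Y Z W a (f : hom X Y) (h : hom Z W) : (a *: f) \om h = a *: (f \om h).
Proof. by have := tens_linl mmK a f 0 h I I I I; rewrite addr0 om0l addr0. Qed.
Lemma omZr X Y Z W a (f : hom X Y) (h : hom Z W) : f \om (a *: h) = a *: (f \om h).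
Proof. by have := tens_linr mmK a f h 0 I I I I; rewrite addr0 om0r addr0. Qed.
Lemma om_suml X Y Z W (I : Type) (r : seq I) (P : pred I) (f : I -> hom X Y) (h : hom Z W) :
  (\sum_(i <- r | P i) f i) \om h = \sum_(i <- r | P i) (f i \om h).
Proof.
by apply: (big_morph (fun f => f \om h)) => [g1 g2|]; rewrite ?omDl ?om0l.
Qed.
Lemma om_sumr X Y Z W (I : Type) (r : seq I) (P : pred I) (f : hom X Y) (h : I -> hom Z W) :
  f \om (\sum_(i <- r | P i) h i) = \sum_(i <- r | P i) (f \om h i).
Proof.
by apply: (big_morph (fun h => f \om h)) => [g1 g2|]; rewrite ?omDr ?om0r.
Qed.

Lemma asK X Y Z : assocV X Y Z \oc assoc X Y Z = cid _.
Proof. exact: (assocK mmK). Qed.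
Lemma asVK X Y Z : assoc X Y Z \oc assocV X Y Z = cid _.
Proof. exact: (assocVK mmK). Qed.
Lemma luK X : lunitV X \oc lunit X = cid _. Proof. exact: (lunitK mmK). Qed.
Lemma luVK X : lunit X \oc lunitV X = cid _. Proof. exact: (lunitVK mmK). Qed.
Lemma ruK X : runitV X \oc runit X = cid _. Proof. exact: (runitK mmK). Qed.
Lemma ruVK X : runit X \oc runitV X = cid _. Proof. exact: (runitVK mmK). Qed.
Lemma as_nat X Y Z X' Y' Z' (f : hom X X') (g : hom Y Y') (h : hom Z Z') :
  assoc X' Y' Z' \oc (f \om g \om h) = (f \om (g \om h)) \oc assoc X Y Z.
Proof. exact: (assoc_nat mmK). Qed.
Lemma lu_nat X Y (f : hom X Y) : lunit Y \oc (cid (tunit K) \om f) = f \oc lunit X.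
Proof. exact: (lunit_nat mmK). Qed.
Lemma ru_nat X Y (f : hom X Y) : runit Y \oc (f \om cid (tunit K)) = f \oc runit X.
Proof. exact: (runit_nat mmK). Qed.
Lemma asV_nat X Y Z X' Y' Z' (f : hom X X') (g : hom Y Y') (h : hom Z Z') :
  assocV X' Y' Z' \oc (f \om (g \om h)) = (f \om g \om h) \oc assocV X Y Z.
Proof.
rewrite -[LHS]cidr -asVK ocA -[_ \oc _ \oc assoc _ _ _]ocA -as_nat !ocA.
by rewrite asK cidl.
Qed.

Lemma cancel_l X Y Z (i : hom Y Z) (j : hom Z Y) (f g : hom X Y) :
  j \oc i = cid Y -> i \oc f = i \oc g -> f = g.
Proof. by move=> ji e; rewrite -[f]cidl -[g]cidl -ji -!ocA e. Qed.
Lemma cancel_r X Y Z (i : hom X Y) (j : hom Y X) (f g : hom Y Z) :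
  i \oc j = cid Y -> f \oc i = g \oc i -> f = g.
Proof. by move=> ij e; rewrite -[f]cidr -[g]cidr -ij !ocA e. Qed.

Lemma om1_inj X Y (f g : hom X Y) : f \om cid (tunit K) = g \om cid (tunit K) -> f = g.
Proof.
move=> e; apply: (cancel_r (ruVK X)).
by rewrite -!ru_nat e.
Qed.
Lemma om1_injl X Y (f g : hom X Y) : cid (tunit K) \om f = cid (tunit K) \om g -> f = g.
Proof.
move=> e; apply: (cancel_r (luVK X)).
by rewrite -!lu_nat e.
Qed.

(* Kelly: the unit coherence for [lunit (X \ox Y)] follows from the pentagon and the triangle. *)
Lemma lunit_tens X Y : lunit (X \ox Y) \oc assoc (tunit K) X Y = lunit X \om cid Y.
Proof.
apply: om1_injl.
rewrite om_idl.
have tri U V : (cid U \om lunit V) \oc assoc U (tunit K) V = runit U \om cid V.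
  exact: (triangle mmK).
apply: (cancel_r (j := (assocV (tunit K) (tunit K) X \om cid Y)
                \oc assocV (tunit K) (tunit K \ox X) Y)
  (i := assoc (tunit K) (tunit K \ox X) Y \oc (assoc (tunit K) (tunit K) X \om cid Y))).
  rewrite !ocA -[_ \oc _ \oc (assocV _ _ _ \om _)]ocA -omC asVK cidl om1 cidr.
  exact: asVK.
have pent := pentagon mmK (W := tunit K) (X := tunit K) (Y := X) (Z := Y) I I I I.
rewrite !ocA in pent *.
rewrite -[_ \oc (cid _ \om assoc _ _ _) \oc _]ocA -[X in X = _]ocA -pent ocA tri.
by rewrite -as_nat -ocA -om_idr tri -om1 as_nat.
Qed.

Inductive tree := Unit | Leaf of K | Node of tree & tree.

Fixpoint ob t : K :=
  match t with
  | Unit => tunit K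
  | Leaf X => X
  | Node s t => ob s \ox ob t
  end.

(** The object [ob t \ox R] with its units dropped and its brackets moved to the right. Trees that
    differ only by brackets or units act through convertible objects, which is why the constraints
    can be stated to act as [cid _]. *)
Fixpoint act t R : K :=
  match t with
  | Unit => R
  | Leaf X => X \ox R
  | Node s t => act s (act t R)
  end.

Fixpoint amap t R R' : hom R R' -> hom (act t R) (act t R') :=
  match t with
  | Unit => fun f => f
  | Leaf X => fun f => cid X \om f
  | Node s t => fun f => amap s (amap t f)
  end.

Lemma amap_comp t R R' R'' (f : hom R R') (g : hom R' R'') :
  amap t (g \oc f) = amap t g \oc amap t f.
Proof.
elim: t R R' R'' f g => [|X|s IHs t IHt] //= R R' R'' f g; first by rewrite om_idl.
by rewrite IHt IHs.
Qed.

Lemma amap_id t R : amap t (cid R) = cid _.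
Proof. by elim: t R => [|X|s IHs t IHt] //= R; rewrite ?om1 // IHt IHs. Qed.

Fixpoint can t R : hom (ob t \ox R) (act t R) :=
  match t with
  | Unit => lunit R
  | Leaf X => cid _
  | Node s t => can s (act t R) \oc (cid (ob s) \om can t R) \oc assoc _ _ _
  end.

Fixpoint canV t R : hom (act t R) (ob t \ox R) :=
  match t with
  | Unit => lunitV R
  | Leaf X => cid _
  | Node s t => assocV _ _ _ \oc ((cid (ob s) \om canV t R) \oc canV s (act t R))
  end.

Lemma canK t R : canV t R \oc can t R = cid _.
Proof.
elim: t R => [|X|s IHs t IHt] /= R; rewrite ?luK ?cidl //.
rewrite -!ocA [canV _ _ \oc (can _ _ \oc _)]ocA IHs cidl.
by rewrite [(cid _ \om _) \oc _]ocA -omC IHt cidl om1 cidl asK.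
Qed.

Lemma canVK t R : can t R \oc canV t R = cid _.
Proof.
elim: t R => [|X|s IHs t IHt] /= R; rewrite ?luVK ?cidl //.
rewrite -!ocA [assoc _ _ _ \oc (assocV _ _ _ \oc _)]ocA asVK cidl.
by rewrite [(cid _ \om _) \oc _]ocA -omC IHt cidl om1 cidl IHs.
Qed.

Lemma can_nat t R R' (f : hom R R') :
  can t R' \oc (cid (ob t) \om f) = amap t f \oc can t R.
Proof.
elim: t R R' f => [|X|s IHs t IHt] /= R R' f; first by rewrite lu_nat.
  by rewrite cidl cidr.
by rewrite -!ocA -om1 as_nat !ocA -[_ \oc _ \oc (cid _ \om (cid _ \om _))]ocA -om_idl IHt
  om_idl !ocA IHs.
Qed.

Lemma canV_nat t R R' (f : hom R R') :
  canV t R' \oc amap t f = (cid (ob t) \om f) \oc canV t R.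
Proof.
apply: (cancel_r (canVK t R)); rewrite -!ocA canK cidr -can_nat.
by rewrite ocA canK cidl.
Qed.

Definition nt s t (f : hom (ob s) (ob t)) R : hom (act s R) (act t R) :=
  can t R \oc (f \om cid R) \oc canV s R.

Lemma nt_nat s t (f : hom (ob s) (ob t)) R R' (g : hom R R') :
  nt f R' \oc amap s g = amap t g \oc nt f R.
Proof.
rewrite /nt -!ocA canV_nat !ocA -can_nat -!ocA; congr (_ \oc _).
by rewrite !ocA -!omC !cidl !cidr.
Qed.

Lemma nt_id s R : nt (cid (ob s)) R = cid _.
Proof. by rewrite /nt om1 cidr canVK. Qed.

Lemma nt_comp s t u (g : hom (ob t) (ob u)) (f : hom (ob s) (ob t)) R :
  @nt s u (g \oc f) R = nt g R \oc nt f R.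
Proof.
rewrite /nt om_idr -!ocA; congr (_ \oc (_ \oc _)).
by rewrite [canV _ _ \oc (can _ _ \oc _)]ocA canK cidl.
Qed.

Lemma nt_tens s t s' t' (f : hom (ob s) (ob t)) (g : hom (ob s') (ob t')) R :
  @nt (Node s s') (Node t t') (f \om g) R = nt f (act t' R) \oc amap s (nt g R).
Proof.
rewrite /nt /= -!ocA; congr (_ \oc _).
rewrite canV_nat /nt !ocA; congr (_ \oc _).
rewrite -[_ \oc assoc _ _ _ \oc _]ocA as_nat !ocA -[_ \oc assoc _ _ _ \oc _]ocA.
by rewrite asVK cidr -!omC !cidl !cidr.
Qed.

(** This is the pentagon, with [R] as its fourth object. *)
Lemma nt_assoc s t u R :
  @nt (Node (Node s t) u) (Node s (Node t u)) (assoc _ _ _) R = cid _.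
Proof.
rewrite -(canVK (Node (Node s t) u) R) /nt; congr (_ \oc _).
have pent := pentagon (monoidal_monoidal (K := K)) (W := ob s) (X := ob t)
  (Y := ob u) (Z := R) I I I I.
rewrite /= !om_idl !ocA -[_ \oc assoc (ob s) (_ \ox _) R \oc _]ocA.
rewrite -!ocA; congr (_ \oc _); rewrite !ocA in pent *.
rewrite -[_ \oc (cid _ \om assoc _ _ _) \oc _]ocA.
rewrite -[_ \oc (_ \oc _) \oc (assoc _ _ _ \om _)]ocA -pent ocA; congr (_ \oc _).
by rewrite -!ocA; congr (_ \oc _); rewrite -om1 as_nat.
Qed.

(** Rests on [lunit_tens], the unit coherence that is not among the axioms; for the right unit the
    triangle suffices. *)
Lemma nt_lunit s R : @nt (Node Unit s) s (lunit _) R = cid _.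
Proof.
rewrite -(canVK (Node Unit s) R) /nt; congr (_ \oc _).
by rewrite /= lu_nat -ocA lunit_tens.
Qed.

Lemma nt_runit s R : @nt (Node s Unit) s (runit _) R = cid _.
Proof.
rewrite -(canVK (Node s Unit) R) /nt; congr (_ \oc _).
by rewrite /= -ocA (triangle (monoidal_monoidal (K := K))).
Qed.

Lemma nt_inv s t (f : hom (ob s) (ob t)) (g : hom (ob t) (ob s))
    R (f' : hom (act s R) (act t R)) (g' : hom (act t R) (act s R)) :
  f \oc g = cid _ -> nt f R = f' -> g' \oc f' = cid _ -> nt g R = g'.
Proof.
move=> fg <- gf.
rewrite -[LHS]cidl -gf -ocA.
have <- := @nt_comp t s t f g R.
by rewrite fg nt_id cidr.
Qed.

Lemma nt_assocV s t u R :
  @nt (Node s (Node t u)) (Node (Node s t) u) (assocV _ _ _) R = cid _.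
Proof.
apply: (@nt_inv (Node (Node s t) u) (Node s (Node t u)) _ _ _ (cid _) (cid _)).
- exact: asVK.
- exact: nt_assoc.
- exact: cidl.
Qed.

Lemma nt_lunitV s R : @nt s (Node Unit s) (lunitV _) R = cid _.
Proof.
apply: (@nt_inv (Node Unit s) s _ _ _ (cid _) (cid _)).
- exact: luVK.
- exact: nt_lunit.
- exact: cidl.
Qed.

Lemma nt_runitV s R : @nt s (Node s Unit) (runitV _) R = cid _.
Proof.
apply: (@nt_inv (Node s Unit) s _ _ _ (cid _) (cid _)).
- exact: ruVK.
- exact: nt_runit.
- exact: cidl.
Qed.

(** Nothing is lost by evaluating at the unit object, because tensoring with it is faithful. *)
Lemma nt_inj s t (f g : hom (ob s) (ob t)) :
  nt f (tunit K) = nt g (tunit K) -> f = g.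
Proof.
move=> e; apply: om1_inj.
apply: (cancel_l (canK t _)); apply: (cancel_r (canK s _)).
exact: e.
Qed.

End Coherence.

Arguments Unit {F K}.

(** * Coherence for braidings *)

Section Braid.
Variables (F : closedFieldType) (K : ribbonData F).
Context {bK : braided K}.
Implicit Types (X Y Z W R : K).
Let bbK := @braided_braided F K bK.

Lemma brK X Y : braidV X Y \oc braid X Y = cid _. Proof. exact: (braidK bbK). Qed.
Lemma brVK X Y : braid X Y \oc braidV X Y = cid _. Proof. exact: (braidVK bbK). Qed.
Lemma br_nat X Y X' Y' (f : hom X X') (g : hom Y Y') :
  braid X' Y' \oc (f \om g) = (g \om f) \oc braid X Y.
Proof. exact: (braid_nat bbK). Qed.

Lemma brV_nat X Y X' Y' (f : hom X X') (g : hom Y Y') :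
  braidV X' Y' \oc (g \om f) = (f \om g) \oc braidV X Y.
Proof.
apply: (cancel_r (brVK X Y)); rewrite -!ocA brK cidr -br_nat.
by rewrite ocA brK cidl.
Qed.

(** The crossing of two trees resolved into crossings of leaves as the hexagons prescribe; a
    crossing with the unit is the identity by construction. The inner recursion moves a single leaf
    past a tree. *)
Fixpoint brt s t R : hom (act s (act t R)) (act t (act s R)) :=
  match s with
  | Unit => cid _
  | Leaf X =>
    (fix brl t R : hom (X \ox act t R) (act t (X \ox R)) :=
     match t return hom (X \ox act t R) (act t (X \ox R)) with
     | Unit => cid _
     | Leaf Y => @nt F K (Node (Leaf X) (Leaf Y)) (Node (Leaf Y) (Leaf X)) (braid X Y) R
     | Node t1 t2 => amap t1 (brl t2 R) \oc brl t1 (act t2 R)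
     end) t R
  | Node s1 s2 => brt s1 t (act s2 R) \oc amap s1 (brt s2 t R)
  end.

Fixpoint brtV s t R : hom (act t (act s R)) (act s (act t R)) :=
  match s with
  | Unit => cid _
  | Leaf X =>
    (fix brl t R : hom (act t (X \ox R)) (X \ox act t R) :=
     match t return hom (act t (X \ox R)) (X \ox act t R) with
     | Unit => cid _
     | Leaf Y => @nt F K (Node (Leaf Y) (Leaf X)) (Node (Leaf X) (Leaf Y)) (braidV X Y) R
     | Node t1 t2 => brl t1 (act t2 R) \oc amap t1 (brl t2 R)
     end) t R
  | Node s1 s2 => amap s1 (brtV s2 t R) \oc brtV s1 t (act s2 R)
  end.

Lemma brtK s t R : brtV s t R \oc brt s t R = cid _.
Proof.
elim: s t R => [|X|s1 IH1 s2 IH2] t R /=; first exact: cidl.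
  elim: t R => [|Y|t1 IH1 t2 IH2] R; first exact: cidl.
    have /= <- := @nt_comp F K _ (Node (Leaf X) (Leaf Y)) (Node (Leaf Y) (Leaf X))
      (Node (Leaf X) (Leaf Y)) (braidV X Y) (braid X Y) R.
    by rewrite brK; exact: (nt_id (Node (Leaf X) (Leaf Y))).
  rewrite /= -!ocA [amap _ _ \oc (amap _ _ \oc _)]ocA -amap_comp IH2 amap_id cidl.
  exact: IH1.
rewrite -!ocA [brtV _ _ _ \oc (brt _ _ _ \oc _)]ocA IH1 cidl -amap_comp IH2.
exact: amap_id.
Qed.

(* With both indices trivial the hexagon says that [braid X 1], up to unit
   constraints, is idempotent; being invertible, it is the identity. *)
Lemma nt_braid_unitr s R :
  @nt F K (Node s Unit) (Node Unit s) (braid (ob s) (tunit K)) R = cid _.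
Proof.
set n := nt _ R.
have nV : @nt F K (Node Unit s) (Node s Unit) (braidV (ob s) (tunit K)) R \oc n = cid _.
  have <- := @nt_comp F K _ (Node s Unit) (Node Unit s) (Node s Unit)
    (braidV _ _) (braid _ _) R.
  by rewrite brK; exact: (nt_id (Node s Unit)).
have nn : n \oc n = n.
  have hex := hexagon bbK (X := ob s) (Y := tunit K) (Z := tunit K) I I I.
  have {hex} := congr1 (fun f => @nt F K (Node (Node s Unit) Unit)
                                   (Node Unit (Node Unit s)) f R) hex.
  rewrite (@nt_comp _ _ _ _ (Node s (Node Unit Unit))) nt_assoc cidr.
  rewrite (@nt_comp _ _ _ _ (Node (Node Unit Unit) s)) nt_assoc cidl.
  rewrite (@nt_comp _ _ _ _ (Node (Node Unit s) Unit)).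
  rewrite (@nt_comp _ _ _ _ (Node Unit (Node s Unit))) nt_assoc cidr.
  rewrite (@nt_tens _ _ _ Unit Unit (Node s Unit) (Node Unit s)).
  rewrite (@nt_tens _ _ _ (Node s Unit) (Node Unit s) Unit Unit).
  rewrite !nt_id amap_id cidl cidr => <-.
  have nat := br_nat (cid (ob s)) (lunit (tunit K)).
  have {nat} := congr1 (fun f => @nt F K (Node s (Node Unit Unit))
                                   (Node Unit s) f R) nat.
  rewrite (@nt_comp _ _ _ _ (Node s Unit)) (@nt_comp _ _ _ _ (Node (Node Unit Unit) s)).
  rewrite (@nt_tens _ _ _ s s (Node Unit Unit) Unit).
  rewrite (@nt_tens _ _ _ (Node Unit Unit) Unit s s).
  rewrite !(@nt_lunit _ _ _ Unit) !nt_id !amap_id !cidr !cidl. by [].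
by rewrite -nV -[in RHS]nn ocA nV cidl.
Qed.

Lemma nt_braid_unitl s R :
  @nt F K (Node Unit s) (Node s Unit) (braid (tunit K) (ob s)) R = cid _.
Proof.
set n := nt _ R.
have nV : @nt F K (Node s Unit) (Node Unit s) (braidV (tunit K) (ob s)) R \oc n = cid _.
  have <- := @nt_comp F K _ (Node Unit s) (Node s Unit) (Node Unit s)
    (braidV _ _) (braid _ _) R.
  by rewrite brK; exact: (nt_id (Node Unit s)).
have nn : n \oc n = n.
  have hex := hexagonV bbK (X := tunit K) (Y := tunit K) (Z := ob s) I I I.
  have {hex} := congr1 (fun f => @nt F K (Node Unit (Node Unit s))
                                   (Node (Node s Unit) Unit) f R) hex.
  rewrite (@nt_comp _ _ _ _ (Node (Node Unit Unit) s)) nt_assocV cidr.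
  rewrite (@nt_comp _ _ _ _ (Node s (Node Unit Unit))) nt_assocV cidl.
  rewrite (@nt_comp _ _ _ _ (Node Unit (Node s Unit))).
  rewrite (@nt_comp _ _ _ _ (Node (Node Unit s) Unit)) nt_assocV cidr.
  rewrite (@nt_tens _ _ _ Unit Unit (Node Unit s) (Node s Unit)).
  rewrite (@nt_tens _ _ _ (Node Unit s) (Node s Unit) Unit Unit).
  rewrite !nt_id amap_id cidl cidr => <-.
  have nat := br_nat (lunit (tunit K)) (cid (ob s)).
  have {nat} := congr1 (fun f => @nt F K (Node (Node Unit Unit) s)
                                   (Node s Unit) f R) nat.
  rewrite (@nt_comp _ _ _ _ (Node Unit s)) (@nt_comp _ _ _ _ (Node s (Node Unit Unit))).
  rewrite (@nt_tens _ _ _ s s (Node Unit Unit) Unit).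
  rewrite (@nt_tens _ _ _ (Node Unit Unit) Unit s s).
  by rewrite !(@nt_lunit _ _ _ Unit) !nt_id !amap_id !cidr !cidl.
by rewrite -nV -[in RHS]nn ocA nV cidl.
Qed.

Lemma nt_braid_noder s t u R :
  @nt F K (Node s (Node t u)) (Node (Node t u) s) (braid _ _) R =
  amap t (@nt F K (Node s u) (Node u s) (braid _ _) R)
    \oc @nt F K (Node s t) (Node t s) (braid _ _) (act u R).
Proof.
have hex := hexagon bbK (X := ob s) (Y := ob t) (Z := ob u) I I I.
have {hex} := congr1 (fun f => @nt F K (Node (Node s t) u) (Node t (Node u s)) f R) hex.
rewrite (@nt_comp _ _ _ _ (Node s (Node t u))) nt_assoc cidr.
rewrite (@nt_comp _ _ _ _ (Node (Node t u) s)) nt_assoc cidl => ->.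
rewrite (@nt_comp _ _ _ _ (Node (Node t s) u)).
rewrite (@nt_comp _ _ _ _ (Node t (Node s u))) nt_assoc cidr.
rewrite (@nt_tens _ _ _ t t (Node s u) (Node u s)).
rewrite (@nt_tens _ _ _ (Node s t) (Node t s) u u).
by rewrite !nt_id amap_id cidl cidr.
Qed.

Lemma nt_braid_nodel s t u R :
  @nt F K (Node (Node s t) u) (Node u (Node s t)) (braid _ _) R =
  @nt F K (Node s u) (Node u s) (braid _ _) (act t R)
  \oc amap s (@nt F K (Node t u) (Node u t) (braid _ _) R).
Proof.
have hex := hexagonV bbK (X := ob s) (Y := ob t) (Z := ob u) I I I.
have {hex} := congr1 (fun f => @nt F K (Node s (Node t u)) (Node (Node u s) t) f R) hex.
rewrite (@nt_comp _ _ _ _ (Node (Node s t) u)) nt_assocV cidr.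
rewrite (@nt_comp _ _ _ _ (Node u (Node s t))) nt_assocV cidl => ->.
rewrite (@nt_comp _ _ _ _ (Node s (Node u t))).
rewrite (@nt_comp _ _ _ _ (Node (Node s u) t)) nt_assocV cidr.
rewrite (@nt_tens _ _ _ s s (Node t u) (Node u t)).
rewrite (@nt_tens _ _ _ (Node s u) (Node u s) t t).
by rewrite !nt_id amap_id cidl cidr.
Qed.

Lemma nt_braid s t R : @nt F K (Node s t) (Node t s) (braid _ _) R = brt s t R.
Proof.
elim: s t R => [|X|s1 IH1 s2 IH2] t R /=; first exact: nt_braid_unitl.
  elim: t R => [|Y|t1 IH1 t2 IH2] R //; first exact: (nt_braid_unitr (Leaf X)).
  by rewrite (nt_braid_noder (Leaf X)) IH1 IH2.
by rewrite nt_braid_nodel IH1 IH2.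
Qed.

Lemma nt_braidV s t R : @nt F K (Node t s) (Node s t) (braidV _ _) R = brtV s t R.
Proof.
apply: (@nt_inv _ _ _ (Node s t) (Node t s) _ _ _ (brt s t R)).
- exact: brVK.
- exact: nt_braid.
- exact: brtK.
Qed.

End Braid.

(** * Diagram calculus *)

(* A morphism [f : ob s -> ob t] is represented by the natural family
   [nt f R : act s R -> act t R] it induces on objects bracketed to the right, on which
   all coherence isomorphisms act as identities and naturality of [f] lets it slide past
   anything to its right.  [diag] turns an equation of morphisms into an equation of such
   right nested composites; [drwN E] and [dwrN E] rewrite with the equation [E] (to the
   right, to the left) after [N] strands, [earlyN f] and [lateN f] slide [f].  The tactics
   with prefix [m] do not resolve braidings and need no braiding axioms. *)
Section Diagrams.
Variables (F : closedFieldType) (K : ribbonData F).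
Local Notation tree := (tree K).

Inductive expr : tree -> tree -> Type :=
| EGen s t of hom (ob s) (ob t) : expr s t
| EId s : expr s s
| EComp s t u of expr t u & expr s t : expr s u
| ETens s t s' t' of expr s t & expr s' t' : expr (Node s s') (Node t t')
| EAssoc s t u : expr (Node (Node s t) u) (Node s (Node t u))
| EAssocV s t u : expr (Node s (Node t u)) (Node (Node s t) u)
| ELunit s : expr (Node Unit s) s
| ELunitV s : expr s (Node Unit s)
| ERunit s : expr (Node s Unit) s
| ERunitV s : expr s (Node s Unit)
| EBraid s t : expr (Node s t) (Node t s)
| EBraidV s t : expr (Node t s) (Node s t).

Fixpoint den s t (e : expr s t) : hom (ob s) (ob t) :=
  match e with
  | EGen s t f => f
  | EId s => cid (ob s)
  | EComp s t u g f => den g \oc den f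
  | ETens s t s' t' f g => den f \om den g
  | EAssoc s t u => assoc (ob s) (ob t) (ob u)
  | EAssocV s t u => assocV (ob s) (ob t) (ob u)
  | ELunit s => lunit (ob s)
  | ELunitV s => lunitV (ob s)
  | ERunit s => runit (ob s)
  | ERunitV s => runitV (ob s)
  | EBraid s t => braid (ob s) (ob t)
  | EBraidV s t => braidV (ob s) (ob t)
  end.

(** Composes [x] with the crossing [brt s t R], placed after the strands [p], one crossing of leaves
    at a time. The result is a flat right nested composite, open to rewriting; [p] grows as the
    trees are taken apart. *)
Fixpoint appbr (p s t : tree) R T : hom T (act p (act s (act t R))) ->
    hom T (act p (act t (act s R))) :=
  match s with
  | Unit => fun x => x
  | Leaf X =>
    (fix brl p t R : hom T (act p (X \ox act t R)) -> hom T (act p (act t (X \ox R))) :=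
     match t return hom T (act p (X \ox act t R)) -> hom T (act p (act t (X \ox R))) with
     | Unit => fun x => x
     | Leaf Y => fun x => amap p
         (@nt F K (Node (Leaf X) (Leaf Y)) (Node (Leaf Y) (Leaf X)) (braid X Y) R) \oc x
     | Node t1 t2 => fun x => brl (Node p t1) t2 R (brl p t1 (act t2 R) x)
     end) p t R
  | Node s1 s2 => fun x =>
      @appbr p s1 t (act s2 R) T (@appbr (Node p s1) s2 t R T x)
  end.

Fixpoint appbrV (p s t : tree) R T : hom T (act p (act t (act s R))) ->
    hom T (act p (act s (act t R))) :=
  match s with
  | Unit => fun x => x
  | Leaf X =>
    (fix brl p t R : hom T (act p (act t (X \ox R))) -> hom T (act p (X \ox act t R)) :=
     match t return hom T (act p (act t (X \ox R))) -> hom T (act p (X \ox act t R)) with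
     | Unit => fun x => x
     | Leaf Y => fun x => amap p
         (@nt F K (Node (Leaf Y) (Leaf X)) (Node (Leaf X) (Leaf Y)) (braidV X Y) R) \oc x
     | Node t1 t2 => fun x => brl p t1 (act t2 R) (brl (Node p t1) t2 R x)
     end) p t R
  | Node s1 s2 => fun x =>
      @appbrV (Node p s1) s2 t R T (@appbrV p s1 t (act s2 R) T x)
  end.

Fixpoint app (p : tree) s t (e : expr s t) R T :
    hom T (act p (act s R)) -> hom T (act p (act t R)) :=
  match e with
  | EGen s t f => fun x => amap p (nt f R) \oc x
  | EComp s t u g f => fun x => @app p t u g R T (@app p s t f R T x)
  | ETens s t s' t' f g => fun x => @app p s t f (act t' R) T (@app (Node p s) s' t' g R T x)
  | EBraid s t => @appbr p s t R T
  | EBraidV s t => @appbrV p s t R T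
  | EId _ | EAssoc _ _ _ | EAssocV _ _ _ => fun x => x
  | ELunit _ | ELunitV _ | ERunit _ | ERunitV _ => fun x => x
  end.

(** For these expressions the monoidal axioms suffice. This makes the calculus available in the
    whole extension, whose braiding appears there only as a generator without laws. *)
Fixpoint planar s t (e : expr s t) : bool :=
  match e with
  | EComp _ _ _ g f => planar g && planar f
  | ETens _ _ _ _ f g => planar f && planar g
  | EBraid _ _ | EBraidV _ _ => false
  | _ => true
  end.

Arguments app p [s t] e [R T] x.
Arguments appbr [p s t R T] x.
Arguments appbrV [p s t R T] x.

Context {mK : monoidal K}.

Lemma appbrE p s t R T (x : hom T (act p (act s (act t R)))) :
  appbr x = amap p (brt s t R) \oc x.
Proof.
elim: s p t R x => [|X|s1 IH1 s2 IH2] p t R x /=; first by rewrite amap_id cidl.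
  elim: t p R x => [|Y|t1 IH1 t2 IH2] p R x //=; first by rewrite amap_id cidl.
  by rewrite IH1 IH2 /= amap_comp !ocA.
by rewrite IH1 IH2 /= amap_comp !ocA.
Qed.

Lemma appbrVE p s t R T (x : hom T (act p (act t (act s R)))) :
  appbrV x = amap p (brtV s t R) \oc x.
Proof.
elim: s p t R x => [|X|s1 IH1 s2 IH2] p t R x /=; first by rewrite amap_id cidl.
  elim: t p R x => [|Y|t1 IH1 t2 IH2] p R x //=; first by rewrite amap_id cidl.
  by rewrite IH1 IH2 /= amap_comp !ocA.
by rewrite IH1 IH2 /= amap_comp !ocA.
Qed.

Lemma appE p s t (e : expr s t) R T (x : hom T (act p (act s R))) :
  planar e \/ braided K -> app p e x = amap p (nt (den e) R) \oc x.
Proof.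
elim: e p R x => {s t} [s t f|s|s t u g IHg f IHf|s t s' t' f IHf g IHg
  |s t u|s t u|s|s|s|s|s t|s t] p R x /= ok.
- by [].
- by rewrite nt_id amap_id cidl.
- have [okg okf] : (planar g \/ braided K) /\ (planar f \/ braided K).
    by case: ok => [/andP[]|]; auto.
  by rewrite IHg // IHf // (nt_comp (t := t)) amap_comp ocA.
- have [okf okg] : (planar f \/ braided K) /\ (planar g \/ braided K).
    by case: ok => [/andP[]|]; auto.
  by rewrite IHf // IHg // (nt_tens (s := s) (t := t)) amap_comp ocA.
- by rewrite nt_assoc amap_id cidl.
- by rewrite nt_assocV amap_id cidl.
- by rewrite (nt_lunit (K := K)) amap_id cidl.
- by rewrite (nt_lunitV (K := K)) amap_id cidl.
- by rewrite (nt_runit (K := K)) amap_id cidl.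
- by rewrite (nt_runitV (K := K)) amap_id cidl.
- by case: ok => // bK; rewrite appbrE nt_braid.
- by case: ok => // bK; rewrite appbrVE nt_braidV.
Qed.

Lemma diagP s t (e1 e2 : expr s t) :
  (planar e1 && planar e2 \/ braided K) ->
  (forall R T (x : hom T (act s R)), app Unit e1 x = app Unit e2 x) ->
  den e1 = den e2.
Proof.
move=> ok e; apply: nt_inj.
have := e (tunit K) _ (cid _).
by rewrite !appE /= ?cidr //; case: ok => [/andP[]|]; auto.
Qed.

(** The strands [p] to the left, the tail [R] and the remaining composite [x] are arbitrary, so that
    an equation applies at any place of a diagram. *)
Lemma ruleP s t (e1 e2 : expr s t) :
  (planar e1 && planar e2 \/ braided K) -> den e1 = den e2 ->
  forall p R T (x : hom T (act p (act s R))), app p e1 x = app p e2 x.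
Proof.
move=> ok e p R T x.
by rewrite !appE ?e //; case: ok => [/andP[]|]; auto.
Qed.

Lemma slideP s t (f : hom (ob s) (ob t)) p R R' (g : hom R R') T
    (x : hom T (act p (act s R))) :
  comp (r := K) (amap p (nt f R')) (comp (r := K) (amap p (amap s g)) x) =
  comp (r := K) (amap p (amap t g)) (comp (r := K) (amap p (nt f R)) x).
Proof. by rewrite !ocA -!amap_comp nt_nat. Qed.

End Diagrams.

Arguments EId {F K} s.
Arguments EAssoc {F K} s t u.
Arguments EAssocV {F K} s t u.
Arguments ELunit {F K} s.
Arguments ELunitV {F K} s.
Arguments ERunit {F K} s.
Arguments ERunitV {F K} s.
Arguments EBraid {F K} s t.
Arguments EBraidV {F K} s t.

Lemma okb (F : closedFieldType) (K : ribbonData F) (bK : braided K) (b : bool) :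
  b \/ braided K.
Proof. by right. Qed.

Lemma okm (F : closedFieldType) (K : ribbonData F) (b : bool) : b = true -> b \/ braided K.
Proof. by left. Qed.

Ltac rtree X :=
  lazymatch X with
  | @tunit ?F ?K => constr:(@Unit F K)
  | @tens ?F ?K ?Y ?Z =>
      let s := rtree Y in let t := rtree Z in constr:(@Node F K s t)
  | ?Y => constr:(Leaf Y)
  end.

(* [b] tells whether crossings are resolved or treated as generators *)
Ltac rexpr b f :=
  lazymatch f with
  | @comp _ _ _ _ _ ?g ?h =>
      let x := rexpr b g in let y := rexpr b h in constr:(EComp x y)
  | @tensm _ _ _ _ _ _ ?g ?h =>
      let x := rexpr b g in let y := rexpr b h in constr:(ETens x y)
  | @cid _ _ ?X => let s := rtree X in constr:(EId s)
  | @assoc _ _ ?X ?Y ?Z =>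
      let s := rtree X in let t := rtree Y in let u := rtree Z in constr:(EAssoc s t u)
  | @assocV _ _ ?X ?Y ?Z =>
      let s := rtree X in let t := rtree Y in let u := rtree Z in constr:(EAssocV s t u)
  | @lunit _ _ ?X => let s := rtree X in constr:(ELunit s)
  | @lunitV _ _ ?X => let s := rtree X in constr:(ELunitV s)
  | @runit _ _ ?X => let s := rtree X in constr:(ERunit s)
  | @runitV _ _ ?X => let s := rtree X in constr:(ERunitV s)
  | @braid _ _ ?X ?Y =>
      lazymatch b with
      | true => let s := rtree X in let t := rtree Y in constr:(EBraid s t)
      | false => rgen f
      end
  | @braidV _ _ ?X ?Y =>
      lazymatch b with
      | true => let s := rtree X in let t := rtree Y in constr:(EBraidV s t)
      | false => rgen f
      end
  | _ => rgen f
  end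
with rgen f :=
  lazymatch type of f with
  | context [@hom ?F ?K ?X ?Y] =>
      let s := rtree X in let t := rtree Y in constr:(@EGen F K s t f)
  end.

Ltac diag_cbn := cbn [app appbr appbrV amap act ob].

Ltac diag_with b tac :=
  lazymatch goal with
  | |- ?f = ?g =>
    let x := rexpr b f in let y := rexpr b g in
    refine (@diagP _ _ _ _ _ x y _ _); [tac | ];
    let R := fresh "R" in let T := fresh "T" in let x := fresh "x" in
    intros R T x; revert x; diag_cbn; intro x
  end.

Tactic Notation "diag" := diag_with true ltac:(exact: okb).
Tactic Notation "mdiag" := diag_with false ltac:(exact: okm).

Ltac mkprefix d r :=
  lazymatch d with
  | 0%N => constr:(r Unit)
  | 1%N => constr:(fun a => r (Leaf a))
  | 2%N => constr:(fun a b => r (Node (Leaf a) (Leaf b)))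
  | 3%N => constr:(fun a b c => r (Node (Leaf a) (Node (Leaf b) (Leaf c))))
  end.

Ltac mkrule_with b tac E d rl :=
  lazymatch type of E with
  | ?f = ?g =>
    let x := rexpr b f in let y := rexpr b g in
    let ok := fresh "ok" in
    lazymatch type of f with context [@hom ?F ?K _ _] =>
      assert (ok : planar x && planar y \/ @braided F K) by tac
    end;
    let r := mkprefix d constr:(@ruleP _ _ _ _ _ x y ok E) in
    pose proof r as rl; clear ok;
    cbn [app appbr appbrV amap act ob] in rl
  end.

Ltac drw_core b tac E d := let rl := fresh "rl" in mkrule_with b tac E d rl; rewrite rl; clear rl.
Ltac drwr_core b tac E d := let rl := fresh "rl" in mkrule_with b tac E d rl; rewrite [in RHS]rl; clear rl.
Ltac dwrr_core b tac E d := let rl := fresh "rl" in mkrule_with b tac E d rl; rewrite -[in RHS]rl; clear rl.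
Ltac drwl_core b tac E d := let rl := fresh "rl" in mkrule_with b tac E d rl; rewrite [in LHS]rl; clear rl.
Ltac dwrl_core b tac E d := let rl := fresh "rl" in mkrule_with b tac E d rl; rewrite -[in LHS]rl; clear rl.
Ltac dwr_core b tac E d := let rl := fresh "rl" in mkrule_with b tac E d rl; rewrite -rl; clear rl.

Tactic Notation "drw" constr(E) := drw_core true ltac:(exact: okb) E 0%N.
Tactic Notation "dwr" constr(E) := dwr_core true ltac:(exact: okb) E 0%N.
Tactic Notation "drwR" constr(E) := drwr_core true ltac:(exact: okb) E 0%N.
Tactic Notation "dwrR" constr(E) := dwrr_core true ltac:(exact: okb) E 0%N.
Tactic Notation "drwL" constr(E) := drwl_core true ltac:(exact: okb) E 0%N.
Tactic Notation "dwrL" constr(E) := dwrl_core true ltac:(exact: okb) E 0%N.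
Tactic Notation "mdrw" constr(E) := drw_core false ltac:(exact: okm) E 0%N.
Tactic Notation "mdwr" constr(E) := dwr_core false ltac:(exact: okm) E 0%N.
Tactic Notation "drw1" constr(E) := drw_core true ltac:(exact: okb) E 1%N.
Tactic Notation "dwr1" constr(E) := dwr_core true ltac:(exact: okb) E 1%N.
Tactic Notation "drwR1" constr(E) := drwr_core true ltac:(exact: okb) E 1%N.
Tactic Notation "dwrR1" constr(E) := dwrr_core true ltac:(exact: okb) E 1%N.
Tactic Notation "mdrw1" constr(E) := drw_core false ltac:(exact: okm) E 1%N.
Tactic Notation "mdwr1" constr(E) := dwr_core false ltac:(exact: okm) E 1%N.
Tactic Notation "drw2" constr(E) := drw_core true ltac:(exact: okb) E 2%N.
Tactic Notation "dwr2" constr(E) := dwr_core true ltac:(exact: okb) E 2%N.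
Tactic Notation "drwR2" constr(E) := drwr_core true ltac:(exact: okb) E 2%N.
Tactic Notation "mdrw2" constr(E) := drw_core false ltac:(exact: okm) E 2%N.
Tactic Notation "mdrw3" constr(E) := drw_core false ltac:(exact: okm) E 3%N.

Ltac mkslide f d sl :=
  lazymatch type of f with
  | context [@hom ?F ?K ?X ?Y] =>
      let s := rtree X in let t := rtree Y in
      let r := mkprefix d constr:(@slideP F K _ s t f) in
      pose proof r as sl; cbn [app appbr appbrV amap act ob] in sl
  end.
Ltac early_core f d := let sl := fresh "sl" in mkslide f d sl; rewrite !sl; clear sl.
Ltac oncel_core f d := let sl := fresh "sl" in mkslide f d sl; rewrite -sl; clear sl.
Ltac late_core f d := let sl := fresh "sl" in mkslide f d sl; rewrite -!sl; clear sl.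
Tactic Notation "early" constr(f) := early_core f 0%N.
Tactic Notation "late_once" constr(f) := oncel_core f 0%N.
Tactic Notation "late" constr(f) := late_core f 0%N.
Tactic Notation "early1" constr(f) := early_core f 1%N.
Tactic Notation "late_once1" constr(f) := oncel_core f 1%N.
Tactic Notation "late1" constr(f) := late_core f 1%N.
Tactic Notation "early2" constr(f) := early_core f 2%N.
Tactic Notation "late2" constr(f) := late_core f 2%N.

(** * The extension *)

(** The field [fbraid2] records that [A] lies in a symmetric subcategory, while the ambient braiding
    is arbitrary. *)
Record comm_frobenius (F : closedFieldType) (C : ribbonData F) (A : frobenius C) : Prop :=
    CommFrobenius {
  fmulA : fmul A \oc (fmul A \om cid (A : C)) =
          fmul A \oc (cid (A : C) \om fmul A) \oc assoc (A : C) A A;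
  fmul1l : fmul A \oc (funit A \om cid (A : C)) = lunit (A : C);
  fmul1r : fmul A \oc (cid (A : C) \om funit A) = runit (A : C);
  fcomulA : assoc (A : C) A A \oc (fcomul A \om cid (A : C)) \oc fcomul A =
            (cid (A : C) \om fcomul A) \oc fcomul A;
  fcomul1l : (fcounit A \om cid (A : C)) \oc fcomul A = lunitV (A : C);
  fcomul1r : (cid (A : C) \om fcounit A) \oc fcomul A = runitV (A : C);
  ffrobl : (cid (A : C) \om fmul A) \oc assoc (A : C) A A \oc (fcomul A \om cid (A : C)) =
           fcomul A \oc fmul A;
  ffrobr : (fmul A \om cid (A : C)) \oc assocV (A : C) A A \oc (cid (A : C) \om fcomul A) =
           fcomul A \oc fmul A;
  fmulC : fmul A \oc braid (A : C) A = fmul A;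
  fcomulC : braid (A : C) A \oc fcomul A = fcomul A;
  fbraid2 : braid (A : C) A \oc braid (A : C) A = cid ((A : C) \ox A)
}.

Section HatFunctor.
Variables (F : closedFieldType) (C : ribbonData F) (A : frobenius C).
Context {bC : braided C}.
Hypothesis frA : comm_frobenius A.
Local Notation a := (A : C).
Implicit Types (X Y Z T : C).

Local Notation "t \hc s" := (hat_comp (A := A) t s) (at level 45, left associativity).
Local Notation "s \ht t" := (hat_tens (A := A) s t) (at level 40, left associativity).
Local Notation h := (hat A).

Lemma hat_compA X Y Z T (f : hom (a \ox X) Y) (g : hom (a \ox Y) Z) (k : hom (a \ox Z) T) :
  k \hc (g \hc f) = k \hc g \hc f.
Proof.
rewrite /hat_comp; diag.
early (fcomul A).
by drw (fcomulA frA).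
Qed.

Lemma hat_comp_hatl X Y Z (f : hom Y Z) (s : hom (a \ox X) Y) : h f \hc s = f \oc s.
Proof.
rewrite /hat_comp /hat; diag.
early (fcounit A).
by drw (fcomul1l frA).
Qed.

Lemma hat_comp_hatr X Y Z (f : hom X Y) (s : hom (a \ox Y) Z) :
  s \hc h f = s \oc (cid a \om f).
Proof.
rewrite /hat_comp /hat; diag.
early1 (fcounit A).
by drw (fcomul1r frA).
Qed.

Lemma hat_comp_hat X Y Z (f : hom X Y) (g : hom Y Z) : h g \hc h f = h (g \oc f).
Proof. rewrite hat_comp_hatl /hat; diag. by early (fcounit A). Qed.

Lemma hat_tens_hat X Y Z T (f : hom X Y) (g : hom Z T) : h f \ht h g = h (f \om g).
Proof.
rewrite /hat_tens /hat; diag.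
early2 (fcounit A).
dwr1 (br_nat (fcounit A) (cid X)).
by drw (fcomul1r frA).
Qed.

(** In the interchange law two of the strands of [A] produced by the coproduct change places;
    cocommutativity enters here. *)
Lemma hat_tens_comp X Y Z X' Y' Z' (f : hom (a \ox X) Y) (g : hom (a \ox Y) Z)
    (f' : hom (a \ox X') Y') (g' : hom (a \ox Y') Z') :
  (g \hc f) \ht (g' \hc f') = (g \ht g') \hc (f \ht f').
Proof.
rewrite /hat_tens /hat_comp; diag.
early (fcomul A).
drw1 (br_nat (cid a) f).
early1 (braid a a).
early2 (braid a X).
late1 f.
dwr2 (br_nat (fcomul A) (cid X)).
late2 (braid a X).
drw (fcomulA frA).
dwr1 (fcomulA frA).
by drw1 (fcomulC frA).
Qed.

Lemma hat_assoc_nat X Y Z X' Y' Z' (f : hom (a \ox X) X') (g : hom (a \ox Y) Y')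
    (k : hom (a \ox Z) Z') :
  h (assoc X' Y' Z') \hc (f \ht g \ht k) = (f \ht (g \ht k)) \hc h (assoc X Y Z).
Proof.
rewrite hat_comp_hatl hat_comp_hatr /hat_tens; diag.
early (fcomul A).
dwr1 (br_nat (fcomul A) (cid X)).
early1 (braid a X).
early2 g.
by drw (fcomulA frA).
Qed.

Lemma hat_lunit_nat X Y (f : hom (a \ox X) Y) :
  h (lunit Y) \hc (h (cid (tunit C)) \ht f) = f \hc h (lunit X).
Proof.
rewrite hat_comp_hatl hat_comp_hatr /hat_tens /hat; diag.
early (fcounit A).
by drw (fcomul1l frA).
Qed.

Lemma hat_runit_nat X Y (f : hom (a \ox X) Y) :
  h (runit Y) \hc (f \ht h (cid (tunit C))) = f \hc h (runit X).
Proof.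
rewrite hat_comp_hatl hat_comp_hatr /hat_tens /hat; diag.
dwr1 (br_nat (fcounit A) (cid X)).
by drw (fcomul1r frA).
Qed.

Lemma hat_linear_category : linear_category [set: rtimes0 A]%classic.
Proof.
split=> [X Y f _ _|X Y f _ _|X Y Z T f g k _ _ _ _|X Y Z b g k f _ _ _|X Y Z b g f k _ _ _].
- by rewrite [LHS]hat_comp_hatl cidl.
- by rewrite [LHS]hat_comp_hatr om1 cidr.
- exact: hat_compA.
- by rewrite /= /hat_comp !(ocDl, ocZl).
- by rewrite /= /hat_comp omDr omZr !(ocDl, ocZl, ocDr, ocZr).
Qed.

Lemma hat_monoidal_category : monoidal_category [set: rtimes0 A]%classic.
Proof.
split=> //=.
- by move=> X Y Z T b f g k _ _ _ _; rewrite /hat_tens omDl omZl !(ocDl, ocZl).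
- by move=> X Y Z T b f g k _ _ _ _; rewrite /hat_tens omDr omZr !(ocDl, ocZl).
- by move=> X Y _ _; rewrite hat_tens_hat om1.
- by move=> *; apply: hat_tens_comp.
- by move=> X Y Z _ _ _; rewrite hat_comp_hat asK.
- by move=> X Y Z _ _ _; rewrite hat_comp_hat asVK.
- by move=> X _; rewrite hat_comp_hat luK.
- by move=> X _; rewrite hat_comp_hat luVK.
- by move=> X _; rewrite hat_comp_hat ruK.
- by move=> X _; rewrite hat_comp_hat ruVK.
- by move=> *; apply: hat_assoc_nat.
- by move=> *; apply: hat_lunit_nat.
- by move=> *; apply: hat_runit_nat.
- move=> W X Y Z _ _ _ _; rewrite !hat_tens_hat !hat_comp_hat.
  by rewrite (pentagon (monoidal_monoidal (K := C))).
- move=> X Y _ _; rewrite !hat_tens_hat !hat_comp_hat.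
  by rewrite (triangle (monoidal_monoidal (K := C))).
Qed.

Lemma hat_monoidal : monoidal (rtimes0 A).
Proof. by split; [apply: hat_linear_category | apply: hat_monoidal_category]. Qed.

Lemma fbraidV : braidV a a = braid a a.
Proof. by rewrite -[RHS]cidl -(brK a a) -ocA (fbraid2 frA) cidr. Qed.

(* The double braiding of [A] with the target of [s] is trivial on the image of [s]:
   these are the morphisms between objects of grade e. *)
Definition central X Y (s : hom (a \ox X) Y) :=
  braid Y a \oc braid a Y \oc (cid a \om s) = cid a \om s.

Lemma central_hcompl X Y Z (s : hom (a \ox X) Y) (t : hom (a \ox Y) Z) :
  central t -> central (t \hc s).
Proof.
rewrite /central => ct; rewrite /hat_comp; diag.
by drw ct.
Qed.

(** With [central_hcompl], this makes the central morphisms a two-sided ideal. The ring around the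
    target is pulled back through [t] to [A \ox Y]; there it splits into a ring around [A], trivial
    by [fbraid2], and one around [Y], absorbed by [s]. *)
Lemma central_hcompr X Y Z (s : hom (a \ox X) Y) (t : hom (a \ox Y) Z) :
  central s -> central (t \hc s).
Proof.
rewrite /central => cs; rewrite /hat_comp; diag.
drw (br_nat (cid a) t).
drw (br_nat t (cid a)).
early (braid a a).
drw1 cs.
late (braid a a).
by drw (fbraid2 frA).
Qed.

Lemma central_htens X Y X' Y' (s : hom (a \ox X) X') (t : hom (a \ox Y) Y') :
  central s -> central t -> central (s \ht t).
Proof.
rewrite /central => cs ct; rewrite /hat_tens; diag.
drw (br_nat (cid a) s).
late s.
early (braid a a).
early1 (braid a X).
drw2 ct.
late1 (braid a X).
late (braid a a).
dwr (br_nat (cid a) s).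
by drw cs.
Qed.

(** Centrality concerns an additional strand of [A] around the target of [s]. Pulled back through
    [s], it encircles [A \ox X]; its ring around [A] is trivial by [fbraid2], so the ring around [X]
    is absorbed as well. The copairing in [snake] lets the input strand of [s] itself be the
    encircling one. *)
Lemma central_mon X Y (s : hom (a \ox X) Y) :
  central s -> s \oc (braid X a \oc braid a X) = s.
Proof.
rewrite /central => cs.
have snake : s = lunit Y \oc ((fcounit A \oc fmul A \oc braid a a) \om s) \oc
     assoc (a \ox a) a X \oc (assocV a a a \om cid X) \oc
     (cid a \om (fcomul A \oc funit A) \om cid X) \oc (runitV a \om cid X).
  diag.
  drw (fmulC frA).
  early (fmul A); early (fcounit A).
  drw (ffrobr frA).
  drw (fcomul1l frA).
  by drw (fmul1r frA).
have swap (u : hom (tunit C) (a \ox a)) :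
    (cid a \om braid a a) \oc assoc a a a \oc (u \om cid a) \oc lunitV a =
    assoc a a a \oc (braid a a \om cid a) \oc assocV a a a \oc (cid a \om u) \oc runitV a.
  diag.
  dwr (br_nat (cid a) u).
  by drw1 (fbraid2 frA).
symmetry; rewrite {1}snake [in RHS]snake; diag.
early (braid a a).
dwr (swap (fcomul A \oc funit A)); dwr (swap (fcomul A \oc funit A)).
dwr1 cs.
drw1 (br_nat (cid a) s).
drw1 (br_nat s (cid a)).
drw1 (fbraid2 frA).
by early (funit A); early (fcomul A).
Qed.

(** The two sides differ by a double braiding of the strand of [A] that belongs to [t] with the
    target of [s]; centrality of [s] removes it. *)
Lemma hat_braid_nat X Y X' Y' (s : hom (a \ox X) X') (t : hom (a \ox Y) Y') :
  central s ->
  h (braid X' Y') \hc (s \ht t) = (t \ht s) \hc h (braid X Y).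
Proof.
rewrite /central => cs.
have key : braid X' a \oc (s \om cid a) \oc assocV a X a \oc (cid a \om braid a X) \oc assoc a a X =
    (cid a \om s) \oc assoc a a X \oc (braid a a \om cid X).
  diag.
  dwr cs.
  drw (br_nat (cid a) s).
  by drw (fbraid2 frA).
rewrite hat_comp_hatl hat_comp_hatr /hat_tens; diag.
early s.
drw (br_nat (cid X') t).
drw key.
drw (fcomulC frA).
drw1 (br_nat s (cid Y)).
by early (fcomul A).
Qed.

Lemma hat_tensr X Y Z T (s : hom (a \ox X) Y) (g : hom Z T) :
  s \ht h g = (s \om g) \oc assocV a X Z.
Proof.
rewrite /hat_tens /hat; diag.
early2 (fcounit A).
dwr1 (br_nat (fcounit A) (cid X)).
by drw (fcomul1r frA).
Qed.

Lemma hat_tensl X Y Z T (g : hom X Y) (t : hom (a \ox Z) T) :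
  h g \ht t = (g \om t) \oc assoc X a Z \oc (braid a X \om cid Z) \oc assocV a X Z.
Proof.
rewrite /hat_tens /hat; diag.
early g.
early (fcounit A).
drw (fcomul1l frA).
by early g.
Qed.

Lemma hat_transpose X Y (f : hom (a \ox X) Y) :
  transpose (C := rtimes0 A) f =
  lunit (dual X) \oc (ev Y \om cid (dual X)) \oc assocV (dual Y) Y (dual X) \oc
    (cid (dual Y) \om (f \om cid (dual X))) \oc
    (cid (dual Y) \om assocV a X (dual X)) \oc assoc (dual Y) a (X \ox dual X) \oc
    (braid a (dual Y) \om cid (X \ox dual X)) \oc assocV a (dual Y) (X \ox dual X) \oc
    (cid a \om ((cid (dual Y) \om coev X) \oc runitV (dual Y))).
Proof.
rewrite /transpose /= !hat_tens_hat !hat_tensr !hat_tensl.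
rewrite !hat_comp_hat hat_comp_hatl !hat_comp_hatr.
by diag.
Qed.

Lemma central_transpose X Y (f : hom (a \ox X) Y) :
  central f -> @central (dual Y) (dual X) (transpose (C := rtimes0 A) f).
Proof.
rewrite /central hat_transpose => cf; diag.
drw (br_nat (cid a) (ev Y)).
late (ev Y).
(* On the image of a central morphism, over- and undercrossings with [A] agree. *)
have cfV : braid a Y \oc (cid a \om f) = braidV Y a \oc (cid a \om f).
  by rewrite -[in RHS]cf !ocA brK cidl.
early (braid a (dual Y)).
drwR1 cfV.
drw1 (br_nat (cid a) f).
drw1 (brV_nat f (cid a)).
rewrite fbraidV.
late1 f.
early1 (braid a (dual Y)).
early (braid a (dual Y)).
early1 (braid a a).
drw2 (br_nat (cid a) (coev X)).
have coevV : (braidV X a \om cid (dual X)) \oc assocV a X (dual X) \oc (cid a \om coev X) =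
    assocV X a (dual X) \oc (cid X \om braid (dual X) a) \oc assoc X (dual X) a \oc (coev X \om cid a) \oc
    lunitV a \oc runit a.
  diag.
  dwr (br_nat (coev X) (cid a)).
  by drw (brK X a).
by drwR2 coevV.
Qed.

(** Naturality of the twist of C at [s] produces the twist of [A \ox X], which is the twist of [X]
    followed by the double braiding with [A]; the latter is absorbed by [central_mon]. *)
Lemma hat_twist_nat (rC : rigid_ribbon_category [set: C]%classic) X Y (s : hom (a \ox X) Y) :
  twist a = cid a -> central s -> h (twist Y) \hc s = s \hc h (twist X).
Proof.
move=> twa cs; rewrite hat_comp_hatl hat_comp_hatr (twist_nat rC) //.
by rewrite (twist_tens rC) // twa !ocA -[s \oc _ \oc _]ocA central_mon.
Qed.

End HatFunctor.

(** * Rigidity and transposition *)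

(** Kept apart from braidings because the whole extension is rigid, whereas only its part of grade e
    is braided. *)
Class rigid (F : closedFieldType) (K : ribbonData F) : Prop := Rigid {
  rigid_is_monoidal :: monoidal K;
  rigid_zigzag : forall X : K,
    runit X \oc (cid X \om ev X) \oc assoc X (dual X) X \oc
      (coev X \om cid X) \oc lunitV X = cid X;
  rigid_zigzag_dual : forall X : K,
    lunit (dual X) \oc (ev X \om cid (dual X)) \oc
      assocV (dual X) X (dual X) \oc (cid (dual X) \om coev X) \oc
      runitV (dual X) = cid (dual X)
}.

Arguments rigid_zigzag {F K _} X.
Arguments rigid_zigzag_dual {F K _} X.

Section Transpose.
Variables (F : closedFieldType) (K : ribbonData F).
Context {rK : rigid K}.
Implicit Types (X Y Z : K).

Lemma ev_transpose X Y (f : hom X Y) :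
  ev Y \oc (cid (dual Y) \om f) = ev X \oc (transpose f \om cid X).
Proof.
rewrite /transpose; mdiag.
late (ev Y).
late1 f.
by mdrw1 (rigid_zigzag X).
Qed.

Lemma coev_transpose X Y (f : hom X Y) :
  (f \om cid (dual X)) \oc coev X = (cid Y \om transpose f) \oc coev Y.
Proof.
rewrite /transpose; mdiag.
late (coev Y).
by mdrw (rigid_zigzag Y).
Qed.

Lemma transpose_uniq X Y (f : hom X Y) (g : hom (dual Y) (dual X)) :
  ev Y \oc (cid (dual Y) \om f) = ev X \oc (g \om cid X) -> g = transpose f.
Proof.
move=> e; rewrite /transpose; mdiag.
mdrw e.
early g.
by mdrw (rigid_zigzag_dual X).
Qed.

Lemma transpose_comp X Y Z (f : hom X Y) (g : hom Y Z) :
  transpose (g \oc f) = transpose f \oc transpose g.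
Proof.
symmetry; apply: transpose_uniq.
mdiag.
mdrw (ev_transpose g).
early (transpose g).
by mdrw (ev_transpose f).
Qed.

End Transpose.

(** * Idempotent completion *)

Section Karoubi.
Variables (F : closedFieldType) (K : ribbonData F).
Context {mK : monoidal K}.
Local Notation kK := (karoubi K).
Local Notation idem := (@is_idem F K).
Implicit Types (P Q R S : kobj K).

(** The map whose fixed space is [khom_space]; naming it gives a place for the linearity instance
    needed to evaluate [linfun]. *)
Definition sandwich P Q (s : hom (tag P) (tag Q)) : hom (tag P) (tag Q) :=
  tagged Q \oc s \oc tagged P.

Lemma sandwich_linear P Q : linear (@sandwich P Q).
Proof. by move=> b s t; rewrite /sandwich !(ocDl, ocZl, ocDr, ocZr). Qed.

HB.instance Definition _ P Q :=
  GRing.isLinear.Build F (hom (tag P) (tag Q)) (hom (tag P) (tag Q)) *:%R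
    (@sandwich P Q) (@sandwich_linear P Q).

Lemma khom_spaceP P Q (s : hom (tag P) (tag Q)) :
  (s \in khom_space P Q) = (tagged Q \oc s \oc tagged P == s).
Proof.
rewrite /khom_space -[linfun _]/(linfun (@sandwich P Q)).
by apply/fixedSpaceP/eqP; rewrite lfunE.
Qed.

Lemma khomP P Q (s : khom P Q) : tagged Q \oc vsval s \oc tagged P = vsval s.
Proof. by apply/eqP; rewrite -khom_spaceP subvsP. Qed.

Lemma kmorK P Q (s : hom (tag P) (tag Q)) :
  tagged Q \oc s \oc tagged P = s -> vsval (kmor s : khom P Q) = s.
Proof. by move/eqP; rewrite -khom_spaceP => sPQ; rewrite /kmor vsprojK. Qed.

Lemma vsval_inj P Q (s t : khom P Q) : vsval s = vsval t -> s = t.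
Proof. exact: val_inj. Qed.

Lemma vsval_lin P Q b (s t : khom P Q) : vsval (b *: s + t) = b *: vsval s + vsval t.
Proof. by []. Qed.

Lemma khom_left P Q (s : khom P Q) : idem Q -> tagged Q \oc vsval s = vsval s.
Proof. by move=> iQ; rewrite -[in RHS](khomP s) -[in LHS](khomP s) !ocA iQ. Qed.

Lemma khom_right P Q (s : khom P Q) : idem P -> vsval s \oc tagged P = vsval s.
Proof. by move=> iP; rewrite -[in RHS](khomP s) -[in LHS](khomP s) -!ocA iP. Qed.

Lemma kmor_bi P Q (s : hom (tag P) (tag Q)) :
  tagged Q \oc s = s -> s \oc tagged P = s -> vsval (kmor s : khom P Q) = s.
Proof. by move=> sl sr; apply: kmorK; rewrite sl. Qed.

Lemma val_kid P : idem P -> vsval (cid (r := kK) P) = tagged P.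
Proof. by move=> iP; apply: kmor_bi. Qed.

Lemma val_kcomp P Q R (t : khom Q R) (s : khom P Q) : idem P -> idem R ->
  vsval (comp (r := kK) t s) = vsval t \oc vsval s.
Proof.
move=> iP iR; apply: kmor_bi; first by rewrite ocA khom_left.
by rewrite -ocA khom_right.
Qed.

Lemma idem_tens P Q : idem P -> idem Q -> idem (ktens P Q).
Proof. by rewrite /is_idem /= => iP iQ; rewrite -omC iP iQ. Qed.

Lemma idem_unit : idem (kunit K).
Proof. exact: cidl. Qed.

Lemma val_ktens P Q R S (s : khom P Q) (t : khom R S) :
  idem P -> idem Q -> idem R -> idem S ->
  vsval (tensm (r := kK) s t) = vsval s \om vsval t.
Proof.
move=> iP iQ iR iS; apply: kmor_bi; rewrite /= -omC ?khom_left //.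
by rewrite !khom_right.
Qed.

Lemma val_kassoc P Q R : idem P -> idem Q -> idem R ->
  vsval (assoc (r := kK) P Q R) =
  assoc (tag P) (tag Q) (tag R) \oc (tagged P \om tagged Q \om tagged R).
Proof.
move=> iP iQ iR; apply: kmor_bi => /=; rewrite ?ocA -?as_nat -?ocA -!omC ?iP ?iQ ?iR //.
Qed.

Lemma val_kassocV P Q R : idem P -> idem Q -> idem R ->
  vsval (assocV (r := kK) P Q R) =
  assocV (tag P) (tag Q) (tag R) \oc (tagged P \om (tagged Q \om tagged R)).
Proof.
move=> iP iQ iR; apply: kmor_bi => /=; rewrite ?ocA -?asV_nat -?ocA -!omC ?iP ?iQ ?iR //.
Qed.

Lemma val_klunit P : idem P -> vsval (lunit (r := kK) P) = tagged P \oc lunit (tag P).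
Proof.
by move=> iP; apply: kmor_bi => /=; rewrite ?ocA ?iP // -ocA lu_nat ocA iP.
Qed.

Lemma val_klunitV P : idem P -> vsval (lunitV (r := kK) P) = lunitV (tag P) \oc tagged P.
Proof.
move=> iP; apply: kmor_bi => /=; last by rewrite -ocA iP.
by apply: (cancel_l (luK _)); rewrite !ocA lu_nat luVK cidl -[_ \oc lunit _ \oc _]ocA luVK cidr iP.
Qed.

Lemma val_krunit P : idem P -> vsval (runit (r := kK) P) = tagged P \oc runit (tag P).
Proof.
by move=> iP; apply: kmor_bi => /=; rewrite ?ocA ?iP // -ocA ru_nat ocA iP.
Qed.

Lemma val_krunitV P : idem P -> vsval (runitV (r := kK) P) = runitV (tag P) \oc tagged P.
Proof.
move=> iP; apply: kmor_bi => /=; last by rewrite -ocA iP.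
by apply: (cancel_l (ruK _)); rewrite !ocA ru_nat ruVK cidl -[_ \oc runit _ \oc _]ocA ruVK cidr iP.
Qed.

Lemma karoubi_linear : linear_category (C := kK) idem.
Proof.
split.
- by move=> P Q f iP iQ; apply: vsval_inj; rewrite val_kcomp // val_kid // khom_left.
- by move=> P Q f iP iQ; apply: vsval_inj; rewrite val_kcomp // val_kid // khom_right.
- by move=> P Q R S f g k iP iQ iR iS; apply: vsval_inj; rewrite !val_kcomp // ocA.
- move=> P Q R b g k f iP iQ iR; apply: vsval_inj.
  by rewrite val_kcomp // !vsval_lin !val_kcomp // ocDl ocZl.
- move=> P Q R b g f k iP iQ iR; apply: vsval_inj.
  by rewrite val_kcomp // !vsval_lin !val_kcomp // ocDr ocZr.
Qed.

Lemma idem_pentagon (W X Y Z : K) (w : hom W W) (x : hom X X) (y : hom Y Y) (z : hom Z Z) :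
  w \oc w = w -> x \oc x = x -> y \oc y = y -> z \oc z = z ->
  assoc W X (Y \ox Z) \oc (w \om x \om (y \om z)) \oc
    (assoc (W \ox X) Y Z \oc (w \om x \om y \om z)) =
  (w \om (assoc X Y Z \oc (x \om y \om z))) \oc
    (assoc W (X \ox Y) Z \oc (w \om (x \om y) \om z)) \oc
    ((assoc W X Y \oc (w \om x \om y)) \om z).
Proof.
move=> ww xx yy zz; mdiag.
early w; early1 x; early2 y.
by do ?mdrw ww; do ?mdrw1 xx; do ?mdrw2 yy; do ?mdrw3 zz.
Qed.

Lemma idem_triangle (X Y : K) (x : hom X X) (y : hom Y Y) :
  x \oc x = x -> y \oc y = y ->
  (x \om (y \oc lunit Y)) \oc (assoc X (tunit K) Y \oc (x \om cid (tunit K) \om y)) =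
  (x \oc runit X) \om y.
Proof.
move=> xx yy; mdiag.
early x.
by mdrw xx; mdrw1 yy.
Qed.

Lemma karoubi_monoidal : monoidal_category (C := kK) idem.
Proof.
split.
- exact: idem_unit.
- exact: idem_tens.
- move=> P Q R S b f g k iP iQ iR iS; apply: vsval_inj.
  by rewrite vsval_lin !val_ktens // vsval_lin omDl omZl.
- move=> P Q R S b f g k iP iQ iR iS; apply: vsval_inj.
  by rewrite vsval_lin !val_ktens // vsval_lin omDr omZr.
- move=> P Q iP iQ; apply: vsval_inj.
  by rewrite val_ktens // !val_kid //; apply: idem_tens.
- move=> P Q R P' Q' R' f g f' g' iP iQ iR iP' iQ' iR'; apply: vsval_inj.
  have := (idem_tens iP iP', idem_tens iQ iQ', idem_tens iR iR') => -[[? ?] ?].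
  by rewrite val_ktens // !val_kcomp // !val_ktens // omC.
- move=> P Q R iP iQ iR; apply: vsval_inj.
  have ? := idem_tens (idem_tens iP iQ) iR; have ? := idem_tens iP (idem_tens iQ iR).
  rewrite val_kcomp // val_kassoc // val_kassocV // val_kid //=.
  rewrite -!ocA [(_ \om (_ \om _)) \oc _]ocA -as_nat -!ocA [assocV _ _ _ \oc _]ocA asK cidl.
  by rewrite -!omC iP iQ iR.
- move=> P Q R iP iQ iR; apply: vsval_inj.
  have ? := idem_tens (idem_tens iP iQ) iR; have ? := idem_tens iP (idem_tens iQ iR).
  rewrite val_kcomp // val_kassoc // val_kassocV // val_kid //=.
  rewrite -!ocA [(_ \om _ \om _) \oc _]ocA -asV_nat -!ocA [assoc _ _ _ \oc _]ocA asVK cidl.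
  by rewrite -!omC iP iQ iR.
- move=> P iP; apply: vsval_inj.
  have ? := idem_tens idem_unit iP.
  rewrite val_kcomp // val_klunit // val_klunitV // val_kid //=.
  rewrite -ocA [tagged P \oc (_ \oc _)]ocA iP -lu_nat ocA.
  by rewrite luK cidl.
- move=> P iP; apply: vsval_inj.
  have ? := idem_tens idem_unit iP.
  rewrite val_kcomp // val_klunit // val_klunitV // val_kid //=.
  by rewrite -ocA [lunit _ \oc _]ocA luVK cidl.
- move=> P iP; apply: vsval_inj.
  have ? := idem_tens iP idem_unit.
  rewrite val_kcomp // val_krunit // val_krunitV // val_kid //=.
  rewrite -ocA [tagged P \oc (_ \oc _)]ocA iP -ru_nat ocA.
  by rewrite ruK cidl.
- move=> P iP; apply: vsval_inj.
  have ? := idem_tens iP idem_unit.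
  rewrite val_kcomp // val_krunit // val_krunitV // val_kid //=.
  by rewrite -ocA [runit _ \oc _]ocA ruVK cidl.
- move=> P Q R P' Q' R' f g k iP iQ iR iP' iQ' iR'; apply: vsval_inj.
  have := (idem_tens iP iQ, idem_tens iQ iR, idem_tens iP' iQ', idem_tens iQ' iR').
  move=> [[[? ?] ?] ?].
  have ? := idem_tens (idem_tens iP iQ) iR; have ? := idem_tens iP' (idem_tens iQ' iR').
  rewrite !val_kcomp // !val_kassoc // !val_ktens // ocA -as_nat -!ocA -!omC.
  by rewrite !khom_left // !khom_right.
- move=> P Q f iP iQ; apply: vsval_inj.
  have ? := idem_tens idem_unit iP; have ? := idem_tens idem_unit iQ.
  rewrite !val_kcomp // !val_klunit // val_ktens //; try exact: idem_unit.
  by rewrite (val_kid idem_unit) -ocA lu_nat !ocA khom_left // khom_right.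
- move=> P Q f iP iQ; apply: vsval_inj.
  have ? := idem_tens iP idem_unit; have ? := idem_tens iQ idem_unit.
  rewrite !val_kcomp // !val_krunit // val_ktens //; try exact: idem_unit.
  by rewrite (val_kid idem_unit) -ocA ru_nat !ocA khom_left // khom_right.
- move=> P Q R S iP iQ iR iS; apply: vsval_inj.
  have ? := idem_tens iP iQ; have ? := idem_tens iQ iR; have ? := idem_tens iR iS.
  have ? := idem_tens (idem_tens iP iQ) iR; have ? := idem_tens (idem_tens (idem_tens iP iQ) iR) iS.
  have ? := idem_tens (idem_tens iP (idem_tens iQ iR)) iS.
  have ? := idem_tens iP (idem_tens (idem_tens iQ iR) iS).
  have ? := idem_tens iP (idem_tens iQ (idem_tens iR iS)).
  have ? := idem_tens iP (idem_tens iQ iR).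
  have ? := idem_tens iQ (idem_tens iR iS).
  have ? := idem_tens (idem_tens iQ iR) iS.
  rewrite !val_kcomp // !val_ktens // !val_kassoc // !val_kid //=.
  exact: idem_pentagon.
- move=> P Q iP iQ; apply: vsval_inj.
  have ? := idem_tens (idem_tens iP idem_unit) iQ; have ? := idem_tens iP (idem_tens idem_unit iQ).
  have ? := idem_tens iP iQ; have ? := idem_tens iP idem_unit; have ? := idem_tens idem_unit iQ.
  have iu := idem_unit.
  rewrite !val_kcomp // !val_ktens // val_kassoc // val_klunit // val_krunit // !val_kid //=.
  exact: idem_triangle.
Qed.

End Karoubi.

Section KaroubiAux.
Variables (F : closedFieldType) (K : ribbonData F).
Context {rK : rigid K}.
Variables (X Y Z : K) (x : hom X X) (y : hom Y Y) (z : hom Z Z).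
Hypotheses (xx : x \oc x = x) (yy : y \oc y = y) (zz : z \oc z = z).

(** This and the following lemmas are axioms of the completion read off on underlying morphisms:
    every constraint carries idempotents, which are slid together and absorbed. Naturality of the
    braiding is assumed only at the idempotents concerned, since in the extension it fails in
    general. *)
Lemma idem_hexagon :
  braid X (Y \ox Z) \oc (x \om (y \om z)) = (y \om z \om x) \oc braid X (Y \ox Z) ->
  braid X Y \oc (x \om y) = (y \om x) \oc braid X Y ->
  assoc Y Z X \oc braid X (Y \ox Z) \oc assoc X Y Z =
    (cid Y \om braid X Z) \oc assoc Y X Z \oc (braid X Y \om cid Z) ->
  assoc Y Z X \oc (y \om z \om x) \oc (braid X (Y \ox Z) \oc (x \om (y \om z))) \oc
    (assoc X Y Z \oc (x \om y \om z)) =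
  (y \om (braid X Z \oc (x \om z))) \oc (assoc Y X Z \oc (y \om x \om z)) \oc
    ((braid X Y \oc (x \om y)) \om z).
Proof.
move=> nat1 nat2 hex; mdiag.
mdwr nat1.
mdrw hex.
early x; early1 x; early y; early1 y.
do ?mdrw xx; do ?mdrw1 xx; do ?mdrw yy; do ?mdrw1 yy; do ?mdrw2 zz.
early1 x.
do ?mdrw1 xx; do ?mdrw2 zz.
late_once y.
mdwr nat2.
late (braid X Y); early x; early1 y.
by do ?mdrw xx; do ?mdrw1 yy; do ?mdrw2 zz.
Qed.

Lemma idem_hexagonV :
  braid (X \ox Y) Z \oc (x \om y \om z) = (z \om (x \om y)) \oc braid (X \ox Y) Z ->
  braid Y Z \oc (y \om z) = (z \om y) \oc braid Y Z ->
  assocV Z X Y \oc braid (X \ox Y) Z \oc assocV X Y Z =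
    (braid X Z \om cid Y) \oc assocV X Z Y \oc (cid X \om braid Y Z) ->
  assocV Z X Y \oc (z \om (x \om y)) \oc (braid (X \ox Y) Z \oc (x \om y \om z)) \oc
    (assocV X Y Z \oc (x \om (y \om z))) =
  ((braid X Z \oc (x \om z)) \om y) \oc (assocV X Z Y \oc (x \om (z \om y))) \oc
    (x \om (braid Y Z \oc (y \om z))).
Proof.
move=> nat1 nat2 hex; mdiag.
mdwr nat1.
mdrw hex.
early x; early1 y; early1 z.
do ?mdrw xx; do ?mdrw1 zz; do ?mdrw2 yy; do ?mdrw1 yy; do ?mdrw2 zz.
late_once1 z.
mdwr1 nat2.
early1 y.
by do ?mdrw1 yy; do ?mdrw2 zz.
Qed.

Lemma idem_zigzag :
  (x \oc runit X) \oc (x \om (ev X \oc (transpose x \om x))) \oc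
    (assoc X (dual X) X \oc (x \om transpose x \om x)) \oc
    (((x \om transpose x) \oc coev X) \om x) \oc (lunitV X \oc x) = x.
Proof.
have tt : transpose x \oc transpose x = transpose x by rewrite -transpose_comp xx.
mdiag.
early x; early1 (transpose x).
do ?mdrw xx; do ?mdrw1 tt; do ?mdrw2 xx.
mdrw (coev_transpose x).
do ?mdrw1 tt.
late1 (transpose x).
mdwr1 (ev_transpose x).
do ?mdrw2 xx.
late (coev X).
do ?mdrw xx.
by mdrw (rigid_zigzag X).
Qed.

Lemma idem_zigzag_dual :
  (transpose x \oc lunit (dual X)) \oc ((ev X \oc (transpose x \om x)) \om transpose x) \oc
    (assocV (dual X) X (dual X) \oc (transpose x \om (x \om transpose x))) \oc
    (transpose x \om ((x \om transpose x) \oc coev X)) \oc (runitV (dual X) \oc transpose x) =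
  transpose x.
Proof.
have tt : transpose x \oc transpose x = transpose x by rewrite -transpose_comp xx.
mdiag.
late (ev X).
early (transpose x); early1 x.
do ?mdrw tt; do ?mdrw1 xx; do ?mdrw2 tt.
mdrw1 (coev_transpose x).
do ?mdrw2 tt.
mdwr1 (coev_transpose x).
mdrw (ev_transpose x).
early (transpose x).
do ?mdrw tt.
by mdrw (rigid_zigzag_dual X).
Qed.

Lemma idem_transpose (f : hom X Y) : y \oc f \oc x = f ->
  (transpose x \oc lunit (dual X)) \oc ((ev Y \oc (transpose y \om y)) \om transpose x) \oc
    (assocV (dual Y) Y (dual X) \oc (transpose y \om (y \om transpose x))) \oc
    (transpose y \om (f \om transpose x)) \oc
    (transpose y \om ((x \om transpose x) \oc coev X)) \oc (runitV (dual Y) \oc transpose y) =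
  transpose f.
Proof.
move=> yfx; rewrite [in RHS]/transpose; mdiag.
have fx : f \oc x = f by rewrite -yfx -!ocA xx.
have yf : y \oc f = f by rewrite -yfx !ocA yy.
have tx : transpose x \oc transpose x = transpose x by rewrite -transpose_comp xx.
have ty : transpose y \oc transpose y = transpose y by rewrite -transpose_comp yy.
late (ev Y).
late (transpose y).
do ?mdrw ty.
mdwr (ev_transpose y).
early1 x; early1 f; early1 y.
do ?mdrw1 yy; do ?mdrw1 yf; do ?mdrw2 tx.
mdrw1 fx.
late1 f.
mdwr1 (coev_transpose x).
by mdrw1 fx.
Qed.
End KaroubiAux.

(** * Ribbon structure on a part of the completion *)

Section KaroubiRibbon.
Variables (F : closedFieldType) (K : ribbonData F).
Context {rK : rigid K}.
Local Notation kK := (karoubi K).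
Local Notation idem := (@is_idem F K).
Variable D : set (kobj K).
Implicit Types (P Q R S : kobj K).

Hypotheses (D_idem : forall P, D P -> idem P) (D_unit : D (kunit K))
  (D_tens : forall P Q, D P -> D Q -> D (ktens P Q))
  (D_dual : forall P, D P -> D (kdual P)).
Hypotheses (K_braidK : forall X Y : K, braidV X Y \oc braid X Y = cid (X \ox Y))
  (K_braidVK : forall X Y : K, braid X Y \oc braidV X Y = cid (Y \ox X))
  (K_hexagon : forall X Y Z : K, assoc Y Z X \oc braid X (Y \ox Z) \oc assoc X Y Z =
    (cid Y \om braid X Z) \oc assoc Y X Z \oc (braid X Y \om cid Z))
  (K_hexagonV : forall X Y Z : K, assocV Z X Y \oc braid (X \ox Y) Z \oc assocV X Y Z =
    (braid X Z \om cid Y) \oc assocV X Z Y \oc (cid X \om braid Y Z))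
  (K_twist_iso : forall X : K, is_iso (twist X))
  (K_twist_tens : forall X Y : K,
    twist (X \ox Y) = braid Y X \oc braid X Y \oc (twist X \om twist Y))
  (K_twist_dual : forall X : K, twist (dual X) = transpose (twist X)).
Hypotheses (D_braid_nat : forall P P' Q Q' (s : khom P P') (t : khom Q Q'),
    D P -> D P' -> D Q -> D Q' ->
    braid (tag P') (tag Q') \oc (vsval s \om vsval t) =
    (vsval t \om vsval s) \oc braid (tag P) (tag Q))
  (D_twist_nat : forall P Q (s : khom P Q), D P -> D Q ->
    twist (tag Q) \oc vsval s = vsval s \oc twist (tag P)).

Let iT P Q (iP : idem P) (iQ : idem Q) : idem (ktens P Q) := idem_tens iP iQ.

Lemma idem_dual P : idem P -> idem (kdual P).
Proof. by rewrite /is_idem /= => iP; rewrite -transpose_comp iP. Qed.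

Lemma karoubi_braid_idem P Q : D P -> D Q ->
  braid (tag P) (tag Q) \oc (tagged P \om tagged Q) =
  (tagged Q \om tagged P) \oc braid (tag P) (tag Q).
Proof.
move=> dP dQ; have := D_braid_nat (cid (r := kK) P) (cid (r := kK) Q) dP dP dQ dQ.
by rewrite !val_kid //; apply: D_idem.
Qed.

Lemma karoubi_twist_idem P : D P -> twist (tag P) \oc tagged P = tagged P \oc twist (tag P).
Proof.
move=> dP; have := D_twist_nat (cid (r := kK) P) dP dP.
by rewrite !val_kid //; apply: D_idem.
Qed.

Lemma val_kbraid P Q : D P -> D Q ->
  vsval (braid (r := kK) P Q) = braid (tag P) (tag Q) \oc (tagged P \om tagged Q).
Proof.
move=> dP dQ; have [iP iQ] := (D_idem dP, D_idem dQ).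
have e := karoubi_braid_idem dP dQ.
by apply: kmor_bi => /=; rewrite ?ocA -?e -?ocA -!omC ?iP ?iQ.
Qed.

Lemma val_kbraidV P Q : D P -> D Q ->
  vsval (braidV (r := kK) P Q) = braidV (tag P) (tag Q) \oc (tagged Q \om tagged P).
Proof.
move=> dP dQ; have [iP iQ] := (D_idem dP, D_idem dQ).
have e : braidV (tag P) (tag Q) \oc (tagged Q \om tagged P) =
    (tagged P \om tagged Q) \oc braidV (tag P) (tag Q).
  apply: (cancel_r (K_braidVK (tag P) (tag Q))).
  by rewrite -!ocA -karoubi_braid_idem // !ocA K_braidK cidl -ocA K_braidK cidr.
by apply: kmor_bi => /=; rewrite ?ocA -?e -?ocA -!omC ?iP ?iQ.
Qed.

Lemma val_kcoev P : idem P ->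
  vsval (coev (r := kK) P) = (tagged P \om transpose (tagged P)) \oc coev (tag P).
Proof.
move=> iP; apply: kmor_bi => /=; last exact: cidr.
by rewrite ocA -omC -transpose_comp iP.
Qed.

Lemma val_kev P : idem P ->
  vsval (ev (r := kK) P) = ev (tag P) \oc (transpose (tagged P) \om tagged P).
Proof.
move=> iP; apply: kmor_bi => /=; first exact: cidl.
by rewrite -ocA -omC -transpose_comp iP.
Qed.

Lemma val_ktwist P : D P -> vsval (twist (r := kK) P) = twist (tag P) \oc tagged P.
Proof.
move=> dP; have iP := D_idem dP.
apply: kmor_bi; last by rewrite -ocA iP.
by rewrite !karoubi_twist_idem // ocA iP.
Qed.

Lemma val_ktranspose P Q (s : khom P Q) : idem P -> idem Q ->
  vsval (transpose (C := kK) s) = transpose (vsval s).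
Proof.
move=> iP iQ.
have iu : idem (kunit K) by apply: idem_unit.
have := (idem_dual iP, idem_dual iQ) => -[dP dQ].
have := (iT iQ dP, iT iP dP, iT dQ iQ, iT iu dP, iT dQ iu).
move=> [[[[? ?] ?] ?] ?].
have := (iT (iT dQ iQ) dP, iT dQ (iT iQ dP),
  iT dQ (iT iP dP)) => -[[? ?] ?].
rewrite /transpose !val_kcomp // !val_ktens // !val_kid // val_kassocV //.
rewrite val_klunit // val_krunitV // val_kev // val_kcoev //.
exact: (idem_transpose iP iQ (khomP s)).
Qed.

Lemma karoubi_braided : braided_category (C := kK) D.
Proof.
split.
- move=> P Q dP dQ; apply: vsval_inj.
  have [iP iQ] := (D_idem dP, D_idem dQ); have ? := iT iP iQ; have ? := iT iQ iP.
  rewrite val_kcomp // val_kbraid // val_kbraidV // val_kid // karoubi_braid_idem //.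
  rewrite ocA -[_ \oc (_ \om _) \oc (_ \om _)]ocA -omC iP iQ -ocA -karoubi_braid_idem //.
  by rewrite ocA K_braidK cidl.
- move=> P Q dP dQ; apply: vsval_inj.
  have [iP iQ] := (D_idem dP, D_idem dQ); have ? := iT iP iQ; have ? := iT iQ iP.
  rewrite val_kcomp // val_kbraid // val_kbraidV // val_kid // karoubi_braid_idem //.
  by rewrite -ocA [braid _ _ \oc _]ocA K_braidVK cidl -omC iP iQ.
- move=> P Q P' Q' f g dP dQ dP' dQ'; apply: vsval_inj.
  have [iP iQ] := (D_idem dP, D_idem dQ); have [iP' iQ'] := (D_idem dP', D_idem dQ').
  have ? := iT iP iQ; have ? := iT iQ iP.
  have ? := iT iP' iQ'; have ? := iT iQ' iP'.
  rewrite !val_kcomp // !val_kbraid // !val_ktens // -ocA -omC !khom_left //.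
  rewrite [in RHS]karoubi_braid_idem // ocA -omC !khom_right //.
  exact: D_braid_nat.
- move=> P Q R dP dQ dR; apply: vsval_inj.
  have [[iP iQ] iR] := (D_idem dP, D_idem dQ, D_idem dR).
  have := (iT iP iQ, iT iQ iP, iT iQ iR, iT iP iR,
    iT iR iP) => -[[[[? ?] ?] ?] ?].
  have := (iT (iT iP iQ) iR, iT (iT iQ iP) iR,
    iT (iT iQ iR) iP, iT iQ (iT iR iP),
    iT iQ (iT iP iR), iT iP (iT iQ iR)) => -[[[[[? ?] ?] ?] ?] ?].
  have dQR := D_tens dQ dR.
  rewrite !val_kcomp // !val_kassoc // !val_ktens // !val_kbraid // !val_kid //=.
  by apply: (idem_hexagon iP iQ iR); [apply: (karoubi_braid_idem dP dQR) | apply: karoubi_braid_idem |].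
- move=> P Q R dP dQ dR; apply: vsval_inj.
  have [[iP iQ] iR] := (D_idem dP, D_idem dQ, D_idem dR).
  have := (iT iP iQ, iT iR iP, iT iQ iR, iT iP iR,
    iT iR iQ) => -[[[[? ?] ?] ?] ?].
  have := (iT iP (iT iQ iR), iT (iT iP iQ) iR,
    iT iR (iT iP iQ), iT (iT iR iP) iQ,
    iT (iT iP iR) iQ, iT iP (iT iR iQ)) => -[[[[[? ?] ?] ?] ?] ?].
  have dPQ := D_tens dP dQ.
  rewrite !val_kcomp // !val_kassocV // !val_ktens // !val_kbraid // !val_kid //=.
  by apply: (idem_hexagonV iP iQ iR); [apply: (karoubi_braid_idem dPQ dR) | apply: karoubi_braid_idem |].
Qed.

Lemma karoubi_ribbon : rigid_ribbon_category (C := kK) D.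
Proof.
have iu : idem (kunit K) by apply: idem_unit.
split.
- exact: D_dual.
- move=> P dP; apply: vsval_inj.
  have iP := D_idem dP; have dI := idem_dual iP.
  have := (iT iP dI, iT dI iP, iT iP iu, iT iu iP) => -[[[? ?] ?] ?].
  have := (iT (iT iP dI) iP, iT iP (iT dI iP)) => -[? ?].
  rewrite !val_kcomp // val_krunit // val_klunitV // val_kassoc // !val_ktens // !val_kid //.
  rewrite val_kev // val_kcoev //; exact: idem_zigzag.
- move=> P dP; apply: vsval_inj.
  have iP := D_idem dP; have dI := idem_dual iP.
  have := (iT iP dI, iT dI iP, iT dI iu, iT iu dI) => -[[[? ?] ?] ?].
  have := (iT (iT dI iP) dI, iT dI (iT iP dI)) => -[? ?].
  rewrite !val_kcomp // val_klunit // val_krunitV // val_kassocV // !val_ktens // !val_kid //.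
  rewrite val_kev // val_kcoev //; exact: idem_zigzag_dual.
- move=> P dP; have iP := D_idem dP; have [g [gt tg]] := K_twist_iso (tag P).
  have nat := karoubi_twist_idem dP.
  have gnat : g \oc tagged P = tagged P \oc g.
    by apply: (cancel_l gt); rewrite !ocA tg cidl nat -ocA tg cidr.
  exists (kmor (P := P) (Q := P) (g \oc tagged P)).
  have vg : vsval (kmor (P := P) (Q := P) (g \oc tagged P)) = g \oc tagged P.
    by apply: kmor_bi; [rewrite gnat ocA iP | rewrite -ocA iP].
  split; apply: vsval_inj; rewrite val_kcomp // vg val_ktwist // val_kid //.
    by rewrite nat ocA -[_ \oc _ \oc tagged P]ocA iP -ocA -nat ocA gt cidl.
  by rewrite gnat ocA -[_ \oc _ \oc tagged P]ocA iP -ocA -gnat ocA tg cidl.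
- move=> P Q s dP dQ; apply: vsval_inj; have [iP iQ] := (D_idem dP, D_idem dQ).
  rewrite !val_kcomp // !val_ktwist // -ocA khom_left //.
  by rewrite D_twist_nat // -[in LHS](khom_right s iP) -ocA -karoubi_twist_idem.
- move=> P Q dP dQ; apply: vsval_inj; have [iP iQ] := (D_idem dP, D_idem dQ).
  have ? := iT iP iQ; have ? := iT iQ iP.
  rewrite val_ktwist; last exact: D_tens.
  rewrite !val_kcomp // val_ktens // !val_kbraid // !val_ktwist // K_twist_tens.
  have ee : (tagged P \om tagged Q) \oc (tagged P \om tagged Q) = tagged P \om tagged Q.
    by rewrite -omC iP iQ.
  have te : (tagged P \om tagged Q) \oc (twist (tag P) \om twist (tag Q)) =
      (twist (tag P) \om twist (tag Q)) \oc (tagged P \om tagged Q).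
    by rewrite -!omC !karoubi_twist_idem.
  rewrite [(_ \oc tagged P) \om _]omC !ocA.
  rewrite -[_ \oc (tagged Q \om _) \oc _]ocA -karoubi_braid_idem //= !ocA.
  rewrite -[_ \oc (tagged P \om _) \oc (tagged P \om _)]ocA ee.
  rewrite -[_ \oc (tagged P \om _) \oc (twist _ \om _)]ocA te !ocA.
  by rewrite -[_ \oc (tagged P \om _) \oc (tagged P \om _)]ocA ee.
- move=> P dP; apply: vsval_inj; have iP := D_idem dP.
  rewrite val_ktwist; last exact: D_dual.
  rewrite val_ktranspose // val_ktwist // transpose_comp -K_twist_dual /=.
  exact: (karoubi_twist_idem (D_dual dP)).
Qed.

End KaroubiRibbon.

Class ribbon (F : closedFieldType) (K : ribbonData F) : Prop := Ribbon {
  ribbon_is_braided :: braided K;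
  ribbon_ribbon : rigid_ribbon_category [set: K]%classic;
  ribbon_unit : simple (tunit K)
}.

#[global] Instance ribbon_rigid (F : closedFieldType) (K : ribbonData F) :
  ribbon K -> rigid K.
Proof.
move=> rK; have rr := @ribbon_ribbon F K rK.
by apply: Rigid => X; [apply: (zigzag rr) | apply: (zigzag_dual rr)].
Qed.

(** * Traces, fusion rules and the S-matrix *)

Section Trace.
Variables (F : closedFieldType) (K : ribbonData F).
Context {rK : ribbon K}.
Implicit Types (X Y Z : K).
Let rr := @ribbon_ribbon F K rK.

Lemma tw_nat X Y (f : hom X Y) : twist Y \oc f = f \oc twist X.
Proof. exact: (twist_nat rr). Qed.
Lemma tw_tens X Y : twist (X \ox Y) = braid Y X \oc braid X Y \oc (twist X \om twist Y).
Proof. exact: (twist_tens rr). Qed.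

(** The twist of [1 \ox 1] shows that the twist of the unit is idempotent; being invertible, it is
    the identity. *)
Lemma tw_unit : twist (tunit K) = cid (tunit K).
Proof.
have [g [gt _]] := twist_iso rr (X := tunit K) I.
have tt : twist (tunit K) \oc twist (tunit K) = twist (tunit K).
  apply: (cancel_r (luVK (tunit K))); rewrite tw_nat tw_tens; diag.
  by [].
by rewrite -gt -[in RHS]tt ocA gt cidl.
Qed.

Lemma epsbar_transpose X Y (f : hom X Y) :
  epsbar Y \oc (f \om cid (dual Y)) = epsbar X \oc (cid X \om transpose f).
Proof.
rewrite /epsbar; diag.
drw (tw_nat f).
drw (br_nat f (cid (dual Y))).
drw (ev_transpose f).
early (twist X).
by drw (br_nat (cid X) (transpose f)).
Qed.

Lemma scalE (f : hom (tunit K) (tunit K)) : f = scal f *: cid (tunit K).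
Proof.
have [endo nz] := @ribbon_unit F K rK.
have fr : free [tuple cid (tunit K)] by rewrite /= free_cons span_nil memv0 nil_free andbT; apply/eqP.
have [b ->] := endo f; congr (_ *: _).
rewrite /scal linearZ /= -[cid _ in RHS]/([tuple cid (tunit K)]`_(ord0 : 'I_1)).
by rewrite coord_free // eqxx mulr1.
Qed.

Lemma unit_nz : cid (tunit K) != 0.
Proof. by have [_ /eqP] := @ribbon_unit F K rK. Qed.

Lemma scal_uniq f b : f = b *: cid (tunit K) -> scal f = b.
Proof.
move=> e; apply/eqP; rewrite -subr_eq0; move: unit_nz; apply: contraR => nz.
by rewrite -(scalerK nz (cid _)) scalerBl -scalE -e subrr scaler0.
Qed.

Lemma traceE X (s : hom X X) :
  epsbar X \oc (s \om cid (dual X)) \oc coev X = trace s *: cid (tunit K).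
Proof. exact: scalE. Qed.

Lemma trace_lin X b (s t : hom X X) : trace (b *: s + t) = b * trace s + trace t.
Proof.
apply: scal_uniq; rewrite omDl omZl ocDr ocZr ocDl ocZl !traceE.
by rewrite scalerDl scalerA.
Qed.

Lemma trace0 X : trace (0 : hom X X) = 0.
Proof.
have := trace_lin 1 (0 : hom X X) 0.
by rewrite scaler0 addr0 mul1r => /(congr1 (fun b => b - trace (0 : hom X X))); rewrite subrr addrK.
Qed.

Lemma traceZ X b (s : hom X X) : trace (b *: s) = b * trace s.
Proof. by rewrite -[_ *: _]addr0 trace_lin trace0 addr0. Qed.

Lemma traceD X (s t : hom X X) : trace (s + t) = trace s + trace t.
Proof. by rewrite -[s in LHS]scale1r trace_lin mul1r. Qed.

Lemma trace_sum X (I : Type) (r : seq I) (P : pred I) (s : I -> hom X X) :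
  trace (\sum_(i <- r | P i) s i) = \sum_(i <- r | P i) trace (s i).
Proof. by apply: (big_morph (@trace F K X)) => [s1 s2|]; rewrite ?traceD ?trace0. Qed.

Lemma traceC X Y (f : hom X Y) (g : hom Y X) : trace (g \oc f) = trace (f \oc g).
Proof.
congr scal; diag.
drw (epsbar_transpose g).
drw (coev_transpose f).
drw (coev_transpose g).
early f.
by drw (coev_transpose f).
Qed.

Section OtherDual.
Variables (Y Y' : K) (b : hom (tunit K) (Y \ox Y')) (d : hom (Y' \ox Y) (tunit K)).
Hypothesis bd : runit Y \oc (cid Y \om d) \oc assoc Y Y' Y \oc (b \om cid Y) \oc lunitV Y = cid Y.
Let v : hom Y' (dual Y) := lunit (dual Y) \oc (d \om cid (dual Y)) \oc assocV Y' Y (dual Y) \oc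
   (cid Y' \om coev Y) \oc runitV Y'.
Let e : hom (Y \ox Y') (tunit K) := d \oc braid Y Y' \oc (twist Y \om cid Y').

(** The morphism [v] compares another dual [Y'] of [Y] with the chosen one, so traces may be
    computed with either. This is applied to products, to [X] as a dual of [dual X], and to the
    self-dual object [A]. *)
Lemma other_coev : (cid Y \om v) \oc b = coev Y.
Proof.
rewrite /v; diag.
late b.
by drw bd.
Qed.

Lemma other_ev : epsbar Y \oc (cid Y \om v) = e.
Proof.
rewrite /e /epsbar.
have dv : ev Y \oc (v \om cid Y) = d.
  rewrite /v; diag.
  late d.
  by drw1 (rigid_zigzag Y).
diag.
early (twist Y).
drw (br_nat (cid Y) v).
by drw dv.
Qed.

Lemma other_trace (s : hom Y Y) : e \oc (s \om cid Y') \oc b = trace s *: cid (tunit K).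
Proof.
rewrite -traceE -other_coev -other_ev; diag.
by early s.
Qed.

Lemma other_ptr X X' (s : hom (X \ox Y) (X' \ox Y)) :
  (cid X' \om epsbar Y) \oc assoc X' Y (dual Y) \oc (s \om cid (dual Y)) \oc
    assocV X Y (dual Y) \oc (cid X \om coev Y) =
  (cid X' \om e) \oc assoc X' Y Y' \oc (s \om cid Y') \oc
    assocV X Y Y' \oc (cid X \om b).
Proof.
rewrite -other_coev -other_ev; diag.
by early s.
Qed.

End OtherDual.

Definition ptr X X' Y (s : hom (X \ox Y) (X' \ox Y)) : hom X X' :=
  runit X' \oc ((cid X' \om epsbar Y) \oc assoc X' Y (dual Y) \oc (s \om cid (dual Y)) \oc
    assocV X Y (dual Y) \oc (cid X \om coev Y)) \oc runitV X.

Section TensorDual.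
Variables X Y : K.
Let b : hom (tunit K) (X \ox Y \ox (dual Y \ox dual X)) :=
  assocV X Y (dual Y \ox dual X) \oc
  (cid X \om (assoc Y (dual Y) (dual X) \oc (coev Y \om cid (dual X)) \oc lunitV (dual X))) \oc
  coev X.
Let d : hom (dual Y \ox dual X \ox (X \ox Y)) (tunit K) :=
  ev Y \oc (cid (dual Y) \om (lunit Y \oc (ev X \om cid Y) \oc assocV (dual X) X Y)) \oc
  assoc (dual Y) (dual X) (X \ox Y).

Lemma tens_zigzag :
  runit (X \ox Y) \oc (cid (X \ox Y) \om d) \oc assoc (X \ox Y) (dual Y \ox dual X) (X \ox Y) \oc
  (b \om cid (X \ox Y)) \oc lunitV (X \ox Y) = cid (X \ox Y).
Proof.
rewrite /b /d; diag.
late1 (coev Y).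
drw1 (rigid_zigzag Y).
by drw (rigid_zigzag X).
Qed.

(** The double braiding contained in the twist of [X \ox Y] unlinks the two strands and leaves two
    nested evaluations. Hence traces over a product can be taken one factor at a time, in
    [trace_ptr] and [ptr_tens]. *)
Lemma tens_ev :
  d \oc braid (X \ox Y) (dual Y \ox dual X) \oc (twist (X \ox Y) \om cid (dual Y \ox dual X)) =
  epsbar X \oc (cid X \om (lunit (dual X) \oc (epsbar Y \om cid (dual X)) \oc assocV Y (dual Y) (dual X)))
    \oc assoc X Y (dual Y \ox dual X).
Proof.
rewrite /d tw_tens /epsbar; diag.
early (twist X).
early (braid X (dual Y)).
drw (br_nat (braid Y X) (cid (dual Y))).
drw (br_nat (braid X Y) (cid (dual Y))).
dwr1 (br_nat (cid Y) (ev X \oc braid X (dual X))).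
early (ev Y).
by dwr (br_nat (cid X) (ev Y)).
Qed.

Lemma trace_ptr (s : hom (X \ox Y) (X \ox Y)) : trace s = trace (ptr s).
Proof.
apply: scal_uniq; rewrite traceE -(other_trace tens_zigzag) tens_ev.
rewrite -traceE /ptr /b; by diag.
Qed.

Lemma ptr_tens W W' (s : hom (W \ox (X \ox Y)) (W' \ox (X \ox Y))) :
  ptr s = ptr (ptr (assocV W' X Y \oc s \oc assoc W X Y)).
Proof.
rewrite {1}/ptr (other_ptr tens_zigzag) tens_ev /b /ptr; by diag.
Qed.
End TensorDual.

Lemma ptr_comp X X' X'' Y (s : hom (X \ox Y) (X' \ox Y)) (f : hom X' X'') :
  ptr ((f \om cid Y) \oc s) = f \oc ptr s.
Proof. by rewrite /ptr; diag; early f. Qed.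

Lemma ptr_compr X X' X'' Y (s : hom (X \ox Y) (X' \ox Y)) (f : hom X'' X) :
  ptr (s \oc (f \om cid Y)) = ptr s \oc f.
Proof. by rewrite /ptr; diag; early f. Qed.

(** A strand [X] encircled by a closed loop coloured [Y] that carries [u]. *)
Definition encu Y (u : hom Y Y) X : hom X X :=
  ptr (braid Y X \oc braid X Y \oc (cid X \om u)).

Lemma encu_nat Y (u : hom Y Y) X X' (f : hom X X') :
  encu u X' \oc f = f \oc encu u X.
Proof.
rewrite /encu -ptr_comp -ptr_compr; congr ptr.
diag.
dwr (br_nat (cid Y) f).
dwr (br_nat f (cid Y)).
by early f.
Qed.

(** A loop coloured by a product is two parallel loops. One of them is an endomorphism of [X], and
    slides along the strand out of the other by naturality of the braiding. *)
Lemma encu_tens Y Z (v : hom Y Y) (u : hom Z Z) X :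
  encu (v \om u) X = encu u X \oc encu v X.
Proof.
have encuE : encu u X = ptr (braid Z X \oc braid X Z \oc (cid X \om u)) by [].
rewrite {1}/encu ptr_tens {2}/encu; move: encuE; rewrite /ptr; move: (encu u X) => E encuE.
diag.
early1 v; early (braid X Y); late (braid Y X).
dwr1 encuE.
drw (br_nat (cid Y) E).
by early E.
Qed.

Lemma trace_encu Y (u : hom Y Y) X (f : hom X X) :
  trace (encu u X \oc f) = trace (braid Y X \oc braid X Y \oc (f \om u)).
Proof.
rewrite trace_ptr /encu -ptr_compr; congr (trace (ptr _)).
by rewrite -!ocA -omC cidl cidr.
Qed.

(* The entries of the S-matrix are the [mon (cid X) (cid Y)]. *)
Definition mon X Y (f : hom X X) (u : hom Y Y) : F :=
  trace (braid Y X \oc braid X Y \oc (f \om u)).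

Lemma monC X Y (f : hom X X) (u : hom Y Y) : mon f u = mon u f.
Proof. by rewrite /mon -ocA br_nat ocA traceC ocA. Qed.

Lemma encu_simple Y (u : hom Y Y) X : simple X -> dim X != 0 ->
  encu u X = (mon (cid X) u / dim X) *: cid X.
Proof.
move=> [endo _] dX; have [b e] := endo (encu u X).
by rewrite /mon -trace_encu cidr e traceZ mulfK.
Qed.

(** A loop acts on a simple [X] by the scalar [mon (cid X) f / dim X], and parallel loops act by the
    product: the normalised rows of the S-matrix are characters of the fusion ring. *)
Lemma mon_tens X Y Z (f : hom Y Y) (g : hom Z Z) : simple X -> dim X != 0 ->
  mon (cid X) (f \om g) = mon (cid X) f * mon (cid X) g / dim X.
Proof.
move=> sX dX; rewrite {1}/mon -trace_encu cidr encu_tens !encu_simple //.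
by rewrite ocZl ocZr cidl !traceZ /dim -/(dim X) -mulrA divfK // mulrC mulrA.
Qed.

Lemma mon_lin X Y b (f g : hom X X) (u : hom Y Y) :
  mon (b *: f + g) u = b * mon f u + mon g u.
Proof. by rewrite /mon omDl omZl ocDr ocZr trace_lin. Qed.

Lemma mon_cyc X X' Y (f : hom X X') (g : hom X' X) (u : hom Y Y) :
  mon (g \oc f) u = mon (f \oc g) u.
Proof. by rewrite /mon -!trace_encu ocA traceC ocA -encu_nat -ocA. Qed.

Lemma mon_unit X (f : hom X X) : mon f (cid (tunit K)) = trace f.
Proof.
rewrite /mon -trace_encu; congr trace; rewrite -[RHS]cidl; congr (_ \oc _).
rewrite /encu /ptr /epsbar; diag.
drw1 tw_unit.
by drw1 (rigid_zigzag (tunit K)).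
Qed.

Lemma dim_unit : dim (tunit K) = 1.
Proof.
apply: scal_uniq; rewrite scale1r /epsbar; diag.
drw tw_unit.
by drw (rigid_zigzag (tunit K)).
Qed.

(** The object [X], with [b] and [epsbar X], is a dual of [dual X], so [other_trace] applies. The
    inverse twist in [b] cancels the twist in [epsbar X], and the twist of [dual X], being a
    transpose, puts it back. *)
Lemma dim_dual X : dim (dual X) = dim X.
Proof.
have [t [tK Kt]] := twist_iso rr (X := X) I.
(* The inverse twist [t] compensates the twist inside [epsbar X]; without it the zigzag [bd] would
   fail. *)
pose b := (cid (dual X) \om t) \oc braidV (dual X) X \oc coev X.
have bd : runit (dual X) \oc (cid (dual X) \om epsbar X) \oc assoc (dual X) X (dual X) \oc
    (b \om cid (dual X)) \oc lunitV (dual X) = cid (dual X).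
  rewrite /b /epsbar; diag.
  have swap : (cid (dual X) \om braid X (dual X)) \oc assoc (dual X) X (dual X) \oc
      (braidV (dual X) X \om cid (dual X)) \oc (coev X \om cid (dual X)) \oc lunitV (dual X) =
      assoc (dual X) (dual X) X \oc (braidV (dual X) (dual X) \om cid X) \oc
      assocV (dual X) (dual X) X \oc (cid (dual X) \om braidV (dual X) X) \oc
      (cid (dual X) \om coev X) \oc runitV (dual X).
    diag.
    dwr (br_nat (coev X) (cid (dual X))).
    dwr (br_nat (braidV (dual X) X) (cid (dual X))).
    by drw (brK (dual X) (dual X)).
  drw1 Kt.
  drw swap.
  dwr (brV_nat (cid (dual X)) (ev X)).
  by drw (rigid_zigzag_dual X).
have dE : epsbar X \oc coev X = dim X *: cid (tunit K).
  by rewrite -[epsbar X]cidr -om1 traceE.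
apply: scal_uniq; rewrite traceE -(other_trace bd) -dE /b /epsbar.
have td := twist_dual rr (X := X) I.
diag.
drw (br_nat (twist (dual X)) t).
drw (brVK (dual X) X).
drw Kt.
rewrite td.
by dwr (coev_transpose (twist X)).
Qed.

End Trace.

(** * Dimensions of morphism spaces *)

Section LinearDim.
Variables (F : fieldType) (U V : vectType F).

Lemma dim_inj (f : U -> V) : linear f -> injective f -> (\dim {:U} <= \dim {:V})%N.
Proof.
move=> lf fI.
pose g : {linear U -> V} := HB.pack_for {linear U -> V} f (GRing.isLinear.Build _ _ _ _ f lf).
have kg : lker (linfun g) == 0%VS.
  by apply/lker0P => x y; rewrite !lfunE; apply: fI.
by rewrite -(limg_dim_eq (f := linfun g) (U := fullv)) ?dimvS ?subvf // (eqP kg) capv0.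
Qed.
End LinearDim.

Lemma dim_bij (F : fieldType) (U V : vectType F) (f : U -> V) (g : V -> U) :
  linear f -> linear g -> cancel f g -> cancel g f -> \dim {:U} = \dim {:V}.
Proof.
move=> lf lg fK gK; apply/eqP; rewrite eqn_leq.
by rewrite (dim_inj lf (can_inj fK)) (dim_inj lg (can_inj gK)).
Qed.

Lemma dim_split (F : fieldType) (V : vectType F) n (U : 'I_n -> vectType F)
    (f : forall k, U k -> V) (g : forall k, V -> U k) :
  (forall k, linear (f k)) -> (forall k, linear (g k)) ->
  (forall k, cancel (f k) (g k)) -> (forall k l, k != l -> forall u, g k (f l u) = 0) ->
  (forall v, \sum_k f k (g k v) = v) -> \dim {:V} = (\sum_k \dim {:U k})%N.
Proof.
move=> lf lg fK gf fg.
pose h k : {linear U k -> V} := HB.pack_for {linear U k -> V} (f k)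
  (GRing.isLinear.Build _ _ _ _ (f k) (lf k)).
pose g' k : {linear V -> U k} := HB.pack_for {linear V -> U k} (g k)
  (GRing.isLinear.Build _ _ _ _ (g k) (lg k)).
have dimh k : \dim (limg (linfun (h k))) = \dim {:U k}.
  apply: limg_dim_eq; suff /eqP -> : lker (linfun (h k)) == 0%VS by rewrite capv0.
  by apply/lker0P => x y; rewrite !lfunE; apply: (can_inj (fK k)).
have dir : directv (\sum_k limg (linfun (h k))).
  apply/directv_sum_independent => us Hus sum0 k _.
  have /memv_imgP [u _ eu] := Hus k isT.
  have := congr1 (g' k) sum0; rewrite linear_sum linear0 (bigD1 k) //= big1 ?addr0.
    by rewrite eu lfunE /= fK => ->; exact: (linear0 (h k)).
  move=> l nlk; have /memv_imgP [w _ ->] := Hus l isT.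
  by rewrite lfunE /= gf // eq_sym.
have -> : (fullv : {vspace V}) = (\sum_k limg (linfun (h k)))%VS.
  apply/eqP; rewrite eqEsubv subvf andbT; apply/subvP => v _.
  rewrite -(fg v); apply: memv_sumr => k _.
  by apply/memv_imgP; exists (g k v); rewrite ?memvf // lfunE.
by rewrite (directvP dir) /=; apply: eq_bigr.
Qed.

Section HomDim.
Variables (F : closedFieldType) (K : ribbonData F).
Implicit Types (X Y Z W : K).

Definition homdim X Y := \dim {: hom X Y}.

Context {mK : monoidal K}.

Lemma homdim_dsumr W Z n (Y : 'I_n -> K) :
  direct_sum Z Y -> homdim W Z = (\sum_k homdim W (Y k))%N.
Proof.
move=> [i [p [pi pi0 ip]]].
apply: (dim_split (f := fun k s => i k \oc s) (g := fun k s => p k \oc s)).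
- by move=> k b s t; rewrite ocDr ocZr.
- by move=> k b s t; rewrite ocDr ocZr.
- by move=> k s; rewrite ocA pi cidl.
- by move=> k l kl s; rewrite ocA pi0 // oc0l.
- move=> s; rewrite -[RHS]cidl -ip oc_suml.
  by apply: eq_bigr => k _; rewrite ocA.
Qed.

Lemma homdim_dsuml W Z n (Y : 'I_n -> K) :
  direct_sum Z Y -> homdim Z W = (\sum_k homdim (Y k) W)%N.
Proof.
move=> [i [p [pi pi0 ip]]].
apply: (dim_split (f := fun k s => s \oc p k) (g := fun k s => s \oc i k)).
- by move=> k b s t; rewrite ocDl ocZl.
- by move=> k b s t; rewrite ocDl ocZl.
- by move=> k s; rewrite -ocA pi cidr.
- by move=> k l kl s; rewrite -ocA pi0 1?eq_sym // oc0r.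
- move=> s; rewrite -[RHS]cidr -ip oc_sumr.
  by apply: eq_bigr => k _; rewrite ocA.
Qed.

Lemma iso_sym X Y : iso X Y -> iso Y X.
Proof. by move=> [f [g [gf fg]]]; exists g, f. Qed.

Lemma iso_refl X : iso X X.
Proof. by exists (cid X), (cid X); rewrite cidl. Qed.

Lemma iso_trans X Y Z : iso X Y -> iso Y Z -> iso X Z.
Proof.
move=> [f [g [gf fg]]] [f' [g' [gf' fg']]]; exists (f' \oc f), (g \oc g').
split; first by rewrite -ocA [g' \oc _]ocA gf' cidl.
by rewrite -ocA [f \oc _]ocA fg cidl.
Qed.

Lemma iso_direct_sum X Y : iso X Y -> direct_sum X (fun _ : 'I_1 => Y).
Proof.
move=> [f [g [gf fg]]]; exists (fun=> g), (fun=> f); split=> // [k l|].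
  by rewrite !ord1 eqxx.
by rewrite big_ord1.
Qed.

Lemma iso_homdimr W X Y : iso X Y -> homdim W X = homdim W Y.
Proof. by move=> /iso_direct_sum /homdim_dsumr ->; rewrite big_ord1. Qed.
Lemma iso_homdiml W X Y : iso X Y -> homdim X W = homdim Y W.
Proof. by move=> /iso_direct_sum /homdim_dsuml ->; rewrite big_ord1. Qed.

Lemma homdim_simple X : simple X -> homdim X X = 1%N.
Proof.
move=> [endo nz]; rewrite /homdim.
have -> : (fullv : {vspace hom X X}) = <[cid X]>%VS.
  apply/eqP; rewrite eqEsubv subvf andbT; apply/subvP => f _.
  by have [b ->] := endo f; rewrite memvZ // memv_line.
by rewrite dim_vline; case: eqP.
Qed.

Lemma homdim0 X Y : (forall f : hom X Y, f = 0) -> homdim X Y = 0%N.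
Proof.
move=> z; apply/eqP; rewrite dimv_eq0 -subv0; apply/subvP => f _.
by rewrite (z f) mem0v.
Qed.

End HomDim.

Section Adjunction.
Variables (F : closedFieldType) (K : ribbonData F).
Context {rK : rigid K}.
Implicit Types (X Y Z W : K).

Lemma homdim_adjl X Y Z : homdim (dual X \ox Y) Z = homdim Y (X \ox Z).
Proof.
apply: (dim_bij
  (f := fun s => (cid X \om s) \oc assoc X (dual X) Y \oc (coev X \om cid Y) \oc lunitV Y)
  (g := fun t => lunit Z \oc (ev X \om cid Z) \oc assocV (dual X) X Z \oc (cid (dual X) \om t))).
- by move=> b s t; rewrite omDr omZr !(ocDl, ocZl).
- by move=> b s t; rewrite omDr omZr !(ocDr, ocZr).
- move=> s; mdiag.
  early (ev X).
  by mdrw (rigid_zigzag_dual X).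
- move=> t; mdiag.
  late (coev X).
  by mdrw (rigid_zigzag X).
Qed.

Lemma homdim_adjr X Y Z : homdim (Y \ox X) Z = homdim Y (Z \ox dual X).
Proof.
apply: (dim_bij
  (f := fun s => (s \om cid (dual X)) \oc assocV Y X (dual X) \oc (cid Y \om coev X) \oc runitV Y)
  (g := fun t => runit Z \oc (cid Z \om ev X) \oc assoc Z (dual X) X \oc (t \om cid X))).
- by move=> b s t; rewrite omDl omZl !(ocDl, ocZl).
- by move=> b s t; rewrite omDl omZl !(ocDr, ocZr).
- move=> s; mdiag.
  late s.
  by mdrw1 (rigid_zigzag X).
- move=> t; mdiag.
  early t.
  by mdrw1 (rigid_zigzag_dual X).
Qed.
End Adjunction.

Lemma intr_inj0 (F : closedFieldType) : [pchar F] =i pred0 ->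
  forall k : int, (k%:~R == 0 :> F) = (k == 0).
Proof.
move=> /pcharf0P F0 [k|k]; first by rewrite -[k%:~R]/(k%:R) F0.
by rewrite NegzE mulrNz !oppr_eq0 -[(k.+1)%:~R]/(k.+1%:R) F0.
Qed.

(** Over the rationals, a row vector [u] killed by the matrix makes the squares of all entries of
    all [u *m N i] sum to zero; in particular [u *m N o = u] vanishes. Integer entries let this
    argument by order serve in [F], through the determinant. *)
Lemma posdef_det (n : nat) (I : finType) (N : I -> 'M[int]_n) (o : I) :
  N o = 1%:M -> \det (\sum_i N i *m (N i)^T) != 0.
Proof.
move=> No; set M := \sum_i _.
apply/negP => /eqP detM.
pose q m := map_mx (intr : int -> rat) (m : 'M_n).
have detq : \det (q M) = 0 by rewrite /q det_map_mx detM.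
have /eqP/det0P [u u0 uM] := detq.
have qM : q M = \sum_i q (N i) *m (q (N i))^T.
  rewrite /q /M raddf_sum; apply: eq_bigr => i _.
  by rewrite map_trmx -map_mxM.
have sq0 : \sum_i \sum_j (u *m q (N i)) 0 j ^+ 2 = 0.
  have := congr1 (fun w => (w *m u^T) 0 0) uM.
  rewrite mul0mx [RHS]mxE qM mulmx_sumr mulmx_suml summxE => e.
  rewrite -[RHS]e.
  apply: eq_bigr => i _.
  rewrite !mulmxA -mulmxA -trmx_mul mxE; apply: eq_bigr => j _.
  by rewrite [_^T _ _]mxE expr2.
have uo : u *m q (N o) = 0.
  apply/rowP => j; rewrite [RHS]mxE; apply/eqP; rewrite -sqrf_eq0.
  have ge0 i : 0 <= \sum_j (u *m q (N i)) 0 j ^+ 2 by apply: Num.Theory.sumr_ge0 => k _; apply: Num.Theory.sqr_ge0.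
  move: sq0 => /eqP; rewrite Num.Theory.psumr_eq0 // => /allP /(_ o).
  rewrite mem_index_enum => /(_ isT) /=.
  rewrite Num.Theory.psumr_eq0; last by move=> k _; apply: Num.Theory.sqr_ge0.
  by move=> /allP /(_ j); rewrite mem_index_enum => /(_ isT).
by move: u0; rewrite -[u]mulmx1; rewrite /q No map_mx1 in uo; rewrite uo eqxx.
Qed.

(** * Fusion rules and invertibility of the S-matrix *)

Section Fusion.
Variables (F : closedFieldType) (K : ribbonData F).
Context {rK : ribbon K}.
Implicit Types (X Y Z W T : K).
Hypothesis charF0 : [pchar F] =i pred0.
Hypothesis dec : forall X, exists n (Y : 'I_n -> K), (forall k, simple (Y k)) /\ direct_sum X Y.
Hypothesis schurK : forall X Y (f : hom X Y), simple X -> simple Y -> ~ iso X Y -> f = 0.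
Hypothesis dim_nz : forall X, simple X -> dim X != 0.
Variables (n : nat) (S : 'I_n -> K).
Hypothesis simpS : simple_classes [set: K]%classic S.

Let S_simple k : simple (S k). Proof. by have [/(_ k) []] := simpS. Qed.

Lemma homdim_classes k l : homdim (S k) (S l) = (k == l).
Proof.
have [_ injS _] := simpS.
case: eqP => [->|kl]; first exact: homdim_simple.
by apply: homdim0 => f; apply: schurK => // /injS.
Qed.

Definition additive_dim (a : K -> F) :=
  forall Z m (Y : 'I_m -> K), direct_sum Z Y -> a Z = \sum_k a (Y k).

Lemma additive_iso a X Y : additive_dim a -> iso X Y -> a X = a Y.
Proof. by move=> aa /iso_direct_sum /aa ->; rewrite big_ord1. Qed.

Lemma dec_classes Z : exists m (j : 'I_m -> 'I_n) (Y : 'I_m -> K),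
  (forall k, iso (Y k) (S (j k))) /\ direct_sum Z Y.
Proof.
have [m [Y [sY ZY]]] := dec Z; have [_ _ complS] := simpS.
have /boolp.choice [j jP] k : exists i, iso (Y k) (S i) by apply: complS.
by exists m, j, Y.
Qed.

Lemma additive_expandr a Z : additive_dim a ->
  a Z = \sum_i (homdim (S i) Z)%:R * a (S i).
Proof.
move=> aa; have [m [j [Y [jP ZY]]]] := dec_classes Z.
rewrite (aa _ _ _ ZY).
under [RHS]eq_bigr => i _ do rewrite (homdim_dsumr _ ZY) natr_sum mulr_suml.
rewrite exchange_big /=; apply: eq_bigr => k _.
rewrite (bigD1 (j k)) //= (iso_homdimr _ (jP k)) homdim_classes eqxx mul1r.
rewrite big1 ?addr0; first exact: additive_iso.
by move=> i ni; rewrite (iso_homdimr _ (jP k)) homdim_classes (negbTE ni) mul0r.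
Qed.

(** Multiplicities of simple objects can be read off on either side of [hom]. Both forms are needed,
    because adjunction turns a summation over one side into a summation over the other. *)
Lemma additive_expandl a Z : additive_dim a ->
  a Z = \sum_i (homdim Z (S i))%:R * a (S i).
Proof.
move=> aa; have [m [j [Y [jP ZY]]]] := dec_classes Z.
rewrite (aa _ _ _ ZY).
under [RHS]eq_bigr => i _ do rewrite (homdim_dsuml _ ZY) natr_sum mulr_suml.
rewrite exchange_big /=; apply: eq_bigr => k _.
rewrite (bigD1 (j k)) //= (iso_homdiml _ (jP k)) homdim_classes eqxx mul1r.
rewrite big1 ?addr0; first exact: additive_iso.
by move=> i ni; rewrite (iso_homdiml _ (jP k)) homdim_classes eq_sym (negbTE ni) mul0r.
Qed.

Definition sm X Y : F := mon (cid X) (cid Y).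

Lemma mon_dsum Z m (Y : 'I_m -> K) W (u : hom W W) : direct_sum Z Y ->
  mon (cid Z) u = \sum_k mon (cid (Y k)) u.
Proof.
move=> [i [p [pi _ <-]]].
have -> : mon (\sum_k (i k \oc p k)) u = \sum_k mon (i k \oc p k) u.
  apply: (big_morph (fun f => mon f u)) => [f g|].
    by rewrite -[f in LHS]scale1r mon_lin mul1r.
  by rewrite /mon om0l oc0r trace0.
by apply: eq_bigr => k _; rewrite mon_cyc pi.
Qed.

Lemma smC X Y : sm X Y = sm Y X. Proof. exact: monC. Qed.
Lemma sm_additive Y : additive_dim (sm Y).
Proof.
move=> Z m W ZW; rewrite smC /sm (mon_dsum _ ZW).
by apply: eq_bigr => k _; rewrite monC.
Qed.
Lemma sm_unit X : sm (tunit K) X = dim X.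
Proof. by rewrite smC /sm mon_unit. Qed.
Lemma dim_additive : additive_dim (@dim F K).
Proof.
move=> Z m Y ZY; rewrite -sm_unit (sm_additive _ ZY).
by apply: eq_bigr => k _; rewrite sm_unit.
Qed.
Lemma sm_tens X Y Z : simple X -> sm X (Y \ox Z) = sm X Y * sm X Z / dim X.
Proof. by move=> sX; rewrite /sm -om1 mon_tens // dim_nz. Qed.
Lemma dim_tens Y Z : dim (Y \ox Z) = dim Y * dim Z.
Proof. by rewrite -!sm_unit sm_tens ?dim_unit ?divr1 //; apply: ribbon_unit. Qed.

Definition gdim : F := \sum_i dim (S i) ^+ 2.
Definition gsum T : F := \sum_i dim (S i) * sm T (S i).

(** Multiplying by the entry of [X] replaces [S i] by [X \ox S i], since rows of the S-matrix are
    characters. Expanding into simple objects [S j] and moving [X] across by adjunction, the sum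
    over [i] becomes the dimension of [dual X \ox S j]. *)
Lemma gsum_dual X T : simple T -> sm T X * gsum T = dim T * dim (dual X) * gsum T.
Proof.
move=> sT.
transitivity (\sum_i dim (S i) * (dim T * sm T (X \ox S i))).
  rewrite mulr_sumr; apply: eq_bigr => i _.
  by rewrite mulrCA sm_tens // [dim T * _]mulrC divfK // dim_nz.
under eq_bigr => i _ do rewrite (additive_expandr _ (sm_additive T)) mulrCA mulr_sumr.
rewrite -mulr_sumr -mulrA; congr (_ * _).
rewrite exchange_big /= /gsum mulr_sumr; apply: eq_bigr => j _.
rewrite mulrA -dim_tens (additive_expandl _ dim_additive) mulr_suml.
apply: eq_bigr => i _.
by rewrite homdim_adjl mulrA [_%:R * _]mulrC.
Qed.

Lemma gsum_unit : gsum (tunit K) = gdim.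
Proof. by apply: eq_bigr => i _; rewrite sm_unit expr2. Qed.

(* [gdim] is an eigenvalue, with eigenvector the dimensions, of the sum of the
   [N_X N_X^T], where [N_X] is the fusion matrix of [X]; this is a positive
   definite integer matrix, because [N_1] is the identity. *)
Lemma gdim_nz : gdim != 0.
Proof.
have [_ _ complS] := simpS.
have [o oP] : exists o, iso (tunit K) (S o) by apply: complS => //; apply: ribbon_unit.
pose b x z y := homdim (S z) (S x \ox S y).
pose N x : 'M[int]_n := \matrix_(z, y) (b x z y)%:Z.
have No : N o = 1%:M.
  apply/matrixP => z y; rewrite !mxE /b.
  have /iso_homdimr -> : iso (S o \ox S y) (S y).
    have [f [g [gf fg]]] := oP.
    exists (lunit (S y) \oc (g \om cid (S y))), ((f \om cid (S y)) \oc lunitV (S y)).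
    split; first by rewrite !ocA -[_ \oc lunitV _ \oc _]ocA luK cidr -omC fg cidl om1.
    by rewrite !ocA -[_ \oc (g \om _) \oc _]ocA -omC gf cidl om1 cidr luVK.
  by rewrite homdim_classes; case: (z == y).
pose NF x := map_mx (intr : int -> F) (N x).
pose v : 'rV[F]_n := \row_z dim (S z).
have vN x : v *m NF x = dim (S x) *: v.
  apply/rowP => y; rewrite !mxE -dim_tens (additive_expandr _ dim_additive).
  by apply: eq_bigr => z _; rewrite !mxE mulrC.
(* By adjunction the transposed fusion matrix of [S x] is that of its dual, which has the same
   dimension. *)
have vNT x : v *m (NF x)^T = dim (S x) *: v.
  apply/rowP => z; rewrite !mxE -[dim (S x)]dim_dual -dim_tens (additive_expandl _ dim_additive).
  by apply: eq_bigr => y _; rewrite !mxE /b homdim_adjl mulrC.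
apply/negP => /eqP D0.
have vM : v *m map_mx intr (\sum_x N x *m (N x)^T) = 0.
  have -> : map_mx (intr : int -> F) (\sum_x N x *m (N x)^T) = \sum_x NF x *m (NF x)^T.
    by rewrite raddf_sum; apply: eq_bigr => x _; rewrite /NF map_trmx -map_mxM.
  rewrite mulmx_sumr.
  under eq_bigr => x _ do rewrite mulmxA vN -scalemxAl vNT scalerA -expr2.
  by rewrite -scaler_suml -/gdim D0 scale0r.
have v0 : v != 0.
  apply/negP => /eqP v0; have := dim_nz (S_simple o).
  by have := congr1 (fun w : 'rV[F]_n => w 0 o) v0; rewrite !mxE => ->; rewrite eqxx.
have : \det (map_mx (intr : int -> F) (\sum_x N x *m (N x)^T)) == 0.
  by apply/det0P; exists v.
by rewrite det_map_mx intr_inj0 // (negbTE (posdef_det No)).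
Qed.

Lemma gsum_eq0 T : simple T -> (exists X, sm T X != dim T * dim X) -> gsum T = 0.
Proof.
move=> sT [X neq]; have /eqP := gsum_dual X sT.
rewrite dim_dual -subr_eq0 -mulrBl mulf_eq0 subr_eq0 (negbTE neq) /=.
by move/eqP.
Qed.

Lemma gsum_iso T T' : iso T T' -> gsum T = gsum T'.
Proof.
move=> i; apply: eq_bigr => k _; congr (_ * _).
by rewrite smC (additive_iso (sm_additive _) i) smC.
Qed.

(** Orthogonality: [S'] consists of the entries at the duals, and an entry of [Smatrix S *m S'] is
    the sum of [gsum] over the simple constituents of [S j \ox dual (S k)]. Only the unit
    contributes, with value [gdim] and multiplicity the Kronecker delta. *)
Lemma Smatrix_unit :
  (forall T, simple T -> (forall X, sm T X = dim T * dim X) -> iso T (tunit K)) ->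
  Smatrix S \in unitmx.
Proof.
move=> triv.
have [_ _ complS] := simpS.
have [o oP] : exists o, iso (tunit K) (S o) by apply: complS => //; apply: ribbon_unit.
pose S' := \matrix_(i, k) sm (S i) (dual (S k)) : 'M[F]_n.
have SS' : Smatrix S *m S' = gdim%:M.
  apply/matrixP => j k; rewrite !mxE.
  have SE i : Smatrix S j i = sm (S i) (S j).
    by rewrite mxE smC /sm /mon om1 cidr.
  under eq_bigr => i _ do rewrite SE mxE.
  have e i : sm (S i) (S j) * sm (S i) (dual (S k)) = dim (S i) * sm (S i) (S j \ox dual (S k)).
    by rewrite sm_tens // [RHS]mulrC divfK ?dim_nz.
  under eq_bigr => i _ do rewrite e (additive_expandr _ (sm_additive _)) mulr_sumr.
  rewrite exchange_big /=.
  transitivity (\sum_m (homdim (S m) (S j \ox dual (S k)))%:R * gsum (S m)).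
    apply: eq_bigr => m _; rewrite mulr_sumr; apply: eq_bigr => i _.
    by rewrite mulrCA [sm (S m) _]smC.
  rewrite (bigD1 o) //= big1 ?addr0.
    rewrite -(gsum_iso oP) gsum_unit -(iso_homdiml _ oP) -homdim_adjr.
    have /iso_homdiml -> : iso (tunit K \ox S k) (S k).
      by exists (lunit _), (lunitV _); rewrite luK luVK.
    by rewrite homdim_classes mulr_natl eq_sym.
  move=> m mo; rewrite gsum_eq0 ?mulr0 //; apply/boolp.not_existsP => all.
  have : iso (S m) (tunit K).
    by apply: triv => // X; apply/eqP/negPn/negP/all.
  by move=> /iso_trans /(_ oP); have [_ injS _] := simpS; move/injS/eqP; apply/negP.
rewrite unitmxE unitfE.
apply: contraNneq gdim_nz => detS.
have := congr1 determinant SS'; rewrite det_mulmx detS mul0r det_scalar => /esym/eqP.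
by rewrite expf_eq0 => /andP[].
Qed.

End Fusion.

(** * Full subcategories *)

Section FullSub.
Variables (F : closedFieldType) (C : ribbonData F) (D : set C).
Hypotheses (D1 : D (tunit C)) (Dt : forall X Y : C, D X -> D Y -> D (X \ox Y))
  (Dd : forall X : C, D X -> D (dual X)).

(** Turns axioms relative to the set [D] into axioms for all objects of a type, the form in which
    [monoidal], [braided] and [ribbon] are stated. *)
Definition full_sub : ribbonData F :=
  @RibbonData F {X : C | D X} (fun X Y => hom (sval X) (sval Y))
    (fun X => cid (sval X)) (fun X Y Z g f => comp g f)
    (exist _ _ D1) (fun X Y => exist _ _ (Dt (svalP X) (svalP Y)))
    (fun X Y Z T f g => tensm f g)
    (fun X Y Z => assoc (sval X) (sval Y) (sval Z))
    (fun X Y Z => assocV (sval X) (sval Y) (sval Z))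
    (fun X => lunit (sval X)) (fun X => lunitV (sval X))
    (fun X => runit (sval X)) (fun X => runitV (sval X))
    (fun X Y => braid (sval X) (sval Y)) (fun X Y => braidV (sval X) (sval Y))
    (fun X => exist _ _ (Dd (svalP X)))
    (fun X => coev (sval X)) (fun X => ev (sval X)) (fun X => twist (sval X)).

Let DP (X : {X : C | D X}) : D (sval X). Proof. exact: svalP. Qed.

Lemma full_sub_monoidal : linear_category D -> monoidal_category D -> monoidal full_sub.
Proof.
move=> [? ? ? ? ?] [? ? tl tr ti tc ? ? ? ? ? ? an ln rn pe tri].
split; first by split=> /= *; auto using DP.
split=> //=; try by move=> *; auto using DP.
Qed.

Lemma full_sub_braided : linear_category D -> monoidal_category D -> braided_category D ->
  braided full_sub.
Proof.
move=> lD mD [? ? ? ? ?]; split; first exact: full_sub_monoidal.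
by split=> /= *; auto using DP.
Qed.

Lemma full_sub_ribbon : linear_category D -> monoidal_category D -> braided_category D ->
  rigid_ribbon_category D -> simple (tunit C) -> ribbon full_sub.
Proof.
move=> lD mD bD [dd zz zd ti tn tt td] uD; split; last exact: uD.
  exact: full_sub_braided.
split=> //.
- by move=> X _; apply: zz (DP X).
- by move=> X _; apply: zd (DP X).
- by move=> X _; apply: ti (DP X).
- by move=> X Y f _ _; apply: tn (DP X) (DP Y).
- by move=> X Y _ _; apply: tt (DP X) (DP Y).
- by move=> X _; apply: td (DP X).
Qed.

End FullSub.

Lemma eigenvector (F : closedFieldType) (V : vectType F) (g : V -> V) :
  linear g -> (0 < \dim {:V})%N -> exists a w, w != 0 /\ g w = a *: w.
Proof.
move=> lg.
pose g' : {linear V -> V} := HB.pack_for {linear V -> V} g (GRing.isLinear.Build _ _ _ _ g lg).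
rewrite dimvf => dV.
pose A := lin1_mx (v2r \o (g' \o (r2v : 'rV_(vector.dim V) -> V))).
have /closed_rootP [a] : size (char_poly A) != 1%N by rewrite size_char_poly; case: (vector.dim V) dV.
rewrite -eigenvalue_root_char => /eigenvalueP [v vA v0].
exists a, (r2v v); split; first by rewrite -(inj_eq (@v2r_inj _ V)) r2vK linear0.
apply: (@v2r_inj _ V); rewrite linearZ /= r2vK -vA.
by rewrite mul_rV_lin1.
Qed.

(** * Semisimplicity and von Neumann regularity *)

Section Regular.
Variables (F : closedFieldType) (K : ribbonData F).
Context {mK : monoidal K}.
Implicit Types (X Y Z W : K).

(** A form of semisimplicity that mentions no simple objects. It concerns one morphism at a time,
    and so can be transported to the extension by averaging and to the completion by cutting down
    with idempotents. *)
Definition regular_homs := forall X Y (f : hom X Y), exists g : hom Y X, f \oc g \oc f = f.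
Definition idems_split := forall X (p : hom X X), p \oc p = p ->
  exists Y (i : hom Y X) (r : hom X Y), r \oc i = cid Y /\ i \oc r = p.

Section FromRegular.
Hypotheses (regK : regular_homs) (idemK : idems_split).

(** For nonzero [f], the endomorphisms [g \oc f] and [f \oc g] are scalars that fix [f], hence
    identities, and [f] is an isomorphism. *)
Lemma regular_schur X Y (f : hom X Y) : simple X -> simple Y -> ~ iso X Y -> f = 0.
Proof.
move=> [endX nX] [endY nY] nXY; have [g fgf] := regK f.
have [a ea] := endX (g \oc f); have [b eb] := endY (f \oc g).
apply/eqP/negPn/negP => f0; apply: nXY.
have a1 : a = 1.
  apply/eqP; rewrite -subr_eq0; apply: contraNT f0 => na.
  have e : a *: f = f by rewrite -[RHS]fgf -ocA ea ocZr cidr.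
  by rewrite -(scalerK na f) scalerBl scale1r e subrr scaler0.
have b1 : b = 1.
  apply/eqP; rewrite -subr_eq0; apply: contraNT f0 => nb.
  have e : b *: f = f by rewrite -[RHS]fgf eb ocZl cidl.
  by rewrite -(scalerK nb f) scalerBl scale1r e subrr scaler0.
by exists f, g; rewrite ea eb a1 b1 !scale1r.
Qed.

(** Subtracting from a non-scalar [f] an eigenvalue of composition with [f] leaves a nonzero [g]
    that kills some nonzero [w]. With a quasi-inverse [h] of [g], both [g \oc h] and [h \oc g] are
    nonzero idempotents, and the second is not the identity because [g] kills [w]. *)
Lemma nontrivial_idem X : cid X != 0 -> (exists f : hom X X, forall a, f <> a *: cid X) ->
  exists p : hom X X, [/\ p \oc p = p, p != 0 & p != cid X].
Proof.
move=> nX [f nf].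
have [a [w [w0 fw]]] : exists a (w : hom X X), w != 0 /\ f \oc w = a *: w.
  apply: (@eigenvector _ _ (fun w : hom X X => f \oc w)); first by move=> b s t; rewrite ocDr ocZr.
  by rewrite lt0n dimv_eq0; apply: contraNneq nX => V0; rewrite -memv0 -V0 memvf.
pose g := f - a *: cid X.
have g0 : g != 0 by rewrite subr_eq0; apply/eqP.
have gw : g \oc w = 0 by rewrite ocBl ocZl cidl fw subrr.
have [h ghg] := regK g.
have gh0 : g \oc h != 0 by apply: contraNneq g0 => gh; rewrite -ghg gh oc0l.
have [gh1|gh1] := eqVneq (g \oc h) (cid X); last first.
  by exists (g \oc h); split=> //; rewrite ocA ghg.
exists (h \oc g); split.
- by rewrite -ocA [g \oc _]ocA ghg.
- by apply: contraNneq g0 => hg; rewrite -ghg -ocA hg oc0r.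
- by apply: contraNneq w0 => hg; rewrite -[w]cidl -hg -ocA gw oc0r.
Qed.

Lemma direct_sum_cat X m n (Y : 'I_m -> K) (Z : 'I_n -> K) (p : hom X X) X1 X2
    (i1 : hom X1 X) (r1 : hom X X1) (i2 : hom X2 X) (r2 : hom X X2) :
  r1 \oc i1 = cid X1 -> i1 \oc r1 = p -> r2 \oc i2 = cid X2 -> i2 \oc r2 = cid X - p ->
  direct_sum X1 Y -> direct_sum X2 Z ->
  direct_sum X (fun k : 'I_(m + n) => match split k with inl a => Y a | inr b => Z b end).
Proof.
move=> ri1 ir1 ri2 ir2 [i [q [qi qi0 iq]]] [j [s [sj sj0 js]]].
have r12 : r1 \oc i2 = 0.
  rewrite -[i2]cidr -ri2 -[r1]cidl -ri1 !ocA -[_ \oc r1 \oc i2]ocA.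
  rewrite -!ocA [i1 \oc _]ocA ir1 [i2 \oc _]ocA ir2 [p \oc _]ocA.
  by rewrite ocBr cidr -ir1 -!ocA [r1 \oc (i1 \oc _)]ocA ri1 cidl subrr oc0l oc0r.
have r21 : r2 \oc i1 = 0.
  rewrite -[i1]cidr -ri1 -[r2]cidl -ri2 -!ocA [i1 \oc _]ocA ir1 [i2 \oc _]ocA ir2 [(cid X - p) \oc _]ocA.
  by rewrite ocBl cidl -ir1 -!ocA [r1 \oc (i1 \oc _)]ocA ri1 cidl subrr oc0l oc0r.
exists (fun k => match split k as u return hom (match u with inl a => Y a | inr b => Z b end) X with
   inl a => i1 \oc i a | inr b => i2 \oc j b end).
exists (fun k => match split k as u return hom X (match u with inl a => Y a | inr b => Z b end) with
   inl a => q a \oc r1 | inr b => s b \oc r2 end).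
split.
- move=> k; case: (split k) => a.
    by rewrite -ocA [r1 \oc _]ocA ri1 cidl qi.
  by rewrite -ocA [r2 \oc _]ocA ri2 cidl sj.
- move=> k l; rewrite -(inj_eq (can_inj (@splitK m n))).
  case: (split k) => a; case: (split l) => b ne; rewrite -ocA.
  + by rewrite [r1 \oc _]ocA ri1 cidl qi0.
  + by rewrite [r1 \oc _]ocA r12 oc0l oc0r.
  + by rewrite [r2 \oc _]ocA r21 oc0l oc0r.
  + by rewrite [r2 \oc _]ocA ri2 cidl sj0.
- pose phi (u : 'I_m + 'I_n) : hom X X :=
    match u with inl a => i1 \oc i a \oc (q a \oc r1) | inr b => i2 \oc j b \oc (s b \oc r2) end.
  transitivity (\sum_k phi (split k)); first by apply: eq_bigr => k _; case: (split k).
  have -> : cid X = i1 \oc cid X1 \oc r1 + i2 \oc cid X2 \oc r2.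
    by rewrite !cidr ir1 ir2 addrC subrK.
  rewrite big_split_ord /= -iq -js !oc_sumr !oc_suml; congr (_ + _); apply: eq_bigr => k _.
    by rewrite (unsplitK (inl k)) /= !ocA.
  by rewrite (unsplitK (inr k)) /= !ocA.
Qed.

Lemma dim_retract X X1 (p : hom X X) (i1 : hom X1 X) (r1 : hom X X1) :
  p != cid X -> r1 \oc i1 = cid X1 -> i1 \oc r1 = p -> (homdim X1 X1 < homdim X X)%N.
Proof.
move=> p1 ri ir.
pose f (s : hom X1 X1) : hom X X := i1 \oc s \oc r1.
have lf : linear f by move=> b s t; rewrite /f ocDr ocZr ocDl ocZl.
have fI : injective f.
  move=> s t /(congr1 (fun u => r1 \oc u \oc i1)).
  by rewrite /f !ocA ri !cidl -!ocA ri !cidr.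
pose g : {linear hom X1 X1 -> hom X X} := HB.pack_for {linear hom X1 X1 -> hom X X} f
  (GRing.isLinear.Build _ _ _ _ f lf).
have kg : lker (linfun g) == 0%VS.
  by apply/lker0P => x y; rewrite !lfunE; apply: fI.
rewrite /homdim -(limg_dim_eq (f := linfun g) (U := fullv)); last by rewrite (eqP kg) capv0.
rewrite ltnNge; apply: contra p1 => le.
have full : (linfun g @: fullv)%VS = fullv by apply/eqP; rewrite eqEdim subvf.
have : cid X \in (linfun g @: fullv)%VS by rewrite full memvf.
move=> /memv_imgP [s _]; rewrite lfunE /= => e.
apply/eqP; rewrite -[LHS]cidr e /f -ir -!ocA [r1 \oc (i1 \oc _)]ocA ri cidl.
by rewrite !ocA.
Qed.

(** Induction on the dimension of the endomorphism space: a nontrivial idempotent splits [X] into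
    two objects for which it is strictly smaller. *)
Lemma regular_decomposition X :
  exists n (Y : 'I_n -> K), (forall k, simple (Y k)) /\ direct_sum X Y.
Proof.
have [d] := ubnP (homdim X X); elim: d X => // d IH X /ltnSE dX.
have [X0|nX] := eqVneq (cid X) 0.
  exists 0%N, (fun=> X); split; first by case.
  by exists (fun k => 0), (fun k => 0); split=> [[]|[]|] //; rewrite big_ord0.
have [scalarX|/boolp.existsNP [f nf]] := boolp.EM (forall f : hom X X, exists a, f = a *: cid X).
  exists 1%N, (fun=> X); split; first by split=> //; apply/eqP.
  exact/iso_direct_sum/iso_refl.
have [|p [pp p0 p1]] := nontrivial_idem nX; first by exists f => a fa; apply: nf; exists a.
have [X1 [i1 [r1 [ri1 ir1]]]] := idemK pp.
have qq : (cid X - p) \oc (cid X - p) = cid X - p.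
  by rewrite ocBl cidl ocBr cidr pp subrr subr0.
have [X2 [i2 [r2 [ri2 ir2]]]] := idemK qq.
have q1 : cid X - p != cid X by rewrite -subr_eq0 addrAC subrr add0r oppr_eq0.
have [n1 [Y1 [s1 XY1]]] := IH X1 (leq_trans (dim_retract p1 ri1 ir1) dX).
have [n2 [Y2 [s2 XY2]]] := IH X2 (leq_trans (dim_retract q1 ri2 ir2) dX).
exists (n1 + n2)%N, (fun k => match split k with inl a => Y1 a | inr b => Y2 b end).
split; first by move=> k; case: (split k).
exact: direct_sum_cat ri1 ir1 ri2 ir2 XY1 XY2.
Qed.

End FromRegular.
End Regular.

Section RegularOfSemisimple.
Variables (F : closedFieldType) (K : ribbonData F).
Context {mK : monoidal K}.
Implicit Types (X Y Z W : K).
Hypothesis dec : forall X, exists n (Y : 'I_n -> K), (forall k, simple (Y k)) /\ direct_sum X Y.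
Hypothesis schurK : forall X Y (f : hom X Y), simple X -> simple Y -> ~ iso X Y -> f = 0.

Lemma simple_between X Y (f : hom X Y) : f != 0 ->
  exists Z (i : hom Z X) (r : hom Y Z), simple Z /\ r \oc f \oc i = cid Z.
Proof.
move=> f0.
have [n [Z [sZ [i [p [_ _ ip]]]]]] := dec X.
have [m [W [sW [j [q [_ _ jq]]]]]] := dec Y.
have [k [l kl0]] : exists k l, q l \oc f \oc i k != 0.
  apply/boolp.not_existsP => nokl; case/eqP: f0.
  rewrite -[f]cidl -[_ \oc f]cidr -ip -jq oc_sumr big1 // => k _.
  rewrite oc_suml oc_suml big1 // => l _.
  have e : q l \oc f \oc i k = 0 by apply/eqP/negPn/negP => ne; apply: (nokl k); exists l.
  by rewrite -!ocA [f \oc (i k \oc _)]ocA [q l \oc (_ \oc _)]ocA [q l \oc (f \oc _)]ocA e oc0l oc0r.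
have [u [w [wu uw]]] : iso (Z k) (W l).
  by have [//|/(schurK (q l \oc f \oc i k)) e] := boolp.EM (iso (Z k) (W l)); rewrite e ?eqxx in kl0.
have [c ec] := (sZ k).1 (w \oc (q l \oc f \oc i k)).
have c0 : c != 0.
  apply: contraNneq kl0 => c0; rewrite -[_ \oc i k]cidl -uw -ocA ec c0 scale0r.
  by rewrite oc0r.
exists (Z k), (i k), (c^-1 *: (w \oc q l)); split=> //.
by rewrite !ocZl -!ocA [q l \oc _]ocA ec scalerA mulVf // scale1r.
Qed.

(** Induction on the dimension of [im f], the space of composites [f \oc u]. Removing from [f] the
    part passing through a simple [Z] gives [f'] with [r \oc f' = 0], whose space is strictly
    smaller. *)
Lemma semisimple_regular : regular_homs K.
Proof.
move=> X Y.
have clin (f : hom X Y) : linear (fun u : hom X X => f \oc u) by move=> b s t; rewrite ocDr ocZr.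
pose L (f : hom X Y) : {linear hom X X -> hom X Y} :=
  HB.pack_for {linear hom X X -> hom X Y} (fun u : hom X X => f \oc u)
    (GRing.isLinear.Build _ _ _ _ _ (clin f)).
pose im (f : hom X Y) := limg (linfun (L f)).
move=> f; have [d] := ubnP (\dim (im f)); elim: d f => // d IH f /ltnSE df.
have [->|f0] := eqVneq f 0; first by exists 0; rewrite oc0r.
have [Z [i [r [[_ /eqP nZ] rfi]]]] := simple_between f0.
have [f' f'E] : exists f', f' = f \oc (cid X - i \oc r \oc f) by exists (f \oc (cid X - i \oc r \oc f)).
have rf' : r \oc f' = 0.
  by rewrite f'E ocA ocBr cidr !ocA rfi cidl subrr.
have ff' : im f' != im f.
  apply: contraNneq nZ => e.
  have : f \oc (i \oc r \oc f) \in im f.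
    by apply/memv_imgP; exists (i \oc r \oc f); rewrite ?memvf // lfunE.
  rewrite -e => /memv_imgP [u _]; rewrite lfunE /= => fe.
  have := congr1 (fun s => r \oc s \oc i) fe.
  by rewrite !ocA rfi cidl rfi rf' !oc0l => ->.
have sub : (im f' <= im f)%VS.
  apply/subvP => s /memv_imgP [u _ ->]; rewrite lfunE /=.
  apply/memv_imgP; exists ((cid X - i \oc r \oc f) \oc u); rewrite ?memvf // lfunE /=.
  by rewrite f'E !ocA.
have ltd : (\dim (im f') < d)%N.
  apply: leq_trans df; rewrite ltn_neqAle dimvS // andbT.
  by apply: contraNneq ff' => e; rewrite eqEdim sub e leqnn.
have [g' fg'] := IH f' ltd.
(* The first summand restores the part of [f] through [Z]; as [f'] is also
   [(cid Y - f \oc i \oc r) \oc f], the second one yields [f' \oc g' \oc f' = f']. *)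
exists (i \oc r + (cid X - i \oc r \oc f) \oc g' \oc (cid Y - f \oc i \oc r)).
rewrite ocDr ocDl.
have -> : f \oc ((cid X - i \oc r \oc f) \oc g' \oc (cid Y - f \oc i \oc r)) \oc f = f'.
  rewrite -[RHS]fg' f'E -!ocA; congr (_ \oc (_ \oc (_ \oc _))).
  by rewrite ocBl ocBr cidl cidr !ocA.
by rewrite f'E ocBr cidr !ocA addrC subrK.
Qed.
End RegularOfSemisimple.

(** * The encircling element of a modular category *)

Section Modular.
Variables (F : closedFieldType) (K : ribbonData F).
Context {rK : ribbon K}.
Implicit Types (X Y Z W T : K).
Hypothesis charF0 : [pchar F] =i pred0.
Hypothesis dec : forall X, exists n (Y : 'I_n -> K), (forall k, simple (Y k)) /\ direct_sum X Y.
Hypothesis schurK : forall X Y (f : hom X Y), simple X -> simple Y -> ~ iso X Y -> f = 0.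
Variables (n : nat) (S : 'I_n -> K).
Hypothesis simpS : simple_classes [set: K]%classic S.
Hypothesis unitS : Smatrix S \in unitmx.

Let S_simple k : simple (S k). Proof. by have [/(_ k) []] := simpS. Qed.
Let complS Y : simple Y -> exists k, iso Y (S k).
Proof. by have [_ _ c] := simpS; move=> sY; apply: c. Qed.

Lemma SmatrixE j i : Smatrix S j i = sm (S j) (S i).
Proof. by rewrite mxE /sm /mon om1 cidr. Qed.

Lemma Smatrix_free (v : 'rV[F]_n) : v *m Smatrix S = 0 -> v = 0.
Proof. by move=> vS; rewrite -(mulmxK unitS v) vS mul0mx. Qed.

Lemma iso_dim X Y : iso X Y -> dim X = dim Y.
Proof. by move/iso_direct_sum/dim_additive => ->; rewrite big_ord1. Qed.

(** Encircling a simple object gives scalars; if its dimension were zero, their traces, which form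
    its row of the S-matrix, would all be zero. *)
Lemma modular_dim_nz X : simple X -> dim X != 0.
Proof.
move=> sX; have [k Xk] := complS sX; rewrite (iso_dim Xk).
apply/negP => /eqP d0.
have : (delta_mx 0 k : 'rV[F]_n) *m Smatrix S = 0.
  apply/rowP => i; rewrite -rowE mxE SmatrixE [RHS]mxE /sm /mon -trace_encu cidr.
  have [a ->] := (S_simple k).1 (encu (cid (S i)) (S k)).
  by rewrite traceZ -/(dim _) d0 mulr0.
move/Smatrix_free/rowP/(_ k); rewrite !mxE !eqxx => /eqP.
by rewrite oner_eq0.
Qed.

(** The row of such a [T] is a multiple of the row of the unit, and the rows of an invertible matrix
    are independent. *)
Lemma modular_center T : simple T -> (forall X, sm T X = dim T * dim X) -> iso T (tunit K).
Proof.
move=> sT cT; have [t Tt] := complS sT.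
have [o oP] := complS (@ribbon_unit F K rK).
have {}cT i : sm (S t) (S i) = dim (S t) * dim (S i).
  by rewrite smC -(additive_iso (sm_additive _) Tt) smC cT (iso_dim Tt).
have co i : sm (S o) (S i) = dim (S i).
  by rewrite smC -(additive_iso (sm_additive _) oP) smC sm_unit.
suff to : t = o by move: Tt; rewrite to => Tt; apply: iso_trans Tt (iso_sym oP).
apply/eqP; apply: contraT => to.
have : (delta_mx 0 t - dim (S t) *: delta_mx 0 o : 'rV[F]_n) *m Smatrix S = 0.
  apply/rowP => i; rewrite mulmxBl -scalemxAl -!rowE.
  rewrite mxE [row t _ _ _]mxE SmatrixE cT [(- _ : 'M_(_, _)) _ _]mxE [(_ *: _ : 'M_(_, _)) _ _]mxE.
  by rewrite [row o _ _ _]mxE SmatrixE co subrr mxE.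
move/Smatrix_free/rowP/(_ t); rewrite !mxE !eqxx (negbTE to) mulr0 subr0 => /eqP.
by rewrite oner_eq0.
Qed.

Definition omega Z : hom Z Z := \sum_i dim (S i) *: encu (cid (S i)) Z.

Lemma omega_nat Z W (f : hom Z W) : omega W \oc f = f \oc omega Z.
Proof.
rewrite /omega oc_suml oc_sumr; apply: eq_bigr => i _.
by rewrite ocZl ocZr encu_nat.
Qed.

Lemma omega_simple T : simple T -> omega T = (gsum S T / dim T) *: cid T.
Proof.
move=> sT; rewrite /omega /gsum mulr_suml scaler_suml; apply: eq_bigr => i _.
by rewrite encu_simple ?modular_dim_nz // scalerA mulrA.
Qed.

Lemma omega_unit T : iso T (tunit K) -> omega T = gdim S *: cid T.
Proof.
move=> i1; have [f [g [gf fg]]] := i1.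
have s1 : simple T.
  split=> [u|T0].
    have [b e] := (@ribbon_unit F K rK).1 (f \oc u \oc g).
    have -> : u = g \oc (f \oc u \oc g) \oc f.
      by rewrite !ocA gf cidl -!ocA gf cidr.
    by exists b; rewrite e ocZr ocZl cidr gf.
  have [_] := @ribbon_unit F K rK; apply; by rewrite -fg -[f]cidr T0 oc0r oc0l.
rewrite omega_simple // (gsum_iso _ i1) gsum_unit.
by rewrite (iso_dim i1) dim_unit divr1.
Qed.

Lemma omega_nontrivial T : simple T -> ~ iso T (tunit K) -> omega T = 0.
Proof.
move=> sT nT; rewrite omega_simple //.
rewrite (gsum_eq0 dec schurK modular_dim_nz simpS) ?mul0r ?scale0r //.
by apply/boolp.not_existsP => all; apply: nT; apply: modular_center => // X; apply/eqP/negPn/negP/all.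
Qed.

Lemma omega_factor Z : exists m (i : 'I_m -> hom (tunit K) Z) (p : 'I_m -> hom Z (tunit K)),
  omega Z = gdim S *: \sum_k (i k \oc p k).
Proof.
have [m [Y [sY [i [p [_ _ ip]]]]]] := dec Z.
have /boolp.choice [w wP] k : exists w : hom (tunit K) Z * hom Z (tunit K),
    i k \oc omega (Y k) \oc p k = gdim S *: (w.1 \oc w.2).
  have [i1|n1] := boolp.EM (iso (Y k) (tunit K)).
    have [f [g [gf fg]]] := i1; exists (i k \oc g, f \oc p k) => /=.
    rewrite omega_unit // ocZr ocZl cidr; congr (_ *: _).
    by rewrite !ocA -[_ \oc g \oc f]ocA gf cidr.
  by exists (0, 0); rewrite omega_nontrivial // oc0r oc0l oc0r scaler0.
exists m, (fun k => (w k).1), (fun k => (w k).2).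
rewrite -[LHS]cidr -ip oc_sumr scaler_sumr; apply: eq_bigr => k _.
by rewrite -wP ocA omega_nat.
Qed.

End Modular.

(** * Functions on the group *)

(* For the algebra of functions on [gT], [rho g] is the right translation by [g]: it
   commutes with the left regular action, hence is a morphism of the category. *)
Record galois_algebra (F : closedFieldType) (C : ribbonData F) (A : frobenius C)
    (gT : finGroupType) (rho : gT -> hom (A : C) A) : Prop := GaloisAlgebra {
  ga_frobenius : comm_frobenius A;
  ga_twist : twist (A : C) = cid (A : C);
  ga_mulcomul : fmul A \oc fcomul A = #|gT|%:R *: cid (A : C);
  ga_counit_unit : fcounit A \oc funit A = cid (tunit C);
  ga_mul : forall g, rho g \oc fmul A = fmul A \oc (rho g \om rho g);
  ga_unit : forall g, rho g \oc funit A = funit A;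
  ga_comul : forall g, fcomul A \oc rho g = (rho g \om rho g) \oc fcomul A;
  ga_counit : forall g, fcounit A \oc rho g = fcounit A;
  ga_inv : forall g, rho g^-1%g \oc rho g = cid (A : C);
  ga_one : rho 1%g = cid (A : C);
  ga_sum : \sum_g rho g = #|gT|%:R *: (funit A \oc fcounit A);
  ga_resolution : \sum_g ((rho g^-1%g \om cid (A : C)) \oc fcomul A \oc fmul A \oc
      (rho g \om cid (A : C))) = #|gT|%:R *: cid ((A : C) \ox A);
  ga_aut : forall f, AutA f -> exists g, f = rho g;
  ga_free : forall c : gT -> F, \sum_g c g *: rho g = 0 -> forall g, c g = 0;
  ga_hom1l : forall f : hom (tunit C) A, exists b, f = b *: funit A;
  ga_hom1r : forall f : hom (A : C) (tunit C), exists b, f = b *: fcounit A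
}.

Lemma tensor_ext (F : closedFieldType) (V W U T : vectType F) (mu : V -> W -> U) (u v : U -> T) :
  is_tensor_product mu -> linear u -> linear v ->
  (forall x y, u (mu x y) = v (mu x y)) -> forall t, u t = v t.
Proof.
move=> [_ _ /andP [/eqP sp _]] lu lv uv t.
have lw : linear (fun t => u t - v t).
  by move=> b s s'; rewrite lu lv scalerBr opprD addrACA.
pose w : {linear U -> T} := HB.pack_for {linear U -> T} (fun t => u t - v t)
  (GRing.isLinear.Build _ _ _ _ _ lw).
have : t \in lker (linfun w).
  have : t \in (fullv : {vspace U}) by rewrite memvf.
  rewrite -sp; apply/subvP; apply/span_subvP => s /allpairsP [[x y] [_ _ ->]].
  by rewrite memv_ker lfunE /= uv subrr.
by rewrite memv_ker lfunE /= subr_eq0 => /eqP.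
Qed.

Local Arguments emul {F gT C} r {X Y}.

Section FunctionAlgebra.
Variables (F : closedFieldType) (charF0 : [pchar F] =i pred0) (C : ribbonData F).
Variables (S : set C) (S1 : S (tunit C)) (St : forall X Y : C, S X -> S Y -> S (X \ox Y)).
Hypothesis twS : trivial_twist S.
Hypothesis symS : forall X Y : C, S X -> S Y -> braid Y X \oc braid X Y = cid (X \ox Y).
Context {mC : monoidal C}.
Variables (gT : finGroupType) (E : rep_functor gT C) (equivE : sym_tensor_equivalence S E).
Variables (A : frobenius C) (SA : S (frob A)).
Variable phi : 'Hom({ffun gT -> F^o}, E (A : C)).
Hypotheses (bij_phi : bijective phi)
  (phi_act : forall g f, eact E (A : C) g (phi f) = phi [ffun h => f (g^-1 * h)%g])
  (phi_mul : forall f h, ehom E (fmul A) (emul E (phi f) (phi h)) =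
                    phi [ffun x => (f x : F) * h x])
  (phi_unit : ehom E (funit A) (eone E) = phi [ffun => 1])
  (phi_comul : forall g, ehom E (fcomul A) (phi (delta F g)) =
                  #|gT|%:R *: emul E (phi (delta F g)) (phi (delta F g)))
  (phi_counit : forall g, ehom E (fcounit A) (phi (delta F g)) = (#|gT|%:R)^-1 *: eone E).

Local Notation a := (A : C).
Local Notation n := (#|gT|%:R : F).
Local Hint Resolve S1 SA St : core.
Local Notation e g := (phi (delta F g)).
Implicit Types (g h k : gT).

Lemma card_nz : n != 0.
Proof.
move: charF0 => /pcharf0P ->; rewrite -lt0n; apply/card_gt0P; by exists 1%g.
Qed.

Lemma EC X Y Z (f : hom X Y) (g : hom Y Z) v : S X -> S Y -> S Z ->
  ehom E (g \oc f) v = ehom E g (ehom E f v).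
Proof. by move=> sX sY sZ; rewrite (ehom_comp equivE) // lfunE. Qed.

Lemma EI X v : S X -> ehom E (cid X) v = v.
Proof. by move=> sX; rewrite (ehom_id equivE) // lfunE. Qed.

Lemma EN X Y X' Y' (f : hom X X') (h : hom Y Y') x y :
    S X -> S Y -> S X' -> S Y' ->
    ehom E (f \om h) (emul E x y) = emul E (ehom E f x) (ehom E h y).
Proof. exact: (emul_nat equivE). Qed.

Lemma EZ X Y b (f : hom X Y) v : S X -> S Y -> ehom E (b *: f) v = b *: ehom E f v.
Proof.
move=> sX sY; have e0 : ehom E (0 : hom X Y) = 0.
  have := ehom_linear equivE (-1) (0 : hom X Y) 0 sX sY.
  by rewrite scaler0 addr0 scaleN1r addNr.
by rewrite -[b *: f]addr0 (ehom_linear equivE) // e0 addr0 lfunE.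
Qed.

Lemma ES X Y (I : finType) (f : I -> hom X Y) v : S X -> S Y ->
  ehom E (\sum_i f i) v = \sum_i ehom E (f i) v.
Proof.
move=> sX sY; apply: (big_morph (fun f : hom X Y => ehom E f v)) => [s t|].
  by rewrite -[s in LHS]scale1r (ehom_linear equivE) // scale1r add_lfunE.
by rewrite -(scale0r (0 : hom X Y)) EZ // scale0r.
Qed.

Lemma emulZl X Y b (x : E X) (y : E Y) : S X -> S Y -> emul E (b *: x) y = b *: emul E x y.
Proof.
move=> sX sY; have [lx _ _] := emul_tensor equivE sX sY.
have e0 : emul E (0 : E X) y = 0.
  by have := lx (-1) 0 0 y; rewrite scaler0 addr0 scaleN1r addNr.
by rewrite -[b *: x]addr0 lx e0 addr0.
Qed.

Lemma emulZr X Y b (x : E X) (y : E Y) : S X -> S Y -> emul E x (b *: y) = b *: emul E x y.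
Proof.
move=> sX sY; have [_ ly _] := emul_tensor equivE sX sY.
have e0 : emul E x (0 : E Y) = 0.
  by have := ly (-1) x 0 0; rewrite scaler0 addr0 scaleN1r addNr.
by rewrite -[b *: y]addr0 ly e0 addr0.
Qed.

Lemma emulDl X Y (I : finType) (x : I -> E X) (y : E Y) : S X -> S Y ->
  emul E (\sum_i x i) y = \sum_i emul E (x i) y.
Proof.
move=> sX sY; have [lx _ _] := emul_tensor equivE sX sY.
apply: (big_morph (fun x => emul E x y)) => [s t|].
  by rewrite -[s in LHS]scale1r lx !scale1r.
by rewrite -(scale0r (0 : E X)) emulZl // scale0r.
Qed.

Lemma emulDr X Y (I : finType) (x : E X) (y : I -> E Y) : S X -> S Y ->
  emul E x (\sum_i y i) = \sum_i emul E x (y i).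
Proof.
move=> sX sY; have [_ ly _] := emul_tensor equivE sX sY.
apply: (big_morph (fun y => emul E x y)) => [s t|].
  by rewrite -[s in LHS]scale1r ly !scale1r.
by rewrite -(scale0r (0 : E Y)) emulZr // scale0r.
Qed.

Lemma delta_sum (f : {ffun gT -> F^o}) : f = \sum_g (f g : F) *: delta F g.
Proof.
apply/ffunP => h; rewrite sum_ffunE (bigD1 h) //= big1 => [|k kh]; rewrite !ffunE.
  by rewrite eqxx addr0; apply/esym/mulr1.
by rewrite eq_sym (negbTE kh); apply: mulr0.
Qed.

Lemma A_basis (x : E a) : exists c : gT -> F, x = \sum_g c g *: e g.
Proof.
have [psi _ psiK] := bij_phi.
exists (psi x); rewrite -{1}(psiK x) {1}(delta_sum (psi x)) linear_sum.
by apply: eq_bigr => g _; rewrite linearZ.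
Qed.

Lemma A_ext (T : vectType F) (u v : E a -> T) : linear u -> linear v ->
  (forall g, u (e g) = v (e g)) -> forall x, u x = v x.
Proof.
move=> lu lv uv x; have [c ->] := A_basis x.
pose u' : {linear E a -> T} := HB.pack_for {linear E a -> T} u (GRing.isLinear.Build _ _ _ _ _ lu).
pose v' : {linear E a -> T} := HB.pack_for {linear E a -> T} v (GRing.isLinear.Build _ _ _ _ _ lv).
rewrite -[u _]/(u' _) -[v _]/(v' _) !linear_sum; apply: eq_bigr => g _.
by rewrite !linearZ /= uv.
Qed.

(** By faithfulness of the fibre functor, identities between morphisms of [S] are checked on
    vectors, and below on products of the basis vectors [e g]. *)
Lemma hom_ext X Y (f g : hom X Y) : S X -> S Y -> (forall x, ehom E f x = ehom E g x) -> f = g.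
Proof. by move=> sX sY fg; apply: (ehom_faithful equivE) => //; apply/lfunP. Qed.

Lemma hom_extA Y (f g : hom a Y) : S Y ->
  (forall k, ehom E f (e k) = ehom E g (e k)) -> f = g.
Proof. by move=> sY fg; apply: hom_ext => //; apply: A_ext => // b s t; rewrite linearP. Qed.

Lemma hom_ext1 Y (f g : hom (tunit C) Y) : S Y ->
  ehom E f (eone E) = ehom E g (eone E) -> f = g.
Proof.
move=> sY fg; apply: hom_ext => // x.
have : x \in <<[:: eone E]>>%VS by case/andP: (eone_basis equivE) => /eqP -> _; rewrite memvf.
by rewrite span_seq1 => /vlineP [b ->]; rewrite !linearZ /= fg.
Qed.

Lemma hom_extT X Y Z (f g : hom (X \ox Y) Z) : S X -> S Y -> S Z ->
  (forall x y, ehom E f (emul E x y) = ehom E g (emul E x y)) -> f = g.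
Proof.
move=> sX sY sZ fg; apply: hom_ext; auto.
by apply: (tensor_ext (emul_tensor equivE sX sY)) => // b s t; rewrite linearP.
Qed.

Lemma emul_linl X Y T (u : 'Hom(E (X \ox Y), T)) y : S X -> S Y -> linear (fun x => u (emul E x y)).
Proof.
move=> sX sY b s t; have [lx _ _] := emul_tensor equivE sX sY.
by rewrite lx linearP.
Qed.

Lemma emul_linr X Y T (u : 'Hom(E (X \ox Y), T)) x : S X -> S Y -> linear (fun y => u (emul E x y)).
Proof.
move=> sX sY b s t; have [_ ly _] := emul_tensor equivE sX sY.
by rewrite ly linearP.
Qed.

Lemma hom_extAA Z (f g : hom (a \ox a) Z) : S Z ->
  (forall h k, ehom E f (emul E (e h) (e k)) = ehom E g (emul E (e h) (e k))) -> f = g.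
Proof.
move=> sZ fg; apply: hom_extT => // x y.
move: x; apply: A_ext; [exact: emul_linl | exact: emul_linl |] => h.
by move: y; apply: A_ext; [exact: emul_linr | exact: emul_linr |] => k.
Qed.

Lemma hom_extAAA Z (f g : hom (a \ox a \ox a) Z) : S Z ->
  (forall h k l, ehom E f (emul E (emul E (e h) (e k)) (e l)) =
     ehom E g (emul E (emul E (e h) (e k)) (e l))) -> f = g.
Proof.
move=> sZ fg; apply: hom_extT; auto => w z.
move: z; apply: A_ext; [by apply: emul_linr; auto | by apply: emul_linr; auto |] => l.
move: w; apply: (tensor_ext (emul_tensor equivE SA SA)); [by apply: emul_linl; auto..|] => x y.
move: x; apply: A_ext.
- by move=> b s t; have [lx _ _] := emul_tensor equivE SA SA; rewrite lx emul_linl; auto.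
- by move=> b s t; have [lx _ _] := emul_tensor equivE SA SA; rewrite lx emul_linl; auto.
move=> h; move: y; apply: A_ext => //.
- by move=> b s t; have [_ lx _] := emul_tensor equivE SA SA; rewrite lx emul_linl; auto.
- by move=> b s t; have [_ lx _] := emul_tensor equivE SA SA; rewrite lx emul_linl; auto.
Qed.

Lemma mulE h k : ehom E (fmul A) (emul E (e h) (e k)) = (h == k)%:R *: e h.
Proof.
rewrite phi_mul -linearZ /=; congr (phi _); apply/ffunP => x; rewrite !ffunE /=.
rewrite [_ *: _]mulrC; case: (eqVneq x h) => [->|_]; last by rewrite !mul0r.
by rewrite mul1r.
Qed.

Lemma unitE : ehom E (funit A) (eone E) = \sum_g e g.
Proof.
rewrite phi_unit -linear_sum; congr (phi _); rewrite [LHS]delta_sum; apply: eq_bigr => g _.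
by rewrite ffunE scale1r.
Qed.

Lemma kronecker (T : lmodType F) (t : gT -> T) h : \sum_g (g == h)%:R *: t g = t h.
Proof.
rewrite (bigD1 h) //= eqxx scale1r big1 ?addr0 // => k /negbTE ->.
by rewrite scale0r.
Qed.

Lemma lunitVE X (x : E X) : S X -> ehom E (lunitV X) x = emul E (eone E) x.
Proof. by move=> sX; rewrite -{1}(eone_lunit equivE x) // -EC ?luK ?EI //; auto. Qed.

Lemma runitVE X (x : E X) : S X -> ehom E (runitV X) x = emul E x (eone E).
Proof. by move=> sX; rewrite -{1}(eone_runit equivE x) // -EC ?ruK ?EI //; auto. Qed.

Lemma assocVE X Y Z (x : E X) (y : E Y) (z : E Z) : S X -> S Y -> S Z ->
  ehom E (assocV X Y Z) (emul E x (emul E y z)) = emul E (emul E x y) z.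
Proof.
by move=> sX sY sZ; rewrite -(emul_assoc equivE) // -EC ?asK ?EI //; auto.
Qed.

Ltac ev := do 4 (rewrite ?EC ?EN ?EI ?mulE ?phi_comul ?phi_counit ?EZ
  ?linearZ ?emulZl ?emulZr ?scalerA ?(emul_assoc equivE) ?assocVE ?(emul_sym equivE)
  ?lunitVE ?runitVE ?(eone_lunit equivE) ?(eone_runit equivE) //=; auto 6); rewrite ?scalerA //; try (do ![rewrite scalerA]).

Lemma function_frobenius : comm_frobenius A.
Proof.
split.
- apply: hom_extAAA => // h k l; ev.
  by case: (eqVneq h k) => [->|_]; rewrite ?mul0r.
- apply: hom_extT => // x y; ev.
  have : x \in <<[:: eone E]>>%VS by case/andP: (eone_basis equivE) => /eqP -> _; rewrite memvf.
  rewrite span_seq1 => /vlineP [b ->]; ev; congr (_ *: _).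
  move: y; apply: A_ext; [exact: emul_linr | by [] | move=> k].
  by rewrite unitE emulDl // linear_sum /=; under eq_bigr => g _ do rewrite mulE; rewrite kronecker.
- apply: hom_extT => // x y; ev.
  have : y \in <<[:: eone E]>>%VS by case/andP: (eone_basis equivE) => /eqP -> _; rewrite memvf.
  rewrite span_seq1 => /vlineP [b ->]; ev; congr (_ *: _).
  move: x; apply: A_ext; [exact: emul_linl | by [] | move=> k].
  rewrite unitE emulDr // linear_sum /=; under eq_bigr => g _ do rewrite mulE eq_sym.
  by rewrite (bigD1 k) //= eqxx scale1r big1 ?addr0 // => g /negbTE ->; rewrite scale0r.
- by apply: hom_extA; auto => k; ev.
- by apply: hom_extA; auto => k; ev; rewrite mulfV ?card_nz // scale1r.
- by apply: hom_extA; auto => k; ev; rewrite mulfV ?card_nz // scale1r.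
- apply: hom_extAA; auto => h k; ev.
- apply: hom_extAA; auto => h k; ev.
  by case: (eqVneq h k) => [->|_]; rewrite ?mul0r ?mulr0 ?scale0r //; rewrite mulrC.
- apply: hom_extAA => // h k; ev.
  by rewrite eq_sym; case: eqVneq => [->|_] //; rewrite !scale0r.
- by apply: hom_extA; auto => k; ev.
- exact: symS.
Qed.

Lemma function_mulcomul : fmul A \oc fcomul A = n *: cid a.
Proof. by apply: hom_extA => // k; ev; rewrite eqxx mul1r. Qed.

Lemma function_counit_unit : fcounit A \oc funit A = cid (tunit C).
Proof.
apply: hom_ext1 => //; ev; rewrite unitE linear_sum /=.
under eq_bigr => g _ do rewrite phi_counit.
by rewrite sumr_const -scaler_nat cardE -cardT scalerA mulfV ?card_nz ?scale1r.
Qed.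

Definition translation (g : gT) (f : {ffun gT -> F^o}) : {ffun gT -> F^o} := [ffun x => f (x * g)%g].

Lemma rho_exists g : exists f : hom a a, forall h, ehom E f (e h) = e (h * g^-1)%g.
Proof.
have [psi phiK psiK] := bij_phi.
have lin : linear (fun x => phi (translation g (psi x))).
  move=> b s t; rewrite -linearP; congr (phi _).
  have -> : psi (b *: s + t) = b *: psi s + psi t.
    by apply: (can_inj phiK); apply: etrans (psiK _) _; rewrite linearP; congr (_ *: _ + _); apply: esym (psiK _).
  by apply/ffunP => x; rewrite !ffunE.
pose u : {linear E a -> E a} := HB.pack_for {linear E a -> E a} (fun x => phi (translation g (psi x)))
  (GRing.isLinear.Build _ _ _ _ _ lin).
have [|f fE] := ehom_full equivE (u := linfun u) SA SA.
  move=> k x; rewrite !lfunE /= -(psiK x) phi_act !phiK phi_act.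
  by congr (phi _); apply/ffunP => y; rewrite !ffunE mulgA.
exists f => h; rewrite -fE lfunE /= phiK; congr (phi _); apply/ffunP => y; rewrite !ffunE.
by rewrite -(inj_eq (mulIg g^-1%g)) mulgK.
Qed.

Definition rho g : hom a a := sval (boolp.cid (rho_exists g)).

Lemma rhoE g h : ehom E (rho g) (e h) = e (h * g^-1)%g.
Proof. by rewrite /rho; case: boolp.cid => f /= ->. Qed.

Lemma e_free (c : gT -> F) : \sum_g c g *: e g = 0 -> forall g, c g = 0.
Proof.
have [psi phiK _] := bij_phi.
pose f : {ffun gT -> F^o} := [ffun g => c g].
have -> : \sum_g c g *: e g = phi f.
  by rewrite [f]delta_sum linear_sum /=; apply: eq_bigr => g _; rewrite linearZ /= ffunE.
move=> f0 g; have : f = 0 by apply: (can_inj phiK); rewrite f0 linear0.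
by move/ffunP/(_ g); rewrite !ffunE.
Qed.

Lemma sum_e_nz : \sum_g e g != 0.
Proof.
apply/eqP => s0; have := e_free (c := fun=> 1); under eq_bigr do rewrite scale1r.
by move=> /(_ s0 1%g)/eqP; rewrite oner_eq0.
Qed.

Ltac ev' := do 2 (ev; rewrite ?rhoE).

(** By equivariance [f] is determined by [u], the image of the delta function at 1. Multiplicativity
    makes the left translates of [u] orthogonal idempotents, and preservation of the unit makes [u]
    nonzero. So [u] is the delta function at some [k], and [f] is translation by [k^-1]. *)
Lemma translation_aut f : AutA f -> exists g, f = rho g.
Proof.
move=> [fm fu]; have [psi phiK psiK] := bij_phi.
pose u := psi (ehom E f (e 1%g)).
have fe g : ehom E f (e g) = phi [ffun x => u (g^-1 * x)%g].
  have -> : e g = eact E a g (e 1%g).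
    rewrite phi_act; congr (phi _); apply/ffunP => x; rewrite !ffunE.
    by rewrite -(inj_eq (mulgI g^-1%g)) mulVg.
  by rewrite (ehom_equivariant equivE) // -(psiK (ehom _ _ _)) phi_act.
have ufe g h x : u (g^-1 * x)%g * u (h^-1 * x)%g = (g == h)%:R * u (g^-1 * x)%g.
  have := congr1 (fun s => ehom E s (emul E (e g) (e h))) fm.
  rewrite !EC ?EN ?mulE ?linearZ ?fe; auto.
  rewrite /= fe phi_mul -linearZ => /(can_inj phiK)/ffunP/(_ x).
  by rewrite !ffunE /= => <-.
have [k uk] : exists k, u k != 0.
  apply/boolp.not_existsP => u0; have : \sum_g ehom E f (e g) = 0.
    apply: big1 => g _; rewrite fe (_ : [ffun x => _] = 0) ?linear0 //.
    by apply/ffunP => x; rewrite !ffunE; apply/eqP/negPn/negP; apply: u0.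
  rewrite -linear_sum /= -unitE -EC // fu unitE => /eqP.
  by rewrite (negbTE sum_e_nz).
have u1 : u k = 1.
  by have := ufe 1%g 1%g k; rewrite eqxx invg1 mul1g => /(mulIf uk).
have ud : u = delta F k.
  apply/ffunP => l; rewrite ffunE; case: (eqVneq l k) => [->|lk] //.
  have := ufe 1%g (k * l^-1)%g k.
  rewrite invg1 mul1g invMg invgK mulgKV u1 mul1r mulr1 => ->.
  case: eqP => // e1; case/eqP: lk; move: (congr1 (mulg^~ l) e1); by rewrite mulgKV mul1g.
exists (k^-1%g); apply: hom_extA => // g; rewrite rhoE fe invgK ud; congr (phi _).
by apply/ffunP => x; rewrite !ffunE -(inj_eq (mulgI g)) mulKVg.
Qed.

Lemma function_galois_algebra : galois_algebra rho.
Proof.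
split.
- exact: function_frobenius.
- exact: twS SA.
- exact: function_mulcomul.
- exact: function_counit_unit.
- move=> g; apply: hom_extAA => // h k; ev'.
  by rewrite (inj_eq (mulIg _)).
- move=> g; apply: hom_ext1 => //; ev; rewrite unitE linear_sum /=.
  under eq_bigr => h _ do rewrite rhoE.
  by rewrite [RHS](reindex_inj (mulIg g^-1%g)).
- by move=> g; apply: hom_extA; auto => h; ev'.
- by move=> g; apply: hom_extA => // h; ev'.
- by move=> g; apply: hom_extA => // h; ev'; rewrite invgK mulgKV.
- by apply: hom_extA => // h; ev'; rewrite invg1 mulg1.
- apply: hom_extA => // h; rewrite ES // EZ // EC // phi_counit linearZ /= unitE scalerA mulfV ?card_nz // scale1r.
  under eq_bigr => g _ do rewrite rhoE.
  by rewrite [RHS](reindex_inj (mulgI h)) [RHS](reindex_inj invg_inj).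
- apply: hom_extAA; auto => h k; rewrite ES; auto.
  (* The regular action is simply transitive: exactly one translation carries [h] to [k], that of
     [g = k^-1 * h]. *)
  transitivity (\sum_g (g == k^-1 * h)%g%:R *: (n *: emul E (e (k * g)%g) (e k))).
    apply: eq_bigr => g _; ev'.
    rewrite invgK mulgKV mulrC.
    have -> : ((h * g^-1)%g == k) = (g == (k^-1 * h)%g).
      by apply/eqP/eqP => [<-|->]; rewrite invMg invgK ?mulgKV // mulKVg.
    by case: eqP => [->|_]; rewrite ?mul0r ?scale0r // invMg invgK !mulKVg.
  by rewrite kronecker mulKVg; ev.
- exact: translation_aut.
- move=> c c0 g; have := congr1 (fun s => ehom E s (e 1%g)) c0.
  rewrite ES // -(scale0r (cid a)) EZ // scale0r.
  under eq_bigr => h _ do rewrite EZ // rhoE mul1g.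
  rewrite (reindex_inj invg_inj) /= => s0.
  have := @e_free (fun g => c g^-1%g) _ g^-1%g; rewrite invgK; apply.
  by rewrite -[RHS]s0; apply: eq_bigr => h _; rewrite invgK.
(* A function invariant under left translation is constant. *)
- move=> f; have [psi phiK psiK] := bij_phi.
  pose u := psi (ehom E f (eone E)).
  have uc g : u g = u 1%g.
    have := eone_equivariant equivE g => /(congr1 (ehom E f)).
    rewrite (ehom_equivariant equivE) // -(psiK (ehom E f _)) phi_act => /(can_inj phiK)/ffunP/(_ g).
    by rewrite ffunE mulVg => ->.
  exists (u 1%g); apply: hom_ext1 => //; ev.
  rewrite phi_unit -linearZ -(psiK (ehom E f _)); congr (phi _); apply/ffunP => g.
  by rewrite !ffunE uc; apply/esym/mulr1.
(* An invariant functional has the same value on all delta functions; the factor [n] undoes the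
   value [n^-1] of the counit there. *)
- move=> f.
  have [b fb] : exists b, ehom E f (e 1%g) = b *: eone E.
    have : ehom E f (e 1%g) \in <<[:: eone E]>>%VS by case/andP: (eone_basis equivE) => /eqP -> _; rewrite memvf.
    by rewrite span_seq1 => /vlineP [b ->]; exists b.
  exists (b * n); apply: hom_extA => // g; rewrite EZ // phi_counit scalerA mulfK ?card_nz //.
  have -> : e g = eact E a g (e 1%g).
    rewrite phi_act; congr (phi _); apply/ffunP => x; rewrite !ffunE.
    by rewrite -(inj_eq (mulgI g^-1%g)) mulVg.
  by rewrite (ehom_equivariant equivE) // fb linearZ /= (eone_equivariant equivE).
Qed.

End FunctionAlgebra.

(** * Grading *)

Section Sectors.
Variables (F : closedFieldType) (charF0 : [pchar F] =i pred0) (C : ribbonData F).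
Context {rC : ribbon C}.
Variables (A : frobenius C) (gT : finGroupType) (rho : gT -> hom (A : C) A).
Hypothesis gaA : galois_algebra rho.
Let frA := ga_frobenius gaA.
Local Notation a := (A : C).
Local Notation n := (#|gT|%:R : F).
Local Notation "t \hc s" := (hat_comp (A := A) t s) (at level 45, left associativity).
Local Notation h := (hat A).
Implicit Types (X Y Z T : C) (g : gT).

Let order_nz : n != 0 := card_nz charF0 gT.

(** The comodule map between cofree comodules of [A] that corresponds to [s]. It turns [\hc] into
    composition in C, and by the Frobenius property it is also a module map. *)
Definition induced X Y (s : hom (a \ox X) Y) : hom (a \ox X) (a \ox Y) :=
  (cid a \om s) \oc assoc a a X \oc (fcomul A \om cid X).

Lemma induced_comp X Y Z (t : hom (a \ox Y) Z) (s : hom (a \ox X) Y) :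
  induced (t \hc s) = induced t \oc induced s.
Proof.
rewrite /induced /hat_comp; diag.
early (fcomul A).
by drw (fcomulA frA).
Qed.

Lemma induced_hat X Y (f : hom X Y) : induced (h f) = cid a \om f.
Proof.
rewrite /induced /hat; diag.
early1 (fcounit A).
by drw (fcomul1r frA).
Qed.

Lemma inducedK X Y (s : hom (a \ox X) Y) : lunit Y \oc (fcounit A \om cid Y) \oc induced s = s.
Proof.
rewrite /induced; diag.
early (fcounit A).
by drw (fcomul1l frA).
Qed.

Lemma induced_comul X Y (s : hom (a \ox X) Y) :
  assoc a a Y \oc (fcomul A \om cid Y) \oc induced s =
  (cid a \om induced s) \oc assoc a a X \oc (fcomul A \om cid X).
Proof.
rewrite /induced; diag.
early (fcomul A).
by drw (fcomulA frA).
Qed.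

Lemma induced_mul X Y (s : hom (a \ox X) Y) :
  induced s \oc (fmul A \om cid X) =
  (fmul A \om cid Y) \oc assocV a a Y \oc (cid a \om induced s) \oc assoc a a X.
Proof.
rewrite /induced; diag.
dwr (ffrobr frA).
by early (fmul A).
Qed.

(** Makes a morphism of the extension out of an arbitrary [k]. Under [induced] it becomes
    multiplication after [k] after comultiplication; the factor [n^-1] is the inverse of
    [fmul A \oc fcomul A], so that induced morphisms are kept. *)
Definition average X Y (k : hom (a \ox X) (a \ox Y)) : hom (a \ox X) Y :=
  n^-1 *: (lunit Y \oc ((fcounit A \oc fmul A) \om cid Y) \oc assocV a a Y \oc (cid a \om k) \oc
    assoc a a X \oc (fcomul A \om cid X)).

Lemma induced_average X Y (k : hom (a \ox X) (a \ox Y)) :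
  induced (average k) = n^-1 *: ((fmul A \om cid Y) \oc assocV a a Y \oc (cid a \om k) \oc
    assoc a a X \oc (fcomul A \om cid X)).
Proof.
rewrite /induced /average omZr !ocZl; congr (_ *: _); diag.
dwr (fcomulA frA).
late (fcomul A).
drw (ffrobl frA).
by drw (fcomul1r frA).
Qed.

(** Averaging commutes with composition by induced morphisms on either side, and fixes the induced
    ones; so the average of a quasi-inverse of [induced f] is a quasi-inverse of [f]. *)
Lemma induced_regular X Y (f : hom (a \ox X) Y) (k : hom (a \ox Y) (a \ox X)) :
  induced f \oc k \oc induced f = induced f -> f \hc average k \hc f = f.
Proof.
move=> fkf; rewrite -[LHS]inducedK -[RHS]inducedK; congr (_ \oc _).
rewrite !induced_comp induced_average ocZr ocZl.
have -> : induced f \oc ((fmul A \om cid X) \oc assocV a a X \oc (cid a \om k) \oc assoc a a Y \oc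
    (fcomul A \om cid Y)) \oc induced f =
   (fmul A \om cid Y) \oc assocV a a Y \oc (cid a \om (induced f \oc k \oc induced f)) \oc assoc a a X \oc
    (fcomul A \om cid X).
  have M := induced_mul f; have D := induced_comul f.
  move: (induced f) M D => L M D; diag.
  drw M.
  by drw D.
rewrite fkf.
have -> : (fmul A \om cid Y) \oc assocV a a Y \oc (cid a \om induced f) \oc assoc a a X \oc
    (fcomul A \om cid X) = induced f \oc ((fmul A \oc fcomul A) \om cid X).
  have M := induced_mul f; move: (induced f) M => L M; diag.
  by drw M.
by rewrite (ga_mulcomul gaA) omZl om1 ocZr cidr scalerA mulVf ?order_nz // scale1r.
Qed.

Lemma rtimes0_regular : regular_homs C -> regular_homs (rtimes0 A).
Proof.
move=> regC X Y f; have [k fkf] := regC _ _ (induced (f : hom (a \ox (X : C)) Y)).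
by exists (average k); apply: induced_regular.
Qed.

Definition ring X : hom (a \ox X) (a \ox X) := braid X a \oc braid a X.

(* The projection of [X] onto its part of grade [rho g]. *)
Definition sector g X : hom (a \ox X) X := average ((rho g \om cid X) \oc ring X).

Lemma ring_mul X (f : hom a a) : ring X \oc (f \om cid X) = (f \om cid X) \oc ring X.
Proof.
rewrite /ring; diag.
drw (br_nat f (cid X)).
by drw (br_nat (cid X) f).
Qed.

(** By [ga_sum] the translations add up to a multiple of [funit A \oc fcounit A], and the counit, by
    naturality, undoes the ring in front of it. *)
Lemma sector_sum X : \sum_g sector g X = h (cid X).
Proof.
rewrite /sector /average -scaler_sumr.
have -> : \sum_g (lunit X \oc ((fcounit A \oc fmul A) \om cid X) \oc assocV a a X \oc
     (cid a \om ((rho g \om cid X) \oc ring X)) \oc assoc a a X \oc (fcomul A \om cid X)) =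
   lunit X \oc ((fcounit A \oc fmul A) \om cid X) \oc assocV a a X \oc
     (cid a \om (((\sum_g rho g) \om cid X) \oc ring X)) \oc assoc a a X \oc (fcomul A \om cid X).
  rewrite om_suml oc_suml om_sumr oc_sumr !oc_suml; exact: eq_bigr.
rewrite (ga_sum gaA) omZl ocZl omZr !(ocZl, ocZr) scalerA mulVf ?order_nz // scale1r.
rewrite /ring /h; diag.
drw (fmul1r frA).
dwr1 (br_nat (cid X) (fcounit A)).
dwr1 (br_nat (fcounit A) (cid X)).
by drw (fcomul1r frA).
Qed.

(** The ring passes through [s] by naturality, and cocommutativity exchanges the strands of [A]
    feeding [s] and the ring. *)
Lemma sector_nat g X Y (s : hom (a \ox X) Y) : s \hc sector g X = sector g Y \hc s.
Proof.
rewrite /sector /average /hat_comp omZr !(ocZl, ocZr); congr (_ *: _); rewrite /ring; diag.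
early (fcomul A).
drw1 (br_nat (cid a) s).
drw1 (br_nat s (cid a)).
drw (fcomulA frA).
drw1 (fcomulC frA).
dwrR (fcomulA frA).
dwrR (fcomulC frA).
drw (fcomulA frA).
late (braid a a).
early1 (rho g); early (fmul A); early (fcounit A).
by dwr (br_nat (cid a) (fcounit A \oc fmul A \oc (cid a \om rho g))).
Qed.

Lemma mul_pairing : fmul A = runit a \oc (cid a \om (fcounit A \oc fmul A)) \oc assoc a a a \oc
  (braid a a \om cid a) \oc assocV a a a \oc (cid a \om fcomul A).
Proof.
diag.
dwrL (fmulC frA).
dwrR1 (fmulC frA).
drwR (br_nat (cid a) (fcomul A)).
drw (ffrobl frA).
by drw (fcomul1r frA).
Qed.

(** A translation preserves product and counit, so it is orthogonal for the pairing and its adjoint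
    is its inverse. *)
Lemma pairing_rho g : (fcounit A \oc fmul A) \oc (rho g^-1%g \om cid a) =
  (fcounit A \oc fmul A) \oc (cid a \om rho g).
Proof.
rewrite -{1}(ga_counit gaA g) -[fcounit A \oc rho g \oc _]ocA (ga_mul gaA); diag.
have := ga_inv gaA g^-1%g; rewrite invgK => e.
early (rho g).
by drw e.
Qed.

Lemma ring_comul X :
  (braid a a \om cid X) \oc assocV a a X \oc (cid a \om ring X) \oc assoc a a X \oc
    (braid a a \om cid X) \oc assocV a a X \oc (cid a \om ring X) \oc assoc a a X \oc
    (fcomul A \om cid X) = (fcomul A \om cid X) \oc ring X.
Proof.
rewrite /ring; diag.
drwL (br_nat (cid a) (braid X a)).
drw (br_nat (cid X) (braid a a)).
drw (fbraid2 frA).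
dwr (br_nat (cid X) (fcomul A)).
by dwr (br_nat (fcomul A) (cid X)).
Qed.

(* Since [A] is commutative, the two rings of [A] around [X] fuse into one along the
   coproduct ([ring_comul]), and [pairing_rho] extracts [rho g^-1]. *)
Lemma ring_induced_sector g X :
  ring X \oc induced (sector g X) = (rho g^-1%g \om cid X) \oc induced (sector g X).
Proof.
have key : ring X \oc induced (sector g X) = n^-1 *: ((fmul A \om cid X) \oc assocV a a X \oc
    (rho g^-1%g \om ring X) \oc assoc a a X \oc (fcomul A \om cid X)).
  rewrite {1}/induced /sector /average omZr !(ocZl, ocZr); congr (_ *: _).
  have RR := ring_comul X.
  rewrite [in RHS]mul_pairing; move: RR; rewrite /ring => RR; diag.
  drwL (br_nat (cid a) (lunit X \oc ((fcounit A \oc fmul A \oc (cid a \om rho g)) \om cid X))).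
  drwL (br_nat (lunit X \oc ((fcounit A \oc fmul A \oc (cid a \om rho g)) \om cid X)) (cid a)).
  early (braid a a).
  dwrL (fcomulA frA).
  drwL (fcomulC frA).
  drwL (fcomulA frA).
  drw1 RR.
  late (rho g^-1%g).
  drwR (br_nat (rho g^-1%g) (cid a)).
  by drwR1 (pairing_rho g).
rewrite key /sector induced_average ocZr; congr (_ *: _); rewrite /ring; diag.
drw (ga_mul gaA g^-1%g).
by drw1 (ga_inv gaA g).
Qed.

(** The previous lemma, at the neutral element, gives this on [induced s] only. By [ga_resolution],
    [cid a \om s] is a combination of the [induced s] followed by translations of [A], and these
    commute with the ring. *)
Lemma ring_sector1 X (s := sector 1%g X) : ring X \oc (cid a \om s) = cid a \om s.
Proof.
have res : n *: (cid a \om s) = \sum_g ((rho g^-1%g \om cid X) \oc induced s \oc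
    (fmul A \om cid X) \oc (rho g \om cid a \om cid X) \oc assocV a a X).
  have -> : n *: (cid a \om s) =
      (cid a \om s) \oc assoc a a X \oc ((n *: cid (a \ox a)) \om cid X) \oc assocV a a X.
    by rewrite omZl om1 !(ocZr, ocZl) cidr -ocA asVK cidr.
  rewrite -(ga_resolution gaA) om_suml !(oc_sumr, oc_suml).
  by apply: eq_bigr => g _; rewrite /induced; diag; early (rho g^-1%g).
have rs g : ring X \oc ((rho g^-1%g \om cid X) \oc induced s) = (rho g^-1%g \om cid X) \oc induced s.
  by rewrite ocA ring_mul -ocA ring_induced_sector invg1 (ga_one gaA) om1 cidl.
apply: (scalerI order_nz); rewrite -ocZr res oc_sumr; apply: eq_bigr => g _.
move: rs; move: (induced s) => L rs; by rewrite !ocA -[ring X \oc _ \oc _]ocA rs.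
Qed.

Lemma sector1_central X : central (sector 1%g X).
Proof. exact: ring_sector1. Qed.

Definition pairing := fcounit A \oc fmul A.
Definition copairing := fcomul A \oc funit A.

Lemma snake_l : lunit a \oc (pairing \om cid a) \oc assocV a a a \oc (cid a \om copairing) \oc runitV a = cid a.
Proof.
rewrite /pairing /copairing; diag.
drw (ffrobr frA).
drw (fcomul1l frA).
by drw (fmul1r frA).
Qed.

Lemma snake_r : runit a \oc (cid a \om pairing) \oc assoc a a a \oc (copairing \om cid a) \oc lunitV a = cid a.
Proof.
rewrite /pairing /copairing; diag.
drw (ffrobl frA).
drw (fcomul1r frA).
by drw (fmul1l frA).
Qed.

Lemma pairingC : pairing \oc braid a a = pairing.
Proof. by rewrite /pairing -ocA (fmulC frA). Qed.
Lemma copairingC : braid a a \oc copairing = copairing.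
Proof. by rewrite /copairing ocA (fcomulC frA). Qed.

(* The left partial trace over [A]. *)
Definition close X Y (f : hom (a \ox X) (a \ox Y)) : hom X Y :=
  lunit Y \oc (pairing \om cid Y) \oc assocV a a Y \oc (cid a \om f) \oc assoc a a X \oc
    (copairing \om cid X) \oc lunitV X.

(** Conjugation with the braiding turns the left closure into a right partial trace. There [A] may
    serve as its own dual through the symmetric [pairing], its twist being trivial. *)
Lemma trace_close X (f : hom (a \ox X) (a \ox X)) : trace (close f) = trace f.
Proof.
have -> : trace f = trace (braid a X \oc f \oc braidV a X).
  by rewrite -ocA traceC -ocA brK cidr.
rewrite trace_ptr /ptr (other_ptr snake_r) (ga_twist gaA) om1 cidr pairingC.
congr trace; rewrite /close; diag.
dwrR (br_nat copairing (cid X)).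
drw (brK a X).
dwrR copairingC.
dwr (br_nat (cid a) f).
dwr (br_nat pairing (cid X)).
by drw pairingC.
Qed.

(* Evaluation of a morphism of the extension at the unit of [A]. *)
Definition at1 X Y (s : hom (a \ox X) Y) : hom X Y := s \oc (funit A \om cid X) \oc lunitV X.

Definition trh X (s : hom (a \ox X) X) : F := trace (at1 s).

Lemma trhZ X b (s : hom (a \ox X) X) : trh (b *: s) = b * trh s.
Proof. by rewrite /trh -traceZ /at1 !ocZl. Qed.

Definition flat X Y (s : hom (a \ox X) Y) : hom X (a \ox Y) :=
  (cid a \om s) \oc assoc a a X \oc (copairing \om cid X) \oc lunitV X.

Lemma at1_comp X Y Z (t : hom (a \ox Y) Z) (s : hom (a \ox X) Y) : at1 (t \hc s) = t \oc flat s.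
Proof. by rewrite /at1 /hat_comp /flat /copairing; diag. Qed.

Lemma trhC X Y (t : hom (a \ox Y) X) (s : hom (a \ox X) Y) : trh (t \hc s) = trh (s \hc t).
Proof.
rewrite /trh !at1_comp traceC -trace_close; congr trace; rewrite /close /flat; diag.
early pairing.
by drw snake_l.
Qed.

Hypothesis decC : forall X, exists n (Y : 'I_n -> C), (forall k, simple (Y k)) /\ direct_sum X Y.
Hypothesis schurC : forall X Y (f : hom X Y), simple X -> simple Y -> ~ iso X Y -> f = 0.
Hypothesis dim_nz : forall X, simple X -> dim X != 0.

(** On a simple [Z] through which [p] is invertible, C supplies [k] with [k \oc p] of trace [dim Z].
    Turning the outgoing strand of [A] around with the pairing makes [k] a morphism of the
    extension, with the same trace by [trace_close]. *)
Lemma trh_nondegenerate X Y (p : hom (a \ox X) Y) : p != 0 ->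
  exists s : hom (a \ox Y) X, trh (s \hc p) != 0.
Proof.
move=> p0; have [Z [i [r [sZ rpi]]]] := simple_between decC schurC p0.
pose k := i \oc r.
exists (lunit X \oc (pairing \om cid X) \oc assocV a a X \oc (cid a \om k)).
have e : trace (k \oc p) = dim Z by rewrite /k -ocA traceC rpi.
rewrite /trh at1_comp; have <- : close (k \oc p) =
   lunit X \oc (pairing \om cid X) \oc assocV a a X \oc (cid a \om k) \oc flat p.
  by rewrite /close /flat; diag.
by rewrite trace_close e dim_nz.
Qed.

(** Closing the strand [X] leaves a morphism from [A] to the unit, necessarily a multiple of the
    counit. *)
Lemma ptr_induced X (p : hom (a \ox X) X) : ptr (induced p) = trh p *: cid a.
Proof.
pose t := epsbar X \oc (p \om cid (dual X)) \oc assocV a X (dual X) \oc (cid a \om coev X) \oc runitV a.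
have -> : ptr (induced p) = runit a \oc (cid a \om t) \oc fcomul A.
  by rewrite /ptr /induced /t; diag; early (fcomul A).
have [b tb] := ga_hom1r gaA t.
have -> : trh p = b.
  apply: scal_uniq; transitivity (t \oc funit A); first by rewrite /t /at1; diag; early (funit A).
  by rewrite tb ocZl (ga_counit_unit gaA).
rewrite tb omZr ocZr ocZl; congr (_ *: _).
by rewrite -ocA (fcomul1r frA) ruVK.
Qed.

(** Evaluated at the unit of [A], the sector of 1 is a scalar [b] on [Y], and the S-matrix entry is
    [n * b * dim Y]. If [b] is nonzero it can be cancelled from [ring_sector1] evaluated at the
    unit. *)
Lemma ring_trivial Y : simple Y -> sm a Y != 0 -> ring Y = cid (a \ox Y).
Proof.
move=> sY; have [b eb] := sY.1 (at1 (sector 1%g Y)).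
have at1E : at1 (sector 1%g Y) = n^-1 *: close (ring Y).
  rewrite /at1 /sector /average (ga_one gaA) om1 cidl !ocZl; congr (_ *: _).
  by rewrite /close /pairing /copairing; diag.
have -> : sm a Y = n * b * dim Y.
  rewrite /sm /mon om1 cidr -/(ring Y) -trace_close.
  have -> : close (ring Y) = n *: at1 (sector 1%g Y) by rewrite at1E scalerA mulfV ?order_nz // scale1r.
  by rewrite eb scalerA traceZ.
rewrite !mulf_eq0 !negb_or => /andP[/andP[_ b0] _].
have := congr1 (fun f => f \oc (cid a \om ((funit A \om cid Y) \oc lunitV Y))) (ring_sector1 Y).
rewrite -!ocA -!omC !cidl !ocA -/(at1 _) eb omZr om1 ocZr cidr => /(scalerI b0).
by [].
Qed.

Definition ringV X : hom (a \ox X) (a \ox X) := braidV a X \oc braidV X a.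

Lemma ringK X : ringV X \oc ring X = cid (a \ox X).
Proof. by rewrite /ringV /ring !ocA -[_ \oc braidV X a \oc _]ocA brK cidr brK. Qed.

Lemma rdimE X (p : hom (a \ox X) X) : rdim (Tagged (fun X => hom (a \ox X) X) p : rtimes A) = trh p.
Proof. by rewrite /rdim /trh /trace /at1 /=; congr scal; diag; early (funit A). Qed.

Lemma gradeE X (p : hom (a \ox X) X) : grade (Tagged (fun X => hom (a \ox X) X) p : rtimes A) =
  (trh p)^-1 *: ptr (ringV X \oc induced p).
Proof.
rewrite /grade rdimE /=; congr (_ *: _); rewrite /ptr /induced /ringV; diag.
by [].
Qed.

(** The ring acts by [rho g^-1] on this sector; the grade is defined through the inverse ring, hence
    is [rho g]. *)
Lemma grade_sector g X (p : hom (a \ox X) X) (c : F) :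
  c != 0 -> trh p != 0 -> sector g X \hc p = c *: p ->
  grade (Tagged (fun X => hom (a \ox X) X) p : rtimes A) = rho g.
Proof.
move=> c0 t0 sp.
have inducedZ (s : hom (a \ox X) X) : induced (c *: s) = c *: induced s.
  by rewrite /induced omZr !ocZl.
have rp : ring X \oc induced p = (rho g^-1%g \om cid X) \oc induced p.
  apply: (scalerI c0); rewrite -[LHS]ocZr -[RHS]ocZr -inducedZ -sp induced_comp.
  by rewrite [LHS]ocA ring_induced_sector -!ocA.
have rpV : ringV X \oc induced p = (rho g \om cid X) \oc induced p.
  have e : induced p = (rho g \om cid X) \oc (ring X \oc induced p).
    have := ga_inv gaA g^-1%g; rewrite invgK => inv.
    by rewrite rp ocA -omC inv cidl om1 cidl.
  by rewrite {1}e [_ \oc (ring X \oc _)]ocA -ring_mul -[ring X \oc _ \oc _]ocA [LHS]ocA ringK cidl.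
rewrite gradeE rpV ptr_comp ptr_induced ocZr cidr scalerA mulVf //.
by rewrite scale1r.
Qed.

Lemma grade_central X (p : hom (a \ox X) X) : central p -> trh p != 0 ->
  grade (Tagged (fun X => hom (a \ox X) X) p : rtimes A) = cid a.
Proof.
move=> cp t0.
have rp : ring X \oc induced p = induced p.
  rewrite /induced -[_ \oc assoc a a X \oc _]ocA ocA; congr (_ \oc _); exact: cp.
rewrite gradeE -{1}rp ocA ringK cidl ptr_induced scalerA mulVf //.
by rewrite scale1r.
Qed.

Lemma hat_compZr X Y Z b (t : hom (a \ox Y) Z) (s : hom (a \ox X) Y) :
  t \hc (b *: s) = b *: (t \hc s).
Proof. by rewrite /hat_comp omZr ocZr !ocZl. Qed.

Lemma hat_comp_suml X Y Z (I : finType) (t : I -> hom (a \ox Y) Z) (s : hom (a \ox X) Y) :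
  (\sum_i t i) \hc s = \sum_i (t i \hc s).
Proof. by rewrite /hat_comp !oc_suml. Qed.

Section SimpleIdempotent.
Variables (X : C) (p : hom (a \ox X) X).
Hypotheses (pp : p \hc p = p) (p0 : p != 0).
Hypothesis simp : forall f : hom (a \ox X) X, p \hc f \hc p = f -> exists b, f = b *: p.

(** Some [s] has [trh (s \hc p)] nonzero; by cyclicity this is the trace of [p \hc s \hc p], a
    multiple of [p]. *)
Lemma trh_simple : trh p != 0.
Proof.
have [s ts] := trh_nondegenerate p0.
have [|b e] := simp (f := p \hc s \hc p).
  by rewrite !(hat_compA frA) pp -!(hat_compA frA) pp.
apply: contraNneq ts => t0.
by rewrite -pp (hat_compA frA) trhC (hat_compA frA) e trhZ t0 mulr0.
Qed.

Lemma simple_sector : exists g c, c != 0 /\ sector g X \hc p = c *: p.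
Proof.
have comm g : sector g X \hc p = p \hc sector g X by rewrite sector_nat.
have /boolp.choice [c cP] g : exists c, sector g X \hc p = c *: p.
  apply: simp; rewrite comm (hat_compA frA) pp -comm.
  by rewrite -(hat_compA frA) pp.
have : \sum_g (sector g X \hc p) != 0.
  by rewrite -hat_comp_suml sector_sum (hat_comp_hatl frA) cidl.
move=> s0; have [g cg] : exists g, c g != 0.
  apply/boolp.not_existsP => all; case/eqP: s0; apply: big1 => g _.
  by rewrite cP; have /negP := all g; rewrite negbK => /eqP ->; rewrite scale0r.
by exists g, (c g).
Qed.

Lemma simple_grade g : sector g X \hc p != 0 ->
  grade (Tagged (fun X => hom (a \ox X) X) p : rtimes A) = rho g.
Proof.
move=> sp; have comm : sector g X \hc p = p \hc sector g X by rewrite sector_nat.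
have [c ec] : exists c, sector g X \hc p = c *: p.
  apply: simp; rewrite comm (hat_compA frA) pp -comm.
  by rewrite -(hat_compA frA) pp.
have c0 : c != 0 by apply: contraNneq sp => c0; rewrite ec c0 scale0r.
exact: grade_sector c0 trh_simple ec.
Qed.

Lemma rho_inj g g' : rho g = rho g' -> g = g'.
Proof.
move=> e; apply/eqP; apply: contraT => ne.
suff s0 : \sum_k ((k == g)%:R - (k == g')%:R) *: rho k = 0.
  have := ga_free gaA s0 g; rewrite eqxx (negbTE ne) subr0 => /eqP.
  by rewrite oner_eq0.
under eq_bigr do rewrite scalerBl.
rewrite sumrB (bigD1 g) //= eqxx scale1r big1 ?addr0 => [|k /negbTE ->]; last by rewrite scale0r.
rewrite (bigD1 g') //= eqxx scale1r big1 ?addr0 => [|k /negbTE ->]; last by rewrite scale0r.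
by rewrite e subrr.
Qed.

Lemma simple_central : grade (Tagged (fun X => hom (a \ox X) X) p : rtimes A) = cid a -> central p.
Proof.
have [g [c [c0 ec]]] := simple_sector.
rewrite (simple_grade (g := g)) ?ec ?scaler_eq0 ?negb_or ?c0 //.
rewrite -(ga_one gaA) => /rho_inj g1.
have -> : p = sector 1%g X \hc (c^-1 *: p).
  by rewrite -g1 hat_compZr ec scalerA mulVf // scale1r.
by apply: central_hcompl; apply: sector1_central.
Qed.

End SimpleIdempotent.
End Sectors.

(** * Encircling the algebra: nonzero sectors and transparent objects *)

Section ModularExtension.
Variables (F : closedFieldType) (charF0 : [pchar F] =i pred0) (C : ribbonData F).
Context {rC : ribbon C}.
Variables (A : frobenius C) (gT : finGroupType) (rho : gT -> hom (A : C) A).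
Hypothesis gaA : galois_algebra rho.
Let frA := ga_frobenius gaA.
Local Notation a := (A : C).
Local Notation n := (#|gT|%:R : F).
Local Notation "t \hc s" := (hat_comp (A := A) t s) (at level 45, left associativity).
Local Notation h := (hat A).
Implicit Types (X Y Z T : C) (g : gT).
Hypothesis decC : forall X, exists n (Y : 'I_n -> C), (forall k, simple (Y k)) /\ direct_sum X Y.
Hypothesis schurC : forall X Y (f : hom X Y), simple X -> simple Y -> ~ iso X Y -> f = 0.
Variables (m : nat) (S : 'I_m -> C).
Hypothesis simpS : simple_classes [set: C]%classic S.
Hypothesis unitS : Smatrix S \in unitmx.

Let dim_nz : forall X, simple X -> dim X != 0 := modular_dim_nz simpS unitS.
Let S_simple k : simple (S k). Proof. by have [/(_ k) []] := simpS. Qed.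
Let D0 : gdim S != 0 := gdim_nz charF0 decC schurC dim_nz simpS.

(** Morphisms between [A] and the unit are unique up to scalars, so [omega S a] is a multiple of
    [funit A \oc fcounit A]; naturality at [funit A] identifies the scalar. *)
Lemma omega_algebra : omega S a = gdim S *: (funit A \oc fcounit A).
Proof.
have [q [i [p e]]] := omega_factor decC schurC simpS unitS a.
have [b eb] : exists b, \sum_k (i k \oc p k) = b *: (funit A \oc fcounit A).
  have /boolp.choice [b bP] k : exists b, i k \oc p k = b *: (funit A \oc fcounit A).
    have [c ->] := ga_hom1l gaA (i k); have [d ->] := ga_hom1r gaA (p k).
    by exists (c * d); rewrite ocZl ocZr scalerA.
  by exists (\sum_k b k); rewrite scaler_suml; apply: eq_bigr.
have := @omega_nat F C rC m S _ _ (funit A); rewrite (omega_unit simpS unitS (iso_refl (tunit C))).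
rewrite e eb !(ocZl, ocZr) cidr -ocA (ga_counit_unit gaA) cidr => /(scalerI D0) b1.
suff -> : b = 1 by rewrite scale1r.
have e1 : b *: cid (tunit C) = 1 *: cid (tunit C).
  by rewrite scale1r -(ga_counit_unit gaA) -ocZr b1.
by rewrite -(scal_uniq (f := b *: cid _) erefl) e1; apply: scal_uniq.
Qed.

Lemma encu_sectors Y : encu (cid Y) a = \sum_g trh (sector rho g Y) *: rho g^-1%g.
Proof.
have ringE : ring A Y = \sum_g ((rho g^-1%g \om cid Y) \oc induced (sector rho g Y)).
  rewrite -[LHS]cidr -om1 -(induced_hat gaA) -(sector_sum charF0 gaA).
  rewrite /induced om_sumr !oc_suml oc_sumr; apply: eq_bigr => g _.
  exact: (ring_induced_sector gaA).
rewrite /encu om1 cidr -/(ring A Y) ringE.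
have -> : ptr (\sum_g ((rho g^-1%g \om cid Y) \oc induced (sector rho g Y))) =
  \sum_g ptr ((rho g^-1%g \om cid Y) \oc induced (sector rho g Y)).
  by rewrite /ptr om_suml !(oc_sumr, oc_suml).
by apply: eq_bigr => g _; rewrite ptr_comp (ptr_induced gaA) ocZr cidr.
Qed.

Lemma sector_inhabited g : exists k, sector rho g (S k) != 0.
Proof.
apply/boolp.not_existsP => all.
have z k : sector rho g (S k) = 0 by apply/eqP/negPn/negP/all.
(* Both expressions for [omega S a] are expanded in the [rho k]: the sector of [k^-1] contributes to
   [rho k], and by [ga_sum] each [rho k] has coefficient [n^-1] in [funit A \oc fcounit A]. *)
have : \sum_k ((\sum_i dim (S i) * trh (sector rho k^-1%g (S i))) - gdim S / n) *: rho k = 0.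
  under eq_bigr => k _ do rewrite scalerBl scaler_suml.
  rewrite sumrB exchange_big /= -scaler_sumr (ga_sum gaA) scalerA divfK; last exact: card_nz.
  rewrite -omega_algebra /omega -sumrB big1 // => i _.
  rewrite encu_sectors scaler_sumr (reindex_inj invg_inj) /= -sumrB big1 // => k _.
  by rewrite invgK scalerA subrr.
move/(ga_free gaA)/(_ g^-1%g)/eqP; rewrite big1 ?sub0r; last first.
  by move=> i _; rewrite invgK z /trh /at1 !oc0l trace0 mulr0.
by rewrite oppr_eq0 mulf_eq0 invr_eq0 (negbTE D0) (negbTE (card_nz charF0 gT)).
Qed.

(** Relates the value of [p] at the unit of [A] to [p] itself: up to [n], it is the sum of the
    conjugates of [induced p] by translations. *)
Lemma induced_resolution X (p : hom (a \ox X) X) : n *: (cid a \om at1 p) =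
  \sum_g ((rho g^-1%g \om cid X) \oc induced p \oc (rho g \om cid X)).
Proof.
have -> : n *: (cid a \om at1 p) = (cid a \om p) \oc assoc a a X \oc ((n *: cid (a \ox a)) \om cid X) \oc
    (((cid a \om funit A) \oc runitV a) \om cid X).
  by rewrite omZl om1 !(ocZr, ocZl) cidr; congr (_ *: _); rewrite /at1; diag.
rewrite -(ga_resolution gaA) om_suml !(oc_sumr, oc_suml); apply: eq_bigr => g _.
rewrite /induced; diag.
early (rho g).
drw (fmul1r frA).
by early (rho g^-1%g).
Qed.

Lemma induced_element X Y (p : hom (a \ox X) Y) (y : hom (tunit C) (a \ox X)) :
  induced p \oc y = (cid a \om (p \oc (fmul A \om cid X) \oc assocV a a X \oc (cid a \om y))) \oc
    assoc a a (tunit C) \oc runitV (a \ox a) \oc fcomul A \oc funit A.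
Proof.
rewrite /induced; diag.
late (fcomul A).
late (funit A).
drw (ffrobl frA).
by drw (fmul1l frA).
Qed.

Lemma gsum_algebra : gsum S a = gdim S.
Proof.
rewrite -[RHS]mulr1 -dim_unit /dim -(ga_counit_unit gaA) -traceC -traceZ -omega_algebra.
rewrite /omega trace_sum; apply: eq_bigr => i _.
by rewrite traceZ -[encu _ _]cidr trace_encu.
Qed.

Lemma trace_omega X (p : hom (a \ox X) X) :
  (forall Y, simple Y -> ring A Y = cid (a \ox Y) -> mon (cid Y) (at1 p) = dim Y * trh p) ->
  trace (omega S (a \ox X) \oc (cid a \om at1 p)) = gdim S * trh p.
Proof.
move=> triv; rewrite -gsum_algebra /omega oc_suml trace_sum mulr_suml; apply: eq_bigr => i _.
rewrite ocZl traceZ trace_encu -/(mon _ _) monC mon_tens ?dim_nz // -/(sm _ _) -!mulrA; congr (_ * _).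
(* Either the entry with [A] vanishes, and both sides are zero, or [ring_trivial] makes [triv]
   applicable. *)
rewrite [sm a _]smC; have [->|s0] := eqVneq (sm (S i) a) 0; first by rewrite !mul0r.
rewrite triv //; last by apply: (ring_trivial charF0 gaA) => //; rewrite smC.
by rewrite [dim _ * _]mulrC mulfK ?dim_nz.
Qed.

Lemma invariant_morphism X (p : hom (a \ox X) X) : p \hc p = p -> trh p != 0 ->
  (forall Y, simple Y -> ring A Y = cid (a \ox Y) -> mon (cid Y) (at1 p) = dim Y * trh p) ->
  exists s : hom (a \ox tunit C) X, s != 0 /\ p \hc s = s.
Proof.
move=> pp t0 triv.
have [j j0] : exists j : hom (tunit C) (a \ox X), (cid a \om at1 p) \oc j != 0.
  apply/boolp.not_existsP => all.
  have z (j : hom (tunit C) (a \ox X)) : (cid a \om at1 p) \oc j = 0 by apply/eqP/negPn/negP/all.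
  have [q [i [r e]]] := omega_factor decC schurC simpS unitS (a \ox X).
  have /eqP := trace_omega triv; rewrite (@omega_nat F C rC) e ocZr traceZ oc_sumr trace_sum big1 ?mulr0.
    by rewrite eq_sym mulf_eq0 (negbTE D0) (negbTE t0).
  by move=> k _; rewrite ocA z oc0l trace0.
pose t g := p \oc (fmul A \om cid X) \oc assocV a a X \oc (cid a \om ((rho g \om cid X) \oc j)).
pose s g := lunit X \oc ((fcounit A \oc fmul A) \om cid X) \oc assocV a a X \oc
  (cid a \om ((rho g \om cid X) \oc j)).
have ts g : p \hc s g = t g.
  rewrite /hat_comp /t /s; diag.
  (* The Frobenius relation moves the coproduct behind the product, where the counit in [s g]
     removes it. *)
  late (fcomul A).
  drw (ffrobl frA).
  by drw (fcomul1r frA).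
have [g tg] : exists g, t g != 0.
  apply/boolp.not_existsP => all.
  have z g : t g = 0 by apply/eqP/negPn/negP/all.
  case/eqP: j0; apply: (scalerI (card_nz charF0 gT)); rewrite scaler0 -ocZl induced_resolution oc_suml.
  apply: big1 => g _; rewrite -ocA -[_ \oc induced p \oc _]ocA induced_element.
  by rewrite -/(t g) z om0r !oc0l oc0r.
exists (t g); split=> //.
by rewrite -ts (hat_compA frA) pp.
Qed.

End ModularExtension.

Section Subcategory.
Variables (F : closedFieldType) (C : ribbonData F) (D D' : set C).
Hypothesis sub : forall X, D X -> D' X.

Lemma linear_category_sub : linear_category D' -> linear_category D.
Proof. by case=> *; split=> *; auto. Qed.

Lemma monoidal_category_sub : D (tunit C) -> (forall X Y, D X -> D Y -> D (X \ox Y)) ->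
  monoidal_category D' -> monoidal_category D.
Proof. by move=> u t; case=> *; split=> *; auto. Qed.

End Subcategory.

(** The [R i] need not lie in [D]: each of them is replaced by a simple object of [D] isomorphic to
    it, if there is one whose class is not yet represented. *)
Lemma simple_classes_exist (F : closedFieldType) (K : ribbonData F) (mK : monoidal K) (D : set K)
    (I : finType) (R : I -> K) :
  (forall Y, D Y -> simple Y -> exists i, iso Y (R i)) -> finite_simples D.
Proof.
move=> cover.
have [n [X [sX injX cX]]] : exists n (X : 'I_n -> K), [/\ forall k, D (X k) /\ simple (X k),
    forall k l, iso (X k) (X l) -> k = l &
    forall i Y, i \in enum I -> D Y -> simple Y -> iso Y (R i) -> exists k, iso Y (X k)].
  elim: (enum I) => [|i s [n [X [sX injX cX]]]].
    by exists 0%N, (fun=> tunit K); split=> // -[].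
  have [[Y [DY sY Yi nY]]|no] := boolp.EM (exists Y, [/\ D Y, simple Y, iso Y (R i) & forall k, ~ iso Y (X k)]).
    exists n.+1, (fun k => if unlift ord_max k is Some j then X j else Y); split.
    - by move=> k; case: unliftP => [j _|_].
    - move=> k l; case: unliftP => [j ->|->]; case: unliftP => [j' ->|->] //.
      + by move/injX ->.
      + by move/iso_sym/nY.
      + by move/nY.
    - move=> i' Z; rewrite inE => /orP [/eqP ->|i's] DZ sZ Zi.
        by exists ord_max; rewrite unlift_none; apply: iso_trans Zi (iso_sym Yi).
      have [k Zk] := cX i' Z i's DZ sZ Zi.
      by exists (lift ord_max k); rewrite liftK.
  exists n, X; split=> // i' Z; rewrite inE => /orP [/eqP ->|i's] DZ sZ Zi; last exact: cX Zi.
  apply/boolp.not_existsP => nk; apply: no; exists Z; split=> // k; exact: nk.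
exists n, X; split=> // Y DY sY; have [i Yi] := cover Y DY sY.
by apply: cX Yi; rewrite ?mem_enum.
Qed.

(** * Regularity, splittings and sums in the completion *)

Section KaroubiSemisimple.
Variables (F : closedFieldType) (K : ribbonData F).
Context {mK : monoidal K}.
Local Notation kK := (karoubi K).
Local Notation idem := (@is_idem F K).
Variable D : set (kobj K).
Implicit Types (P Q R : kobj K).
Hypotheses (D_idem : forall P, D P -> idem P) (D1 : D (kunit K))
  (Dt : forall P Q, D P -> D Q -> D (ktens P Q)) (Dd : forall P, D P -> D (kdual P)).

Definition karoubi_sub : ribbonData F := @full_sub F kK D D1 Dt Dd.

Lemma karoubi_sub_linear : linear_category (C := kK) D.
Proof. exact: (linear_category_sub (C := kK) D_idem (@karoubi_linear F K mK)). Qed.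

Lemma karoubi_sub_monoidal_category : monoidal_category (C := kK) D.
Proof. exact: (monoidal_category_sub (C := kK) D_idem D1 Dt (@karoubi_monoidal F K mK)). Qed.

Lemma karoubi_sub_monoidal : monoidal karoubi_sub.
Proof. exact: full_sub_monoidal karoubi_sub_linear karoubi_sub_monoidal_category. Qed.

Lemma karoubi_sub_regular : regular_homs K -> regular_homs karoubi_sub.
Proof.
move=> regK [P dP] [Q dQ] f; have [iP iQ] := (D_idem dP, D_idem dQ).
have [g fgf] := regK _ _ (vsval (f : khom P Q)).
have vg : vsval (kmor (P := Q) (Q := P) (tagged P \oc g \oc tagged Q)) = tagged P \oc g \oc tagged Q.
  by apply: kmor_bi; rewrite ?ocA ?iP // -!ocA iQ.
exists (kmor (P := Q) (Q := P) (tagged P \oc g \oc tagged Q)); apply: vsval_inj.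
rewrite !(val_kcomp (K := K)) // vg -!ocA khom_left // !ocA khom_right //.
Qed.

Hypothesis D_split : forall P (p : khom P P), D P -> vsval p \oc vsval p = vsval p ->
  D (Tagged (fun X => hom X X) (vsval p)).

Lemma karoubi_sub_split : idems_split karoubi_sub.
Proof.
move=> [P dP] p pp; have iP := D_idem dP.
have vpp : vsval (p : khom P P) \oc vsval (p : khom P P) = vsval (p : khom P P).
  by rewrite -[in RHS]pp (val_kcomp (K := K)).
pose Y : kobj K := Tagged (fun X => hom X X) (vsval (p : khom P P)).
have dY : D Y := D_split dP vpp.
have iY : idem Y := D_idem dY.
have vi : vsval (kmor (P := Y) (Q := P) (vsval (p : khom P P))) = vsval (p : khom P P).
  by apply: kmor_bi => //=; rewrite khom_left.
have vr : vsval (kmor (P := P) (Q := Y) (vsval (p : khom P P))) = vsval (p : khom P P).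
  by apply: kmor_bi => //=; rewrite khom_right.
exists (exist _ Y dY), (kmor (P := Y) (Q := P) (vsval (p : khom P P))),
  (kmor (P := P) (Q := Y) (vsval (p : khom P P))); split; apply: vsval_inj.
  by rewrite (val_kcomp (K := K)) // vi vr vpp val_kid.
by rewrite (val_kcomp (K := K)) // vi vr vpp.
Qed.

Lemma karoubi_sums : (forall n (Y : 'I_n -> K), exists Z, direct_sum Z Y) ->
  forall n (Y : 'I_n -> kK), (forall k, idem (Y k)) -> exists Z : kK, idem Z /\ direct_sum Z Y.
Proof.
move=> sumK n Y iY; have [Z [i [p [pi pi0 ip]]]] := sumK n (fun k => tag (Y k)).
pose z := \sum_k (i k \oc tagged (Y k) \oc p k).
have zi k : z \oc i k = i k \oc tagged (Y k).
  rewrite /z oc_suml (bigD1 k) //= big1 ?addr0; first by rewrite -ocA pi cidr.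
  by move=> l lk; rewrite -ocA pi0 // oc0r.
have pz k : p k \oc z = tagged (Y k) \oc p k.
  rewrite /z oc_sumr (bigD1 k) //= big1 ?addr0; first by rewrite !ocA pi cidl.
  by move=> l lk; rewrite !ocA pi0 1?eq_sym // !oc0l.
have zz : z \oc z = z.
  rewrite {2}/z oc_sumr; apply: eq_bigr => k _.
  by rewrite !ocA zi -[_ \oc tagged _ \oc tagged _]ocA iY.
pose Q : kobj K := Tagged (fun X => hom X X) z.
have vi k : vsval (kmor (P := Y k) (Q := Q) (i k \oc tagged (Y k))) = i k \oc tagged (Y k).
  by apply: kmor_bi => /=; rewrite ?ocA ?zi -ocA iY.
have vp k : vsval (kmor (P := Q) (Q := Y k) (tagged (Y k) \oc p k)) = tagged (Y k) \oc p k.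
  by apply: kmor_bi => /=; rewrite ?ocA ?iY // -ocA pz ocA iY.
exists Q; split=> //; exists (fun k => kmor (P := Y k) (Q := Q) (i k \oc tagged (Y k))),
  (fun k => kmor (P := Q) (Q := Y k) (tagged (Y k) \oc p k)).
split=> [k|k l kl|].
- apply: vsval_inj; rewrite val_kcomp // vi vp val_kid // -ocA [p k \oc _]ocA pi cidl.
  exact: iY.
- by apply: vsval_inj; rewrite val_kcomp // vi vp -ocA [p k \oc _]ocA pi0 // oc0l oc0r.
- apply: vsval_inj; rewrite val_kid // linear_sum; apply: eq_bigr => k _.
  by rewrite [LHS]val_kcomp // vi vp !ocA -[_ \oc tagged _ \oc tagged _]ocA iY.
Qed.

Lemma val_direct_sum P n (Y : 'I_n -> kK) : idem P -> (forall k, idem (Y k)) -> direct_sum (C := kK) P Y ->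
  exists (i : forall k, khom (Y k) P) (p : forall k, khom P (Y k)),
    tagged P = \sum_k (vsval (i k) \oc vsval (p k)) /\
    forall k, vsval (p k) \oc vsval (i k) = tagged (Y k).
Proof.
move=> iP iY [i [p [pi _ ip]]]; exists i, p; split.
  rewrite -val_kid // -ip linear_sum; apply: eq_bigr => k _.
  by rewrite [LHS]val_kcomp.
by move=> k; rewrite -val_kcomp // pi val_kid.
Qed.

Lemma karoubi_simple P : idem P -> simple (C := kK) P ->
  tagged P != 0 /\ forall f : hom (tag P) (tag P), tagged P \oc f \oc tagged P = f ->
    exists b, f = b *: tagged P.
Proof.
move=> iP [endo nz]; split.
  by apply/eqP => p0; apply: nz; apply: vsval_inj; rewrite val_kid.
move=> f fP; have [b e] := endo (kmor (P := P) (Q := P) f).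
by exists b; rewrite -(kmorK fP) e linearZ /= val_kid.
Qed.

Lemma karoubi_hom P Q (s : hom (tag P) (tag Q)) : idem P -> idem Q ->
  tagged Q \oc s = s -> s \oc tagged P = s -> s != 0 -> exists f : khom P Q, f != 0.
Proof.
move=> iP iQ sQ sP s0; exists (kmor (P := P) (Q := Q) s).
by apply: contraNneq s0 => f0; rewrite -(kmor_bi sQ sP) f0 linear0.
Qed.

End KaroubiSemisimple.

(** * Grade e *)

Lemma idem_trace (F : closedFieldType) (K : ribbonData F) (rK : rigid K) (X : K) (p s t : hom X X)
    (b : hom (X \ox dual X) (dual X \ox X)) :
  p \oc p = p -> b \oc (p \om transpose p) = (transpose p \om p) \oc b -> t \oc p = p \oc t ->
  p \oc s = s -> s \oc p = s ->
  ev X \oc (transpose p \om p) \oc (b \oc (p \om transpose p)) \oc ((t \oc p) \om transpose p) \oc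
    (s \om transpose p) \oc ((p \om transpose p) \oc coev X) =
  ev X \oc b \oc (t \om cid (dual X)) \oc (s \om cid (dual X)) \oc coev X.
Proof.
move=> pp bp tp ps sp; set q := transpose p.
have qq : q \oc q = q by rewrite -transpose_comp pp.
have absorb (f : hom X X) : (f \om q) \oc coev X = ((f \oc p) \om cid (dual X)) \oc coev X.
  by rewrite -[f in LHS]cidr -[q]cidl omC -[LHS]ocA -coev_transpose ocA -omC cidl.
transitivity (ev X \oc b \oc (((t \oc s) \om q) \oc coev X)); last first.
  by rewrite absorb -[t \oc s \oc p]ocA sp !ocA -[_ \oc (t \om _) \oc (s \om _)]ocA -omC cidl.
rewrite !ocA -[ev X \oc _ \oc b]ocA -bp -!ocA; congr (_ \oc (_ \oc _)).
rewrite !ocA -!omC !qq !ocA pp -tp.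
by rewrite -[t \oc p \oc p]ocA pp -[t \oc p \oc s]ocA ps -[_ \oc s \oc p]ocA sp.
Qed.

Section CentralPart.
Variables (F : closedFieldType) (C : ribbonData F).
Context {rC : ribbon C}.
Variables (A : frobenius C).
Hypotheses (frA : comm_frobenius A) (twA : twist (A : C) = cid (A : C)).
Hypothesis counit_unit : fcounit A \oc funit A = cid (tunit C).
Hypothesis hom1r : forall f : hom (A : C) (tunit C), exists b, f = b *: fcounit A.
Let rrC := @ribbon_ribbon F C rC.
Local Notation a := (A : C).
Local Notation "t \hc s" := (hat_comp (A := A) t s) (at level 45, left associativity).
Local Notation "s \ht t" := (hat_tens (A := A) s t) (at level 40, left associativity).
Local Notation h := (hat A).
Local Notation K := (rtimes0 A).
Local Notation B := (rtimes A).
Implicit Types (X Y Z T : C) (P Q : kobj K).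

Lemma hat_rigid : rigid K.
Proof.
split; first exact: (hat_monoidal frA).
- move=> X; rewrite /= !(hat_tens_hat frA) !(hat_comp_hat frA).
  by rewrite (rigid_zigzag (X : C)).
- move=> X; rewrite /= !(hat_tens_hat frA) !(hat_comp_hat frA).
  by rewrite (rigid_zigzag_dual (X : C)).
Qed.
Local Existing Instance hat_rigid.

Lemma central0 X Y : central (0 : hom (a \ox X) Y).
Proof. by rewrite /central om0r oc0r. Qed.

Lemma central_sum X Y (I : finType) (s : I -> hom (a \ox X) Y) :
  (forall i, central (s i)) -> central (\sum_i s i).
Proof. by move=> cs; rewrite /central om_sumr oc_sumr; apply: eq_bigr => i _; apply: cs. Qed.

Lemma central_unit : central (h (cid (tunit C))).
Proof. by rewrite /central /hat; diag. Qed.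

Definition central_objects : set (kobj K) :=
  [set P : kobj K | is_idem P /\ @central F C A (tag P) (tag P) (tagged P)]%classic.
Local Notation D := central_objects.

Lemma central_ob_idem P : D P -> is_idem P. Proof. by case. Qed.
Lemma central_ob_unit : D (kunit K).
Proof. by split; [exact: idem_unit | exact: central_unit]. Qed.
Lemma central_ob_tens P Q : D P -> D Q -> D (ktens P Q).
Proof.
by move=> [iP cP] [iQ cQ]; split; [exact: idem_tens | exact: (central_htens cP cQ)].
Qed.
Lemma central_ob_dual P : D P -> D (kdual P).
Proof.
by move=> [iP cP]; split; [exact: idem_dual | exact: (central_transpose frA)].
Qed.

Lemma central_khom P Q (s : khom P Q) : D P -> @central F C A (tag P) (tag Q) (vsval s).
Proof.
move=> [iP cP]; rewrite -(khom_right s iP); exact: (central_hcompr frA).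
Qed.

Lemma central_ob_split P (p : khom P P) : D P -> vsval p \oc vsval p = vsval p ->
  D (Tagged (fun X : K => hom X X) (vsval p)).
Proof. by move=> dP pp; split=> //; exact: (central_khom p dP). Qed.

Lemma central_ob_sum P n (Q : 'I_n -> kobj K) : is_idem P -> (forall k, D (Q k)) ->
  direct_sum (C := karoubi K) P Q -> D P.
Proof.
move=> iP dQ PQ; split=> //.
have [i [p [-> _]]] := val_direct_sum iP (fun k => central_ob_idem (dQ k)) PQ.
by apply: central_sum => k; apply: central_hcompl; apply: central_khom.
Qed.

Lemma rtimes0_braidK (X Y : K) : braidV X Y \oc braid X Y = cid (X \ox Y).
Proof. by rewrite /= (hat_comp_hat frA) brK. Qed.
Lemma rtimes0_braidVK (X Y : K) : braid X Y \oc braidV X Y = cid (Y \ox X).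
Proof. by rewrite /= (hat_comp_hat frA) brVK. Qed.
Lemma rtimes0_hexagon (X Y Z : K) : assoc Y Z X \oc braid X (Y \ox Z) \oc assoc X Y Z =
    (cid Y \om braid X Z) \oc assoc Y X Z \oc (braid X Y \om cid Z).
Proof.
rewrite /= !(hat_tens_hat frA) !(hat_comp_hat frA).
by rewrite (hexagon (braided_braided (K := C))).
Qed.
Lemma rtimes0_hexagonV (X Y Z : K) : assocV Z X Y \oc braid (X \ox Y) Z \oc assocV X Y Z =
    (braid X Z \om cid Y) \oc assocV X Z Y \oc (cid X \om braid Y Z).
Proof.
rewrite /= !(hat_tens_hat frA) !(hat_comp_hat frA).
by rewrite (hexagonV (braided_braided (K := C))).
Qed.
Lemma rtimes0_twist_iso (X : K) : is_iso (twist X).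
Proof.
have [t [tK Kt]] := twist_iso rrC (X := (X : C)) I.
by exists (h t); rewrite /= !(hat_comp_hat frA) tK Kt.
Qed.
Lemma rtimes0_twist_tens (X Y : K) : twist (X \ox Y) = braid Y X \oc braid X Y \oc (twist X \om twist Y).
Proof. by rewrite /= (tw_tens (X : C)) !(hat_tens_hat frA) !(hat_comp_hat frA). Qed.
Lemma rtimes0_twist_dual (X : K) : twist (dual X) = transpose (twist X).
Proof.
rewrite /transpose /= !(hat_tens_hat frA) !(hat_comp_hat frA).
by rewrite (twist_dual rrC).
Qed.

Lemma central_braid_nat P P' Q Q' (s : khom P P') (t : khom Q Q') :
    D P -> D P' -> D Q -> D Q' ->
    braid (tag P') (tag Q') \oc (vsval s \om vsval t) =
    (vsval t \om vsval s) \oc braid (tag P) (tag Q).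
Proof. by move=> dP _ _ _; apply: (hat_braid_nat frA); apply: central_khom. Qed.

Lemma central_twist_nat P Q (s : khom P Q) : D P -> D Q ->
    twist (tag Q) \oc vsval s = vsval s \oc twist (tag P).
Proof. by move=> dP _; apply: (hat_twist_nat frA rrC twA); apply: central_khom. Qed.

Lemma central_braided : braided_category (C := B) D.
Proof.
apply: (karoubi_braided central_ob_idem central_ob_tens rtimes0_braidK rtimes0_braidVK rtimes0_hexagon rtimes0_hexagonV central_braid_nat).
Qed.

Lemma central_ribbon : rigid_ribbon_category (C := B) D.
Proof.
exact: (karoubi_ribbon central_ob_idem central_ob_tens central_ob_dual rtimes0_twist_iso rtimes0_twist_tens rtimes0_twist_dual central_braid_nat central_twist_nat).
Qed.

Lemma unit_hom (u : hom (a \ox tunit C) (tunit C)) : exists b, u = b *: h (cid (tunit C)).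
Proof.
have hatE : h (cid (tunit C)) = fcounit A \oc runit a by rewrite /hat; diag.
have [b ub] := hom1r (u \oc runitV a).
by exists b; rewrite hatE -ocZl -ub -ocA ruK cidr.
Qed.

Lemma at1_hat X Y (f : hom X Y) : at1 (h f) = f.
Proof.
rewrite /at1 /hat; diag.
early (fcounit A).
by drw counit_unit.
Qed.

Lemma central_unit_simple : simple (C := B) (tunit B).
Proof.
split=> [f|e].
  have [b fb] := unit_hom (vsval (f : khom (kunit K) (kunit K))).
  by exists b; apply: vsval_inj; rewrite linearZ /= (val_kid (idem_unit (K := K))).
have := @unit_nz F C rC; rewrite -(at1_hat (cid _)).
have <- : vsval (cid (r := B) (tunit B)) = h (cid (tunit C)) by rewrite (val_kid (idem_unit (K := K))).
by rewrite e linear0 /at1 !oc0l eqxx.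
Qed.

Lemma at1_trace X (s : hom (a \ox X) X) : epsbar X \oc (at1 s \om cid (dual X)) \oc coev X =
  at1 (ev X \oc braid X (dual X) \oc (twist X \om cid (dual X)) \oc
    ((s \om cid (dual X)) \oc assocV a X (dual X)) \oc (cid a \om coev X)).
Proof.
rewrite /at1 /epsbar; diag.
by early (funit A).
Qed.

Lemma hat_trace (X : K) (s : hom X X) :
  ev X \oc braid X (dual X) \oc (twist X \om cid (dual X)) \oc (s \om cid (dual X)) \oc coev X =
  @trh F C A X s *: cid (tunit K).
Proof.
rewrite /= !(hat_tens_hat frA) !(hat_comp_hat frA) (hat_comp_hatl frA) (hat_tensr frA) (hat_comp_hatr frA).
set u := (X in X = _).
have [b ub] := unit_hom u; rewrite ub; congr (_ *: _).
apply/esym/scal_uniq.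
have -> : b *: cid (tunit C) = at1 u by rewrite ub /at1 !ocZl -/(at1 _) at1_hat.
exact: at1_trace.
Qed.

Lemma central_trace P (s : khom P P) : D P ->
  epsbar (C := B) P \oc (tensm (r := B) s (cid (r := B) (dual (r := B) P))) \oc coev (r := B) P =
  trh (vsval s) *: cid (r := B) (tunit B).
Proof.
move=> dP; have iP := central_ob_idem dP.
have dQ := central_ob_dual dP; have iQ := central_ob_idem dQ.
have iu : is_idem (kunit K) by apply: idem_unit.
have iT : is_idem (ktens P (kdual P)) by apply: idem_tens.
have iT' : is_idem (ktens (kdual P) P) by apply: idem_tens.
apply: vsval_inj.
rewrite /epsbar !val_kcomp // !val_ktens // !val_kid // val_kev // val_kcoev //.
rewrite (val_kbraid central_ob_idem central_braid_nat) // (val_ktwist central_ob_idem central_twist_nat) //.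
transitivity (@trh F C A (tag P) (vsval s) *: cid (tunit K)); last by rewrite -[cid (tunit K)]/(tagged (kunit K)) -(val_kid iu).
rewrite -hat_trace.
apply: idem_trace => //.
- exact: (karoubi_braid_idem central_ob_idem central_braid_nat dP dQ).
- exact: (karoubi_twist_idem central_ob_idem central_twist_nat dP).
- exact: khom_left.
- exact: khom_right.
Qed.

Lemma val_double_braid P Q : D P -> D Q ->
  vsval (braid (r := B) Q P \oc braid (r := B) P Q \oc (tensm (r := B) (cid (r := B) P) (cid (r := B) Q))) =
  braid (tag Q) (tag P) \oc braid (tag P) (tag Q) \oc (tagged P \om tagged Q).
Proof.
move=> dP dQ; have [iP iQ] := (central_ob_idem dP, central_ob_idem dQ).
have iT : is_idem (ktens P Q) by apply: idem_tens.
have iT' : is_idem (ktens Q P) by apply: idem_tens.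
rewrite !val_kcomp // !val_ktens // !val_kid //.
rewrite !(val_kbraid central_ob_idem central_braid_nat) //.
have e := karoubi_braid_idem central_ob_idem central_braid_nat dP dQ.
have pp : tagged P \oc tagged P = tagged P := iP.
have qq : tagged Q \oc tagged Q = tagged Q := iQ.
rewrite -[LHS]ocA -[_ \oc (_ \om _) \oc (_ \om _)]ocA -omC pp qq e.
rewrite -[LHS]ocA [(tagged Q \om _) \oc (_ \oc _)]ocA -omC qq pp.
by rewrite -e ocA.
Qed.

(** Against the image of an object [Y] of C, the link computed in the extension is the link of
    [at1 p] with [Y] in C; this brings transparency in the extension back to C. *)
Lemma double_braid_trace X Y (p : hom (a \ox X) X) :
  @trh F C A (X \ox Y) (h (braid Y X) \hc h (braid X Y) \hc (p \ht h (cid Y))) = mon (at1 p) (cid Y).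
Proof.
rewrite (hat_comp_hat frA) (hat_comp_hatl frA) (hat_tensr frA) /trh /mon /at1; congr trace.
by diag.
Qed.

Lemma ring_central Y : ring A Y = cid (a \ox Y) -> D (Tagged (fun X : K => hom X X) (h (cid Y))).
Proof.
move=> rY; split; first by rewrite /is_idem /= (hat_comp_hat frA) cidl.
by rewrite /central -/(ring A Y) rY cidl.
Qed.

End CentralPart.

(** * Semisimplicity, finiteness and modularity of the part of grade e *)

Section GaloisExtension.
Variables (F : closedFieldType) (charF0 : [pchar F] =i pred0) (C : ribbonData F).
Context {rC : ribbon C}.
Variables (A : frobenius C) (gT : finGroupType) (rho : gT -> hom (A : C) A).
Hypothesis gaA : galois_algebra rho.
Let frA := ga_frobenius gaA.
Hypothesis sumC : forall n (Y : 'I_n -> C), exists Z, direct_sum Z Y.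
Hypothesis decC : forall X : C, exists n (Y : 'I_n -> C), (forall k, simple (Y k)) /\ direct_sum X Y.
Hypothesis schurC : forall (X Y : C) (f : hom X Y), simple X -> simple Y -> ~ iso X Y -> f = 0.
Variables (m : nat) (S : 'I_m -> C).
Hypothesis simpS : simple_classes [set: C]%classic S.
Hypothesis unitS : Smatrix S \in unitmx.
Local Notation a := (A : C).
Local Notation "t \hc s" := (hat_comp (A := A) t s) (at level 45, left associativity).
Local Notation h := (hat A).
Local Notation K := (rtimes0 A).
Local Notation B := (rtimes A).
Local Notation D := (@central_objects F C A).
Implicit Types (P Q : kobj K) (X Y : C).

Let dim_nz (X : C) : simple X -> dim X != 0 := @modular_dim_nz F C rC m S simpS unitS X.
Let rK : rigid K := hat_rigid frA.
Local Existing Instance rK.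
Let mK : monoidal K := hat_monoidal frA.
Let regK : regular_homs K := rtimes0_regular charF0 gaA (semisimple_regular decC schurC).

(** All idempotents together. Decompositions into simple objects are needed in every grade, so only
    the monoidal structure is used here. *)
Definition idems : ribbonData F :=
  @karoubi_sub F K (@is_idem F K) (@idem_unit F K mK) (@idem_tens F K mK) (@idem_dual F K rK).

Lemma idems_monoidal : monoidal idems.
Proof. exact: karoubi_sub_monoidal. Qed.
Local Existing Instance idems_monoidal.

Lemma idems_regular : regular_homs idems.
Proof. exact: karoubi_sub_regular. Qed.

Lemma idems_splitting : idems_split idems.
Proof. exact: karoubi_sub_split. Qed.

Lemma rtimes_decomposition (P : B) : is_idem P -> exists n (Q : 'I_n -> B),
  (forall k, is_idem (Q k) /\ simple (Q k)) /\ direct_sum P Q.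
Proof.
move=> iP; have [n [Q [sQ PQ]]] := regular_decomposition idems_regular idems_splitting (exist _ P iP : idems).
exists n, (fun k => sval (Q k)); split=> // k.
by split; [exact: svalP | exact: sQ].
Qed.

Lemma rtimes_schur (P Q : B) (f : hom P Q) : is_idem P -> is_idem Q ->
  simple P -> simple Q -> ~ iso P Q -> f = 0.
Proof.
move=> iP iQ sP sQ nPQ.
exact: (regular_schur idems_regular (X := exist _ P iP : idems) (Y := exist _ Q iQ : idems)).
Qed.

Lemma rtimes_simple P : is_idem P -> simple (C := B) P ->
  [/\ (tagged P : @hom F C (a \ox tag P) (tag P)) \hc tagged P = tagged P, tagged P != 0 &
   forall f : @hom F C (a \ox tag P) (tag P), tagged P \hc f \hc tagged P = f ->
    exists b, f = b *: (tagged P : @hom F C (a \ox tag P) (tag P))].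
Proof. by move=> iP sP; have [p0 simp] := karoubi_simple iP sP; split. Qed.

Lemma rtimes_trh P : is_idem P -> simple (C := B) P -> @trh F C A (tag P) (tagged P) != 0.
Proof. by move=> iP sP; have [pp p0 simp] := rtimes_simple iP sP; apply: (trh_simple gaA). Qed.

Lemma Tagged_eta P : Tagged (fun X : K => hom X X) (tagged P) = P.
Proof. by case: P. Qed.

Lemma grade_central_object P : D P -> simple (C := B) P -> grade (P : B) = cid a.
Proof.
move=> [iP cP] sP; rewrite -(Tagged_eta P).
exact: (grade_central gaA cP (rtimes_trh iP sP)).
Qed.

Lemma central_of_grade P : is_idem P -> simple (C := B) P -> grade (P : B) = cid a -> D P.
Proof.
move=> iP sP gP; split=> //; have [pp p0 simp] := rtimes_simple iP sP.
apply: (simple_central charF0 gaA decC schurC dim_nz pp p0 simp).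
by rewrite -[RHS]gP -[in RHS](Tagged_eta P).
Qed.

Lemma central_ob_summand P n (Q : 'I_n -> B) : D P -> (forall k, is_idem (Q k)) -> direct_sum (C := B) P Q ->
  forall k, D (Q k).
Proof.
move=> [iP cP] iQ PQ k; split=> //.
have [i [p [_ pi]]] := val_direct_sum iP iQ PQ.
rewrite -pi; apply: (central_hcompr frA).
by rewrite -(khom_left (i k) iP); apply: central_hcompl.
Qed.

Lemma grade_one : rtimes_grade (cid a) = D.
Proof.
apply/seteqP; split=> P.
  case=> [[iP nP [n [Q [sQ PQ]]]]|[iP zP]].
    apply: (central_ob_sum frA iP _ PQ) => k; have [iQ sQk gQ] := sQ k.
    exact: central_of_grade.
  split=> //; have -> : tagged P = 0.
    by rewrite -(val_kid (K := K) iP) [cid _]zP linear0.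
  exact: central0.
move=> dP; have iP := central_ob_idem dP.
have [zP|nP] := boolp.EM (zero_obj (P : B)); [by right | left].
split=> //; have [n [Q [sQ PQ]]] := rtimes_decomposition iP.
exists n, Q; split=> // k; have [iQ sQk] := sQ k; split=> //.
apply: grade_central_object => //.
by apply: (central_ob_summand dP _ PQ) => l; have [] := sQ l.
Qed.

Let ob_idem P : D P -> is_idem P := @central_ob_idem F C A P.
Let ob_unit : D (kunit K). Proof. exact: central_ob_unit. Qed.
Let ob_tens P Q : D P -> D Q -> D (ktens P Q). Proof. exact: central_ob_tens. Qed.
Let ob_dual P : D P -> D (kdual P). Proof. exact: central_ob_dual. Qed.
Let ob_split P (p : khom P P) : D P -> vsval p \oc vsval p = vsval p ->
  D (Tagged (fun X : K => hom X X) (vsval p)).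
Proof. exact: (central_ob_split frA). Qed.

Definition central_part : ribbonData F := @karoubi_sub F K D ob_unit ob_tens ob_dual.

Lemma hat_direct_sum X n (Y : 'I_n -> C) : direct_sum X Y -> @direct_sum F K X n Y.
Proof.
move=> [i [p [pi pi0 ip]]].
exists (fun l => h (i l)), (fun l => h (p l)); split=> [l|l l' ll'|].
- by rewrite /= (hat_comp_hat frA) pi.
- by rewrite /= (hat_comp_hat frA) pi0 // /hat om0r oc0r.
- transitivity (h (\sum_l (i l \oc p l))); last by rewrite ip.
  by rewrite /hat om_sumr oc_sumr; apply: eq_bigr => l _; apply: (hat_comp_hat frA).
Qed.

Lemma central_semisimple : semisimple_category (C := B) D.
Proof.
split.
- move=> n Y dY.
  have [|Z [iZ ZY]] := karoubi_sums (K := K) _ (fun k => ob_idem (dY k)).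
    by move=> k X; have [Z ZX] := sumC (X : 'I_k -> C); exists Z; apply: hat_direct_sum.
  by exists Z; split=> //; apply: (central_ob_sum frA iZ dY ZY).
- move=> X p dX pp.
  have [Y [i [r e]]] := karoubi_sub_split ob_idem ob_split
    (X := exist _ X dX : central_part) pp.
  by exists (sval Y); split; [exact: svalP | exists i, r].
- move=> P dP; have [n [Q [sQ PQ]]] := rtimes_decomposition (ob_idem dP).
  exists n, Q; split=> // k; have [_ sQk] := sQ k; split=> //.
  by apply: (central_ob_summand dP _ PQ) => l; have [] := sQ l.
- by move=> P Q f dP dQ; apply: rtimes_schur; apply: ob_idem.
Qed.

Lemma central_BTC : BTC (C := B) D.
Proof.
split.
- exact: karoubi_sub_linear ob_idem.
- exact: karoubi_sub_monoidal_category ob_idem ob_unit ob_tens.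
- exact: central_braided.
- exact: (central_ribbon frA (ga_twist gaA)).
- exact: central_semisimple.
- exact: (central_unit_simple frA (ga_counit_unit gaA) (ga_hom1r gaA)).
Qed.

Lemma central_part_ribbon : ribbon central_part.
Proof. by have [lD mD bD rD _ uD] := central_BTC; apply: full_sub_ribbon. Qed.
Local Existing Instance central_part_ribbon.

Definition hat_object X : kobj K := Tagged (fun X : K => hom X X) (h (cid X)).

Lemma hat_object_idem X : is_idem (hat_object X).
Proof. by rewrite /is_idem /= (hat_comp_hat frA) cidl. Qed.

Lemma hom_vanish X Q n (R : 'I_n -> B) : is_idem Q -> (forall l, is_idem (R l)) ->
  direct_sum (C := B) (hat_object X) R -> (forall l (f : khom (R l) Q), f = 0) ->
  forall s : @hom F K X (tag Q), tagged Q \oc s = s -> s = 0.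
Proof.
move=> iQ iR XR van s qs.
have [i [p [e _]]] := val_direct_sum (hat_object_idem X) iR XR.
have -> : s = s \oc tagged (hat_object X) by rewrite [RHS]cidr.
rewrite e oc_sumr big1 // => l _.
have si : s \oc vsval (i l) = 0.
  have <- : vsval (kmor (P := R l) (Q := Q) (s \oc vsval (i l))) = s \oc vsval (i l).
    apply: kmor_bi; first by rewrite ocA qs.
    by rewrite -ocA (khom_right (i l) (iR l)).
  by rewrite (van l (kmor _)) linear0.
by rewrite ocA si oc0l.
Qed.

(** Decomposing the underlying object in C, a simple object of the extension receives a nonzero
    morphism from the image of some [S j]. It is therefore isomorphic to one of the finitely many
    simple summands of these images, which themselves may have any grade. *)
Lemma central_finite : finite_simples (C := B) D.
Proof.
have /boolp.choice [w wP] j : exists w : {n & 'I_n -> B}, (forall k, is_idem (tagged w k) /\ simple (tagged w k)) /\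
    direct_sum (C := B) (hat_object (S j)) (tagged w).
  have [n [Q [sQ jQ]]] := rtimes_decomposition (hat_object_idem (S j)).
  by exists (existT _ n Q).
have wi j k : is_idem (tagged (w j) k) by have [/(_ k) []] := wP j.
pose I := {j : 'I_m & 'I_(tag (w j))}.
pose R (i : I) : idems := exist _ (tagged (w (tag i)) (tagged i)) (wi _ _).
have [|n [X [sX injX cX]]] := simple_classes_exist idems_monoidal
    (D := [set Y : idems | D (sval Y)]%classic) (R := R).
  move=> [Q iQ] /= dQ sQ; apply/boolp.not_existsP => nQ.
  have [pp q0 _] := rtimes_simple iQ sQ; case/eqP: q0.
  have van j (s : @hom F K (S j) (tag Q)) : tagged Q \oc s = s -> s = 0.
    have [sw jw] := wP j.
    apply: (hom_vanish iQ (wi j) jw) => l f.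
    apply: rtimes_schur => //; first by have [] := sw l.
    by move=> /iso_sym QR; apply: (nQ (existT _ j l)).
  have [n [Y [sY QY]]] := decC (tag Q).
  have [i [p [_ _ ip]]] := hat_direct_sum QY.
  rewrite -[LHS]cidr -ip oc_sumr big1 // => k _.
  have [_ _ complS] := simpS; have [j [u [v [vu _]]]] := complS (Y k) Logic.I (sY k).
  have huv : (h v : @hom F K (S j) (Y k)) \oc (h u : @hom F K (Y k) (S j)) = cid (Y k : K).
    by rewrite /= (hat_comp_hat frA) vu.
  suff t0 : tagged Q \oc i k \oc (h v : @hom F K (S j) (Y k)) = 0.
    by rewrite ocA -[_ \oc i k]cidr -huv [X in X \oc p k]ocA t0 !oc0l.
  by apply: (van j); rewrite !ocA; congr (_ \oc _ \oc _).
exists n, (fun k => sval (X k)); split.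
- by move=> k; apply: sX.
- by move=> k l; apply: injX.
- move=> Y dY sY; exact: (cX (exist _ Y (ob_idem dY)) dY sY).
Qed.

Lemma central_part_trace (X : central_part) (s : hom X X) :
  trace s = @trh F C A (tag (sval X)) (vsval (s : khom (sval X) (sval X))).
Proof.
apply: scal_uniq.
exact: (central_trace frA (ga_twist gaA) (ga_counit_unit gaA) (ga_hom1r gaA) s (svalP X)).
Qed.

Lemma central_part_dim (X : central_part) : dim X = @trh F C A (tag (sval X)) (tagged (sval X)).
Proof.
by rewrite /dim central_part_trace (val_kid (ob_idem (svalP X))).
Qed.

(** It suffices to test transparency against images of objects [Y] with trivial ring: these have
    grade e, and they are the ones in the hypothesis of [invariant_morphism]. The nonzero morphism
    from the unit obtained there is an isomorphism by Schur's lemma. *)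
Lemma central_part_center (T : central_part) : simple T ->
  (forall X : central_part, sm T X = dim T * dim X) -> iso T (tunit central_part).
Proof.
case: T => P dP sT cT; have iP := ob_idem dP.
have [pp p0 simp] := rtimes_simple iP sT.
have t0 := rtimes_trh iP sT.
have triv Y : simple Y -> ring A Y = cid (a \ox Y) ->
    mon (cid Y) (@at1 F C A _ _ (tagged P)) = dim Y * @trh F C A (tag P) (tagged P).
  move=> sY rY; have dY : D (hat_object Y) by apply: ring_central.
  have := cT (exist D (hat_object Y) dY).
  rewrite /sm {1}/mon central_part_trace !central_part_dim /= -[RHS]mulrC.
  rewrite [@trh F C A Y _]/trh (at1_hat (ga_counit_unit gaA)) -/(dim Y) => <-.
  rewrite monC -(double_braid_trace frA) /=.
  congr (@trh F C A _ _); apply/esym; exact: (val_double_braid frA dP dY).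
have [s [s0 ps]] := invariant_morphism charF0 gaA decC schurC simpS unitS pp t0 triv.
have [f f0] : exists f : khom (kunit K) P, f != 0.
  apply: (karoubi_hom (P := kunit K) (Q := P) (s := s)) => //; first exact: idem_unit.
  by rewrite [LHS]cidr.
have [//|nT] := boolp.EM (iso (exist D P dP : central_part) (tunit central_part)); case/eqP: f0.
apply: rtimes_schur => //; first exact: idem_unit.
  exact: (central_unit_simple frA (ga_counit_unit gaA) (ga_hom1r gaA)).
by move=> i; apply: nT; apply: (iso_sym (K := central_part)); exact: i.
Qed.

Lemma central_modular : modular (C := B) D.
Proof.
split; first exact: central_BTC.
have [n [X [sX injX cX]]] := central_finite.
exists n, X; split=> //.
have dX k : D (X k) by have [] := sX k.
pose X' k : central_part := exist _ (X k) (dX k).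
have [_ _ _ _ [_ _ decD schurD] _] := central_BTC.
apply: (@Smatrix_unit F central_part _ charF0 _ _ _ n X').
- move=> [P dP]; have [q [Q [sQ PQ]]] := decD P dP.
  have dQ k : D (Q k) by have [] := sQ k.
  by exists q, (fun k => exist _ (Q k) (dQ k)); split=> // k; have [] := sQ k.
- by move=> [P dP] [Q dQ] f sP sQ nPQ; apply: (schurD P Q f).
- move=> [P dP] sP; rewrite central_part_dim; exact: (rtimes_trh (ob_idem dP) sP).
- split.
  + by move=> k; split=> //; have [] := sX k.
  + by move=> k l; apply: injX.
  + by move=> [Y dY] _ sY; apply: (cX Y).
- exact: central_part_center.
Qed.

(** A nonzero sector of some [S j] remains nonzero on a simple summand of the image of [S j], and
    that summand has the grade of the sector. *)
Lemma spectrum_full : full_Gspectrum A.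
Proof.
apply/seteqP; split=> [g []//|g gA]; split=> //.
have [k ->] := ga_aut gaA gA.
have [j jk] := sector_inhabited charF0 gaA decC schurC simpS unitS k.
have [n [Q [sQ jQ]]] := rtimes_decomposition (hat_object_idem (S j)).
have iQ l : is_idem (Q l) by have [] := sQ l.
have [i [p [e _]]] := val_direct_sum (hat_object_idem (S j)) iQ jQ.
have [l lk] : exists l, @sector F C A gT rho k (S j) \hc vsval (i l) != 0.
  apply/boolp.not_existsP => all; case/eqP: jk.
  have -> : sector rho k (S j) = sector rho k (S j) \hc (tagged (hat_object (S j))).
    by rewrite /= (hat_comp_hatr frA) om1 cidr.
  rewrite e [LHS](oc_sumr (K := K)) big1 // => l _; rewrite [LHS]ocA.
  have -> : @comp F K _ _ _ (sector rho k (S j)) (vsval (i l)) = 0 by apply/eqP/negPn/negP/all.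
  exact: oc0l.
have iQl := iQ l; have sQl : simple (Q l) by have [] := sQ l.
have [pp p0 simp] := rtimes_simple iQl sQl.
exists (Q l); split=> //.
  by move=> z; have [_] := sQl; apply.
exists 1%N, (fun=> Q l); split=> [_|].
  split=> //; rewrite -(Tagged_eta (Q l)).
  apply: (simple_grade gaA decC schurC dim_nz pp p0 simp).
  apply: contraNneq lk => z.
  have comm X Y (s : hom (a \ox X) Y) : sector rho k Y \hc s = s \hc sector rho k X.
    by rewrite (sector_nat gaA).
  apply/eqP; rewrite comm -[X in X \hc _](khom_right (i l) iQl) -(hat_compA frA) -comm z.
  by rewrite /hat_comp om0r oc0r !oc0l.
exact: (iso_direct_sum (K := idems) (iso_refl (exist _ (Q l) iQl : idems))).
Qed.

End GaloisExtension.

Theorem corollary3p27 (F : closedFieldType) (charF0 : [pchar F]%R =i pred0)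
  (C : ribbonData F) (strictC : strict C) (modC : modular [set: C]%classic)
  (S : set C) (subS : full_tensor_subcategory S)
  (stcS : STC S) (finS : finite_simples S) (admS : admissible S)
  (gT : finGroupType) (E : rep_functor gT C)
  (equivE : sym_tensor_equivalence S E)
  (A : frobenius C) (SA : S (frob A)) (regA : regular_frobenius E A) :
  full_Gspectrum A /\
  @modular F (rtimes A) (rtimes_grade (cid (frob A))).
Proof.
have [[lC mC bC rrC [sums _ decC schurC] uC] [n [X [simpX unitX]]]] := modC.
have rC : ribbon C by split=> //; split=> //; split.
have [S1 St _ _ _] := subS.
(* Both alternatives of admissibility include the triviality of the twist. *)
have twS : trivial_twist S by case: admS => -[].
have [phi [bij_phi [act mul unit comul counit]]] := regA.
have [rho gaA] : exists rho : gT -> hom (A : C) A, galois_algebra rho.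
  by eexists; apply: (function_galois_algebra charF0 S1 St twS stcS.2 equivE SA bij_phi act mul unit comul counit).
have sumC k (Y : 'I_k -> C) : exists Z, direct_sum Z Y.
  by have [//|Z [_ ZY]] := sums k Y; exists Z.
have decC' (Y : C) : exists k (Z : 'I_k -> C), (forall i, simple (Z i)) /\ direct_sum Y Z.
  by have [//|k [Z [sZ YZ]]] := decC Y; exists k, Z; split=> // i; have [] := sZ i.
have schurC' (Y Z : C) (f : hom Y Z) : simple Y -> simple Z -> ~ iso Y Z -> f = 0%R.
  exact: schurC.
split; first exact: (spectrum_full charF0 gaA decC' schurC' simpX unitX).
rewrite (grade_one charF0 gaA decC' schurC' simpX unitX).
exact: (central_modular charF0 gaA sumC decC' schurC' simpX unitX).
Qed.
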